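(* Let $\mathsf S$ be a full-dimensional simple polytope with the origin in its interior, and let $\Psi=\operatorname{Bar}(\Sigma(\mathsf S))$ be the barycentric subdivision of its normal fan. For all sufficiently small $\epsilon>0$, the set of $\epsilon$-truncations $\{\operatorname{Tr}_\epsilon[\mathsf S,\mathsf F] : \emptyset\subsetneq \mathsf F\subsetneq \mathsf S \text{ a face}\}$ is a polytopal basis for the deformation cone of $\Psi$. The Minkowski sum of these truncations is normally equivalent to an omnitruncation of $\mathsf S$ (i.e. it has the same normal fan). Furthermore, if $\mathsf S$ is smooth with all edges of lattice length $1$, then the deep truncations $\operatorname{DTr}[\mathsf S,\mathsf F]$, $\emptyset\subsetneq\mathsf F\subsetneq\mathsf S$, are all flat truncations, and they form a polytopal basis for the deformation cone of $\Psi$.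
   Context: Conventions. Let $\Lambda$ be a lattice (by default $\mathbb Z^n\subset\mathbb R^n$) and $V=\Lambda\otimes\mathbb R$. Polytopes live in $V$; normal vectors live in $V^*$, which contains the dual lattice $\Lambda^*$ (for $\mathbb R^n$ everything is identified via the dot product). All polytopes are assumed to have rational facet normals. The support function is $h(\mathsf P,u)=\min_{x\in\mathsf P}u\cdot x$. For a nonempty face $\mathsf F$ of $\mathsf P$, its normal cone is $\{u : u\cdot x=h(\mathsf P,u)\ \forall x\in\mathsf F\}$; the normal fan $\Sigma(\mathsf P)$ is the collection of normal cones of all nonempty faces. A fan $\Sigma_2$ coarsens $\Sigma_1$ if every cone of $\Sigma_2$ is a union of cones of $\Sigma_1$. Two polytopes are normally equivalent if they have the same normal fan. Face normals. Let $\mathsf S$ be a full-dimensional simple polytope. For a facet $\mathsf G$, $u_{\mathsf G}\in\Lambda^*$ is its primitive inner normal; for a nonempty proper face $\mathsf F$, $u_{\mathsf F}=\sum_{\mathsf G\supseteq\mathsf F}u_{\mathsf G}$, summed over the facets $\mathsf G$ containing $\mathsf F$. Truncations. For a nonempty proper face $\mathsf F$ and $\epsilon>0$, $\operatorname{Tr}_\epsilon[\mathsf S,\mathsf F]=\{x\in\mathsf S : u_{\mathsf F}\cdot x\ge h(\mathsf S,u_{\mathsf F})+\epsilon\}$. A vertex $y\notin\mathsf F$ is a neighbor of $\mathsf F$ if it is joined by an edge of $\mathsf S$ to a vertex of $\mathsf F$; $\delta_{\mathsf F}=\min\{u_{\mathsf F}\cdot y-h(\mathsf S,u_{\mathsf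 F}) : y\text{ a neighbor of }\mathsf F\}$. The truncation is shallow if $0<\epsilon<\delta_{\mathsf F}$; the deep truncation is $\operatorname{DTr}[\mathsf S,\mathsf F]=\operatorname{Tr}_{\delta_{\mathsf F}}[\mathsf S,\mathsf F]$. A deep truncation is flat if it equals the convex hull of the vertices of $\mathsf S$ not lying in $\mathsf F$. Barycentric subdivision. $\operatorname{Bar}(\Sigma(\mathsf S))$ is the fan whose cones are $\operatorname{Cone}(u_{\mathsf F_1},\dots,u_{\mathsf F_k})$ for all (possibly empty) chains $\mathsf F_1\subsetneq\dots\subsetneq\mathsf F_k$ of nonempty proper faces of $\mathsf S$. Omnitruncation. List the nonempty proper faces as $\mathsf F_1,\dots,\mathsf F_m$ in an order extending inclusion (smaller faces first), let $\mathsf S_0=\mathsf S$, and for numbers $\epsilon_{\mathsf F}>0$ let $\mathsf S_i=\operatorname{Tr}_{\epsilon_{\mathsf F_i}}[\mathsf S_{i-1},\mathsf F_i\cap\mathsf S_{i-1}]$ (truncating in direction $u_{\mathsf F_i}$). If each of these truncations is shallow, $\mathsf S_m$ is called an omnitruncation of $\mathsf S$. Its normal fan is $\operatorname{Bar}(\Sigma(\mathsf S))$. Deformations. For a complete polytopal fan $\Psi$ in $V^*$, $\operatorname{PL}(\Psi)$ is the vector space of functions on $V^*$ that are linear on each cone of $\Psi$. The deformation cone $\operatorname{Def}(\Psi)\subseteq\operatorname{PL}(\Psi)$ is the set of support functions $h(\mathsf Q,\cdot)$ of polytopes $\mathsf Q$ whose normal fan coarsens $\Psi$. A polytopal basis for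 the deformation cone (or deformation space) of $\Psi$ is a collection of polytopes with normal fans coarsening $\Psi$ whose support functions form a basis of $\operatorname{PL}(\Psi)$. Smoothness. A full-dimensional polytope with vertices in $\Lambda$ is smooth (Delzant) if at every vertex the primitive lattice vectors along the incident edges form a basis of $\Lambda$. An edge has lattice length $1$ (is primitive) if its only lattice points are its endpoints. *)

(* Defs.v *)
From HB Require Import structures.
From mathcomp Require Import all_boot all_order all_algebra.
From mathcomp Require Import all_classical all_reals all_analysis.

Set Implicit Arguments.
Unset Strict Implicit.
Unset Printing Implicit Defensive.

Import Order.TTheory GRing.Theory Num.Theory.
Import numFieldNormedType.Exports.

Local Open Scope classical_set_scope.
Local Open Scope ring_scope.

(** [B] is a basis of the submodule [W] of [E]; [E] may be infinite-dimensional
    and [K] need not be a field ([K = int] gives bases of a lattice). *)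
Definition is_basis (K : nzRingType) (E : lmodType K) (B W : set E) : Prop :=
  [/\ B `<=` W,
      (forall (s : seq E) (c : E -> K), uniq s -> [set` s] `<=` B ->
         \sum_(x <- s) c x *: x = 0 -> forall x, x \in s -> c x = 0)
    & (forall w, W w -> exists (s : seq E) (c : E -> K),
         [set` s] `<=` B /\ w = \sum_(x <- s) c x *: x)].

Section Geometry.
Context {R : realType} {n : nat}.

(** [V] is R^n and is identified with its dual through [dot]; the lattice is
    'rV[int]_n, embedded into [V] by [of_lattice]. *)
Local Notation V := 'rV[R]_n.

Definition dot (u x : V) : R := \sum_i u 0 i * x 0 i.

Definition of_lattice (w : 'rV[int]_n) : V := map_mx intr w.

(** This excludes [w = 0] (take [k = 0]). *)
Definition primitive (w : 'rV[int]_n) : Prop :=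
  forall (k : nat) (z : 'rV[int]_n), w = z *+ k -> k = 1%N.

(** Affine dimension: the largest number of linearly independent differences
    [y - x] with [x] a fixed point and [y] any point of [A]; it is 0 for the
    empty set. *)
Definition affdim (A : set V) : nat :=
  \max_(k < n.+1 | `[< exists (x : V) (M : 'M[R]_(k, n)),
     [/\ A x, forall i, A (x + row i M) & row_free M] >]) k.

Definition conv (A : set V) : set V :=
  [set x | exists (k : nat) (p : 'I_k -> V) (a : 'I_k -> R),
     [/\ forall i, A (p i), forall i, 0 <= a i, \sum_i a i = 1
       & x = \sum_i a i *: p i]].

Definition cone (A : set V) : set V :=
  [set x | exists (k : nat) (p : 'I_k -> V) (a : 'I_k -> R),
     [/\ forall i, A (p i), forall i, 0 <= a i & x = \sum_i a i *: p i]].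

(** Only meant for finite collections, because of the finitely supported sum. *)
Definition minkowski_sum (Qs : set (set V)) : set V :=
  [set \sum_(Q \in Qs) x Q |
     x in [set x : set V -> V | forall Q, Qs Q -> Q (x Q)]].

(** On polytopes the infimum is attained. *)
Definition supp (P : set V) : V -> R^o :=
  fun u => inf [set dot u x | x in P].

Definition face_in (P : set V) (u : V) : set V :=
  [set x | P x /\ dot u x = supp P u].

Definition face (P F : set V) : Prop := F !=set0 /\ exists u, F = face_in P u.

Definition proper_face (P F : set V) : Prop := face P F /\ F <> P.

Definition vertex (P : set V) (x : V) : Prop := face P [set x].

Definition edge (P E : set V) : Prop := face P E /\ affdim E = 1%N.

Definition facet (P G : set V) : Prop :=
  face P G /\ (affdim G).+1 = affdim P.

(** Nonempty convex hulls of finite sets whose facets all have an integral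
    (equivalently, rational) normal vector. *)
Definition polytope (P : set V) : Prop :=
  [/\ P !=set0, (exists A : set V, finite_set A /\ P = conv A)
    & forall G, facet P G -> exists w, G = face_in P (of_lattice w)].

Definition full_dimensional (P : set V) : Prop := affdim P = n.

Definition simple (P : set V) : Prop :=
  forall v, vertex P v -> ([set G | facet P G /\ G v] #= `I_(affdim P))%card.

Definition normal_cone (P F : set V) : set V :=
  [set u | forall x, F x -> dot u x = supp P u].

Definition normal_fan (P : set V) : set (set V) :=
  [set normal_cone P F | F in face P].

Definition normally_equivalent (P Q : set V) : Prop :=
  normal_fan P = normal_fan Q.

Definition coarsens (Sigma2 Sigma1 : set (set V)) : Prop :=
  forall C, Sigma2 C ->
    exists2 D : set (set V), D `<=` Sigma1 & C = \bigcup_(c in D) c.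

Definition PL (Psi : set (set V)) : set (V -> R^o) :=
  [set f | forall C, Psi C -> exists w : V, forall u, C u -> f u = dot w u].

Definition polytopal_basis (Psi : set (set V)) (Qs : set (set V)) : Prop :=
  (forall Q, Qs Q -> polytope Q /\ coarsens (normal_fan Q) Psi) /\
  is_basis [set supp Q | Q in Qs] (PL Psi).

(** For a facet of a full-dimensional polytope exactly one vector qualifies;
    it is an inner normal because [supp] is a minimum. *)
Definition facet_normal (S G : set V) : 'rV[int]_n :=
  xget 0 [set w | primitive w /\ G = face_in S (of_lattice w)].

Definition face_normal (S F : set V) : V :=
  of_lattice (\sum_(G \in [set G | facet S G /\ F `<=` G]) facet_normal S G).

(** A chain is given by the set [c] of its members. *)
Definition Bar (S : set V) : set (set V) :=
  [set cone [set face_normal S F | F in c] |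
     c in [set c : set (set V) | c `<=` proper_face S /\
             forall F G, c F -> c G -> F `<=` G \/ G `<=` F]].

Definition truncate (P : set V) (u : V) (e : R) : set V :=
  [set x | P x /\ supp P u + e <= dot u x].

Definition neighbor (P F : set V) (y : V) : Prop :=
  [/\ vertex P y, ~ F y
    & exists x E, [/\ vertex P x, F x, edge P E, E x & E y]].

(** The bound delta_F on shallow truncations. The direction [u] is explicit
    because omnitruncations use normals computed in another polytope than [P]. *)
Definition depth (P F : set V) (u : V) : R :=
  inf [set dot u y - supp P u | y in neighbor P F].

Definition Tr (e : R) (S F : set V) : set V := truncate S (face_normal S F) e.

Definition DTr (S F : set V) : set V := Tr (depth S F (face_normal S F)) S F.

Definition flat_DTr (S F : set V) : Prop :=
  DTr S F = conv [set y | vertex S y /\ ~ F y].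

(** [truncations S e [:: F_1; ..; F_i]] is S_i; all the truncations use the
    directions [face_normal S F_j] computed in [S] itself. *)
Definition truncations (S : set V) (e : set V -> R) (Fs : seq (set V)) : set V :=
  foldl (fun P F => truncate P (face_normal S F) (e F)) S Fs.

Definition omnitruncation (S T : set V) : Prop :=
  exists (Fs : seq (set V)) (e : set V -> R),
    [/\ uniq Fs /\ [set` Fs] = proper_face S,
        (forall F G, F \in Fs -> G \in Fs -> F `<` G ->
           (index F Fs < index G Fs)%N),
        (forall F, F \in Fs ->
           let P := truncations S e (take (index F Fs) Fs) in
           0 < e F < depth P (F `&` P) (face_normal S F))
      & T = truncations S e Fs].

Definition edge_vectors (S : set V) (v : V) : set 'rV[int]_n :=
  [set w | primitive w /\ exists E (t : R),
     [/\ edge S E, E v, 0 < t & E (v + t *: of_lattice w)]].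

Definition smooth (S : set V) : Prop :=
  [/\ full_dimensional S,
      (forall v, vertex S v -> range of_lattice v)
    & forall v, vertex S v -> is_basis (edge_vectors S v) setT].

Definition lattice_length_one (E : set V) : Prop :=
  E `&` range of_lattice = vertex E.

End Geometry.

(* Main.v *)
Require Import Defs.
From mathcomp Require Import all_boot all_order all_algebra.
From mathcomp Require Import all_classical all_reals all_analysis.
From mathcomp Require Import ring lra.

Set Implicit Arguments.
Unset Strict Implicit.
Unset Printing Implicit Defensive.

Import Order.TTheory GRing.Theory Num.Theory.
Import numFieldNormedType.Exports.

Local Open Scope classical_set_scope.
Local Open Scope ring_scope.

(** Let [u_i] be the normals of the facets of [S], and let [b_i < 0] be the values of
    the support function of [S] there. As [S] is simple, its nonempty proper faces
    correspond to the nonempty sets [J] of facets that have a common vertex; the face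
    [F_J] has the normal [u_J], the sum of the [u_i] with [i] in [J], and the support
    function of [S] is [b_J], the sum of the corresponding [b_i], at [u_J]
    ([presentation_exists], [proper_face_of], [face_normal_face_of]). At a vertex,
    the facet normals and the edge directions are dual bases, so that every functional
    is a nonnegative combination of the facet normals at a vertex where it is minimal.
    Sorting the coefficients shows that it lies in the cone of a chain of faces: the
    fan [Bar S] is complete ([Bar_complete]).

    Call a set [P] compatible with values [b'] if [b'_J <= u_J . x] on [P] for all
    faces, and if for every chain some point of [P] attains all these bounds. Then
    the support function of [P] is linear on the cones of [Bar S], its normal fan
    coarsens [Bar S], and its facet normals are face normals; if in addition the point
    can be chosen strictly above [b'_G] for any given face [G] outside the chain, then
    the normal fan is [Bar S] ([compatible_normal_fan]).

    The truncation of [F_J] at height [e] is compatible with the values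
    [b_K + e [J <= K]]: along a chain they are attained at a vertex outside [F_J], or
    else at height [e] on an edge that leaves [F_J] ([compatible_Tr]). A piecewise
    linear function is determined by its values at the [u_K], so the truncations
    form a basis if and only if the square matrix of these values is invertible. Let
    [d_J] be the coefficients of a relation between its rows, with sum [s]. Then
    [d_J + (s / e) b_i], where the second term occurs only for facets [J = {i}], is
    orthogonal to the zeta matrix of the face poset, and therefore zero; summing up,
    [s (e + sum_i b_i) = 0]. So there is a basis unless [e = - sum_i b_i]
    ([trunc_val_free], [trunc_basis]).

    The Minkowski sum is compatible with the sums of the values, and the strict
    inequalities come from the single truncations ([Tr_separates]); its normal fan
    is [Bar S]. For an omnitruncation with this normal fan, the depths are chosen
    successively. At each stage the next truncation can be shallow, because some
    edge leaves every proper face of a polytope ([neighbor_exists]). If moreover the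
    depths decrease quickly, then the minimizing points at each vertex of [S] can be
    written down: they spread the increments of the depths along a chain evenly over
    the facets ([chain_spread], [omnitruncation_normal_fan]).

    If [S] is smooth with primitive edges, then the other end of the edge in the
    direction dual to [u_i] is at height one above facet [i] ([smooth_edge]). So the
    deep truncations are the truncations at height [e = 1], all the minimizing points
    above are vertices of [S], and the truncations are flat. They form a basis because
    there are at least two facets and the [b_i] are negative integers.

    The inequality description of [S] and all separations of points from polytopes
    rest on Gordan's alternative ([gordan]), proved by elimination. *)


(** * Scalar products and small parameters *)

Section Dot.
Context {R : realType} {n : nat}.
Local Notation V := 'rV[R]_n.
Implicit Types u v x y : V.

Lemma dotE u x : dot u x = (u *m x^T) 0 0.
Proof. by rewrite mxE; apply: eq_bigr => i _; rewrite mxE. Qed.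

Lemma dotC u x : dot u x = dot x u.
Proof. by apply: eq_bigr => i _; rewrite mulrC. Qed.

Lemma dotDr u x y : dot u (x + y) = dot u x + dot u y.
Proof. by rewrite !dotE linearD mulmxDr mxE. Qed.

Lemma dotZr u (c : R) x : dot u (c *: x) = c * dot u x.
Proof. by rewrite !dotE linearZ -scalemxAr mxE. Qed.

Lemma dot0r u : dot u 0 = 0.
Proof. by rewrite -(scale0r 0) dotZr mul0r. Qed.

Lemma dotNr u x : dot u (- x) = - dot u x.
Proof. by rewrite -scaleN1r dotZr mulN1r. Qed.

Lemma dotBr u x y : dot u (x - y) = dot u x - dot u y.
Proof. by rewrite dotDr dotNr. Qed.

Lemma dotDl u v x : dot (u + v) x = dot u x + dot v x.
Proof. by rewrite dotC dotDr !(dotC x). Qed.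

Lemma dotZl (c : R) u x : dot (c *: u) x = c * dot u x.
Proof. by rewrite dotC dotZr dotC. Qed.

Lemma dot0l x : dot 0 x = 0.
Proof. by rewrite dotC dot0r. Qed.

Lemma dotNl u x : dot (- u) x = - dot u x.
Proof. by rewrite dotC dotNr dotC. Qed.

Lemma dotBl u v x : dot (u - v) x = dot u x - dot v x.
Proof. by rewrite dotDl dotNl. Qed.

Lemma dot_sumr (I : Type) (r : seq I) (P : pred I) u (F : I -> V) :
  dot u (\sum_(i <- r | P i) F i) = \sum_(i <- r | P i) dot u (F i).
Proof.
by apply: (big_morph (dot u)) => [x y|]; rewrite ?dotDr ?dot0r.
Qed.

Lemma dot_suml (I : Type) (r : seq I) (P : pred I) x (F : I -> V) :
  dot (\sum_(i <- r | P i) F i) x = \sum_(i <- r | P i) dot (F i) x.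
Proof. by rewrite dotC dot_sumr; apply: eq_bigr => i _; rewrite dotC. Qed.

Lemma dot_gt0 x : x != 0 -> 0 < dot x x.
Proof.
move=> x0; have [i xi] : exists i, x 0 i != 0.
  apply/existsP; apply: contraNT x0; rewrite negb_exists => /forallP h.
  by apply/eqP/rowP => i; rewrite mxE; apply/eqP; move: (h i); rewrite negbK.
rewrite /dot (bigD1 i)//= ltr_pwDl//.
  by rewrite -expr2 exprn_even_gt0.
by apply: sumr_ge0 => j _; rewrite -expr2 sqr_ge0.
Qed.

End Dot.

Section Small.
Context {R : realType}.

(** The axiom of choice for [exists2]. *)
Lemma choice2 (A B : Type) (P Q : A -> B -> Prop) :
  (forall x, exists2 y, P x y & Q x y) ->
  exists f : A -> B, forall x, P x (f x) /\ Q x (f x).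
Proof.
move=> h; suff /choice[f hf] : forall x, exists y, P x y /\ Q x y by exists f.
by move=> x; have [y] := h x; exists y.
Qed.

(** Finitely many conditions that hold for all small positive parameters hold
    simultaneously for all small positive parameters. *)
Lemma fin_small (I : finType) (Q : I -> R -> Prop) :
  (forall i, exists2 d : R, 0 < d & forall e, 0 < e < d -> Q i e) ->
  exists2 d : R, 0 < d & forall e, 0 < e < d -> forall i, Q i e.
Proof.
move=> /choice2[d hd].
exists (\big[Num.min/1]_i d i).
  by apply/bigmin_gtP; split=> // i _; case: (hd i).
move=> e /andP[e0 /bigmin_gtP[_ he]] i; apply: (hd i).2.
by rewrite e0 he.
Qed.

Lemma small_pick (P : R -> Prop) :
  (exists2 d : R, 0 < d & forall e, 0 < e < d -> P e) -> exists2 e, 0 < e & P e.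
Proof.
move=> [d d0 hd]; exists (d / 2); first by rewrite divr_gt0.
by apply: hd; rewrite divr_gt0//= ltr_pdivrMr// mulr2n mulrDr mulr1 ltrDl.
Qed.

Lemma lin_small (f g : R) : 0 < f ->
  exists2 d : R, 0 < d & forall e, 0 < e < d -> e * g < f.
Proof.
move=> f0; have g0 : 0 < 1 + `|g| by rewrite ltr_pwDl.
exists (f / (1 + `|g|)); first by rewrite divr_gt0.
move=> e /andP[e0 he]; apply: (@le_lt_trans _ _ (e * (1 + `|g|))).
  by rewrite ler_pM2l// (le_trans (ler_norm g))// lerDr.
by rewrite -ltr_pdivlMr.
Qed.

End Small.

(** * Convex hulls of finite families *)

Section Hull.
Context {R : realType} {n : nat}.
Local Notation V := 'rV[R]_n.

(** The convex hull of the points [a i], [i \in B]. *)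
Definition hull (I : finType) (a : I -> V) (B : {set I}) : set V :=
  [set x | exists2 l : I -> R,
    [/\ forall i, 0 <= l i, forall i, i \notin B -> l i = 0 & \sum_i l i = 1]
    & x = \sum_i l i *: a i].

Section Family.
Variable I : finType.
Implicit Types (a p : I -> V) (B : {set I}).

Lemma conv_hull a B : Defs.conv [set a i | i in [set` B]] = hull a B.
Proof.
apply/seteqP; split=> [x [k [p [l [hp l0 l1 ->]]]]|x [l [l0 lB l1] ->]].
  have [g hg] := choice2 hp.
  exists (fun i => \sum_(j | g j == i) l j).
    split=> [i|i iB|]; first exact: sumr_ge0.
    - rewrite big1// => j /eqP gj; move: iB; rewrite -gj; by case: (hg j) => ->.
    - by rewrite -l1 (partition_big g xpredT).
  rewrite (partition_big g xpredT)//=; apply: eq_bigr => i _.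
  rewrite scaler_suml; apply: eq_bigr => j /eqP <-.
  by case: (hg j) => _ ->.
have off (W : nmodType) (F : I -> W) : (forall i, i \notin B -> F i = 0) ->
    \sum_i F i = \sum_(k < #|B|) F (enum_val k).
  move=> hF; rewrite (bigID (mem B))/= [X in _ + X]big1 ?addr0; last first.
    by move=> i /hF.
  by rewrite (big_enum_val F).
exists #|B|, (a \o enum_val), (l \o enum_val); split=> //=.
- by move=> k; exists (enum_val k) => //; apply: enum_valP.
- by rewrite -l1; apply/esym/off.
- by apply: off => i iB; rewrite lB// scale0r.
Qed.

Lemma hull_mem a B i : i \in B -> hull a B (a i).
Proof.
move=> iB; exists (fun j => (j == i)%:R).
  split=> [j|j jB|]; first by case: eqP.
  - by case: eqP jB => // ->; rewrite iB.
  - by rewrite (bigD1 i)//= eqxx big1 ?addr0// => j /negbTE ->.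
rewrite (bigD1 i)//= eqxx scale1r big1 ?addr0// => j /negbTE ->.
by rewrite scale0r.
Qed.

Lemma hull_ge a B (u : V) (c : R) x :
  (forall i, i \in B -> c <= dot u (a i)) -> hull a B x -> c <= dot u x.
Proof.
move=> h [l [l0 lB l1] ->]; rewrite dot_sumr -[c]mul1r -l1 mulr_suml.
apply: ler_sum => i _; rewrite dotZr.
have [/h iB|/lB ->] := boolP (i \in B); first exact: ler_wpM2l.
by rewrite !mul0r.
Qed.

(** Gordan's alternative, by induction on the family: eliminate one
    vector [p q] along a functional that is positive on the other ones. *)
Lemma gordan B p :
  (exists2 l : I -> R,
    [/\ forall i, 0 <= l i, forall i, i \notin B -> l i = 0 & \sum_i l i = 1]
    & \sum_i l i *: p i = 0) \/
  exists u, forall i, i \in B -> 0 < dot u (p i).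
Proof.
have [k] := ubnP #|B|; elim: k => // k IH in B p *; rewrite ltnS => Bk.
have [->|[q qB]] := set_0Vmem B.
  by right; exists 0 => i; rewrite inE.
have B'k : (#|B :\ q| < k)%N by rewrite (leq_trans _ Bk)// [ltnRHS](cardsD1 q) qB.
have qB' : q \notin B :\ q by rewrite !inE eqxx.
have offB (l : I -> R) : (forall i, i \notin B :\ q -> l i = 0) ->
    forall i, i \notin B -> l i = 0.
  by move=> h i iB; apply: h; rewrite !inE negb_and iB orbT.
have [[l [l0 lB l1] lp]|[u hu]] := IH _ p B'k.
  by left; exists l => //; split=> //; exact: offB.
have inB i : i \in B -> i != q -> i \in B :\ q by rewrite !inE => -> ->.
have [uq|uq|uq] := ltgtP 0 (dot u (p q)).
- right; exists u => i iB; have [->//|iq] := eqVneq i q.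
  exact/hu/inB.
- pose c := - dot u (p q); have c0 : 0 < c by rewrite oppr_gt0.
  pose p' i := c *: p i + dot u (p i) *: p q.
  have up' i : dot u (p' i) = 0.
    by rewrite dotDr !dotZr /c mulNr mulrC addNr.
  have [[l [l0 lB l1] lp]|[u' hu']] := IH _ p' B'k.
    left; have lu0 i : 0 <= l i * dot u (p i).
      have [/hu iB|/lB ->] := boolP (i \in B :\ q); last by rewrite mul0r.
      by rewrite mulr_ge0// ltW.
    pose s := \sum_i l i * dot u (p i).
    have s0 : 0 <= s by apply: sumr_ge0.
    have cs0 : 0 < c + s by rewrite ltr_pwDl.
    exists (fun i => (c + s)^-1 * (c * l i + (i == q)%:R * s)).
      split=> [i|i iB|].
      + apply: mulr_ge0; first by rewrite invr_ge0 ltW.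
        by rewrite addr_ge0// mulr_ge0// ltW.
      + rewrite (offB l)// mulr0 add0r; case: eqP iB => [->|_ _].
          by rewrite qB.
        by rewrite mul0r mulr0.
      + rewrite -mulr_sumr big_split/= -mulr_sumr l1 mulr1 -mulr_suml.
        rewrite (bigD1 q)//= eqxx big1 ?addr0 ?mul1r ?mulVf ?gt_eqF// => i.
        by move=> /negbTE ->.
    under eq_bigr do rewrite -scalerA.
    rewrite -scaler_sumr; apply/eqP; rewrite scaler_eq0; apply/orP; right.
    apply/eqP; rewrite -[RHS]lp.
    under eq_bigr do rewrite scalerDl -(scalerA _%:R).
    under [RHS]eq_bigr do rewrite scalerDr !scalerA (mulrC _ c).
    rewrite !big_split/=; congr (_ + _).
    rewrite -[RHS]scaler_suml -/s (bigD1 q)//= eqxx scale1r big1 ?addr0// => i.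
    by move=> /negbTE ->; rewrite scale0r.
  (* move [u'] along [u] until its value at [p q] is a small positive [e] *)
  right; have /small_pick[e e0 hd] : exists2 d : R, 0 < d & forall e, 0 < e < d ->
      forall i, i \in B :\ q -> e * dot u (p i) < dot u' (p' i).
    apply: fin_small => i; have [/hu' h|_] := boolP (i \in B :\ q).
      by have [d d0 hd] := lin_small (dot u (p i)) h; exists d => // e /hd.
    by exists 1.
  pose w := u' + ((dot u' (p q) - e) / c) *: u.
  have wq : dot w (p q) = e.
    have -> : dot w (p q) = dot u' (p q) + (dot u' (p q) - e) / c * (- c).
      by rewrite dotDl dotZl /c opprK.
    by field; rewrite gt_eqF.
  exists w => i iB; have [->|iq] := eqVneq i q; first by rewrite wq.
  have /hd hi := inB _ iB iq.
  have : dot w (p' i) = dot u' (p' i) by rewrite dotDl dotZl up' mulr0 addr0.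
  rewrite {1}/p' dotDr !dotZr wq => h.
  have : 0 < c * dot w (p i) by nra.
  by rewrite pmulr_rgt0.
have [pq|pq] := eqVneq (p q) 0.
  left; exists (fun i => (i == q)%:R).
    split=> [i|i iB|]; first by case: eqP.
    - by case: eqP iB => // ->; rewrite qB.
    - by rewrite (bigD1 q)//= eqxx big1 ?addr0// => i /negbTE ->.
  rewrite big1// => i _; case: eqP => [->|_]; last by rewrite scale0r.
  by rewrite pq scaler0.
right; have /small_pick[e e0 hd] : exists2 d : R, 0 < d & forall e, 0 < e < d ->
    forall i, i \in B :\ q -> e * - dot (p q) (p i) < dot u (p i).
  apply: fin_small => i; have [/hu h|_] := boolP (i \in B :\ q).
    by have [d d0 hd] := lin_small (- dot (p q) (p i)) h; exists d => // e /hd.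
  by exists 1.
exists (u + e *: p q) => i iB; rewrite dotDl dotZl.
have [->|iq] := eqVneq i q; first by rewrite -uq add0r mulr_gt0// dot_gt0.
by have /hd := inB _ iB iq; lra.
Qed.

(** A point outside the hull of a finite family is strictly separated from it. *)
Lemma hull_sep a B x : ~ hull a B x ->
  exists u, forall i, i \in B -> dot u x < dot u (a i).
Proof.
move=> hx; have [[l [l0 lB l1] lp]|[u hu]] := gordan B (fun i => a i - x).
  case: hx; exists l; first by split.
  move: lp; under eq_bigr do rewrite scalerBr.
  by rewrite sumrB -scaler_suml l1 scale1r => /eqP; rewrite subr_eq0 => /eqP.
by exists u => i /hu; rewrite dotBr subr_gt0.
Qed.

End Family.
End Hull.

(** * Affine dimension *)

Section Affdim.
Context {R : realType} {n : nat}.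
Local Notation V := 'rV[R]_n.
Implicit Types (A G D : set V) (u x y : V).

(** Any independent difference vectors bound the affine dimension from below; a
    maximal family of them is provided by [affdim_wit]. *)
Lemma affdim_ge A x k (M : 'M[R]_(k, n)) :
  A x -> (forall i, A (x + row i M)) -> row_free M -> (k <= affdim A)%N.
Proof.
move=> Ax AM fM; have kn : (k < n.+1)%N.
  by rewrite ltnS; move: fM; rewrite /row_free => /eqP <-; apply: rank_leq_col.
rewrite /affdim -[k]/(nat_of_ord (Ordinal kn)).
by apply: leq_bigmax_cond; apply/asboolP; exists x, M.
Qed.

Lemma affdim_wit A x : A x -> exists y (M : 'M[R]_(affdim A, n)),
  [/\ A y, forall i, A (y + row i M) & row_free M].
Proof.
move=> Ax; pose P (k : 'I_n.+1) := `[< exists y (M : 'M[R]_(k, n)),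
  [/\ A y, forall i, A (y + row i M) & row_free M] >].
have [|k /asboolP[y [M h]] e] :=
  @bigop.eq_bigmax_cond _ (fun k : 'I_n.+1 => P k) (@nat_of_ord n.+1).
  apply/card_gt0P; exists ord0; apply/asboolP; exists x, 0.
  by split=> //; [case | rewrite /row_free mxrank0].
by rewrite /affdim -/P e; exists y, M.
Qed.

Lemma affdim_le A m (D : 'M[R]_(m, n)) :
  (forall x y, A x -> A y -> (y - x <= D)%MS) -> (affdim A <= \rank D)%N.
Proof.
move=> h; apply/bigmax_leqP => k /asboolP[x [M [Ax AM /eqP <-]]].
apply/mxrankS/row_subP => i; have := h _ _ Ax (AM i).
by rewrite addrC addKr.
Qed.

(** A functional that is constant on [G] but not on [D] makes room for one more
    independent direction in [D]. *)
Lemma affdim_lt G D u (c : R) x y : G `<=` D -> G x ->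
  (forall z, G z -> dot u z = c) -> D y -> dot u y != c ->
  (affdim G < affdim D)%N.
Proof.
move=> GD Gx Gc Dy yc; have [z [M [Gz GM fM]]] := affdim_wit Gx.
pose M' := col_mx M (y - z : 'rV_n).
suff : (affdim G + 1 <= affdim D)%N by rewrite addn1.
apply: (@affdim_ge D z _ M'); first exact: GD.
  move=> i; case: (split_ordP i) => j ->.
    by rewrite rowKu; exact/GD/GM.
  by rewrite rowKd row_id addrC subrK.
apply: inj_row_free => v; rewrite -[v]hsubmxK mul_row_col => v0.
have uM : M *m u^T = 0.
  apply/matrixP => i j; rewrite ord1 [RHS]mxE.
  have /eqP := Gc _ (GM i); rewrite dotDr (Gc _ Gz) -subr_eq0 addrAC subrr add0r.
  by rewrite dotC dotE -row_mul mxE => /eqP.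
have r0 : rsubmx v = 0.
  have : (lsubmx v *m M + rsubmx v *m (y - z)) *m u^T = 0 by rewrite v0 mul0mx.
  rewrite mulmxDl -mulmxA uM mulmx0 add0r -mulmxA => h.
  apply/matrixP => i j; rewrite !ord1 [RHS]mxE.
  have : (rsubmx v *m ((y - z) *m u^T)) 0 0 = 0 by rewrite h mxE.
  rewrite mxE big_ord1 -dotE dotC => /eqP; rewrite mulf_eq0 => /orP[/eqP //|].
  by rewrite dotBr (Gc _ Gz) subr_eq0 (negbTE yc).
move: v0; rewrite r0 mul0mx addr0 => l0.
have -> : lsubmx v = 0 by apply: (row_free_inj fM); rewrite l0 mul0mx.
by rewrite row_mx0.
Qed.

Lemma affdim_line A x y (d : V) : A x -> A y -> x != y ->
  (forall z, A z -> exists s : R, z = x + s *: d) -> affdim A = 1%N.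
Proof.
move=> Ax Ay xy h; apply/eqP; rewrite eqn_leq; apply/andP; split.
  apply: (leq_trans _ (rank_leq_row d)); apply: affdim_le => a b.
  move=> /h[s ->] /h[t ->]; rewrite opprD addrACA subrr add0r -scalerBl.
  exact: scalemx_sub.
apply: (@affdim_ge A x _ (y - x)) => //.
  by move=> i; rewrite row_id addrC subrK.
by rewrite /row_free eqn_leq rank_leq_row/= lt0n mxrank_eq0 subr_eq0 eq_sym.
Qed.

End Affdim.

(** * Faces of hulls of finite families *)

Section Faces.
Context {R : realType} {n : nat}.
Local Notation V := 'rV[R]_n.
Implicit Types (P : set V) (u x y : V).

Lemma supp_min P u x : P x -> (forall y, P y -> dot u x <= dot u y) ->
  supp P u = dot u x.
Proof.
move=> Px h; apply/eqP; rewrite eq_le; apply/andP; split.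
  apply: ge_inf; last by exists x.
  by exists (dot u x) => _ [y Py <-]; exact: h.
apply: lb_le_inf; first by exists (dot u x), x.
by move=> _ [y Py <-]; exact: h.
Qed.

Section Family.
Variables (I : finType) (a : I -> V).
Implicit Types B : {set I}.

Lemma hull_nonempty B x : hull a B x -> B != finset.set0.
Proof.
move=> [l [_ lB l1] _]; apply/eqP => B0; move: l1; rewrite big1 => [|i _].
  by move/eqP; rewrite eq_sym oner_eq0.
by rewrite lB// B0 inE.
Qed.

Lemma hull_argmin B u : B != finset.set0 ->
  exists2 i, i \in B & forall x, hull a B x -> dot u (a i) <= dot u x.
Proof.
move=> /set0Pn[i0 i0B]; case: (arg_minP (fun i => dot u (a i)) i0B) => i iB h.
by exists i => // x; exact: hull_ge.
Qed.

(** The members of the family at which [u] is minimal. *)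
Definition argmin B u : {set I} :=
  [set i in B | dot u (a i) == supp (hull a B) u].

Lemma hull_supp_le B u x : hull a B x -> supp (hull a B) u <= dot u x.
Proof.
move=> hx; have [i iB h] := hull_argmin u (hull_nonempty hx).
by rewrite (supp_min (hull_mem a iB) h) h.
Qed.

Lemma argmin_neq0 B u : B != finset.set0 -> argmin B u != finset.set0.
Proof.
move=> /hull_argmin-/(_ u)[i iB h]; apply/set0Pn; exists i.
by rewrite inE iB (supp_min (hull_mem a iB) h)/=.
Qed.

Lemma face_in_hull B u : face_in (hull a B) u = hull a (argmin B u).
Proof.
apply/seteqP; split=> [x [[l [l0 lB l1] xE] ux]|x [l [l0 lB l1] xE]].
  exists l => //; split=> // i; rewrite inE negb_and.
  have [iB|/lB//] := boolP (i \in B); move=> /= ui.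
  have : \sum_i l i * (dot u (a i) - supp (hull a B) u) = 0.
    under eq_bigr do rewrite mulrBr; rewrite sumrB -mulr_suml l1 mul1r -ux xE.
    by rewrite dot_sumr; under [X in _ - X]eq_bigr do rewrite dotZr; rewrite subrr.
  move/eqP; rewrite psumr_eq0 => [/allP/(_ i)|j _].
    rewrite mem_index_enum => /(_ isT)/implyP/(_ isT).
    by rewrite mulf_eq0 subr_eq0 (negbTE ui) orbF => /eqP.
  have [jB|/lB->] := boolP (j \in B); last by rewrite mul0r.
  by rewrite mulr_ge0// subr_ge0 hull_supp_le//; exact: hull_mem.
have lB' i : i \notin B -> l i = 0.
  by move=> iB; apply: lB; rewrite inE (negbTE iB).
split; first by exists l.
rewrite xE dot_sumr -[RHS]mul1r -l1 mulr_suml; apply: eq_bigr => i _.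
rewrite dotZr; have [|/lB->] := boolP (i \in argmin B u); last by rewrite !mul0r.
by rewrite inE => /andP[_ /eqP ->].
Qed.

(** A face of a face is a face: perturb the first functional by a small
    multiple of the second one. *)
Lemma argmin_trans B u u' : B != finset.set0 ->
  exists v, argmin (argmin B u) u' = argmin B v.
Proof.
move=> B0; have := argmin_neq0 u' (argmin_neq0 u B0).
move=> /set0Pn[i]; rewrite inE => /andP[iBu /eqP iu'].
have := iBu; rewrite inE => /andP[iB /eqP iu].
have /small_pick[e e0 hd0] : exists2 d : R, 0 < d & forall e, 0 < e < d ->
    forall j, j \in B :\: argmin B u ->
    e * - dot u' (a j - a i) < dot u (a j - a i).
  apply: fin_small => j; have [jB|_] := boolP (j \in _); last by exists 1.
  have [|d d0 hd] := @lin_small _ (dot u (a j - a i)) (- dot u' (a j - a i)).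
    move: jB; rewrite !inE dotBr iu negb_and => /andP[/orP[/negbTE ->//|h] jB].
    by rewrite subr_gt0 lt_neqAle eq_sym h/= hull_supp_le//; exact: hull_mem.
  by exists d => // e /hd.
have hd j : j \in B :\: argmin B u -> 0 < dot (u + e *: u') (a j - a i).
  by move=> /hd0 h; rewrite dotDl dotZl; move: h; lra.
exists (u + e *: u'); set v := u + _.
have vE j : j \in argmin B u -> dot v (a j - a i) = e * dot u' (a j - a i).
  by rewrite inE dotDl dotZl => /andP[_ /eqP ju]; rewrite [dot u _]dotBr iu ju subrr add0r.
have u'0 j : j \in argmin B u -> 0 <= dot u' (a j - a i).
  by move=> jB; rewrite dotBr subr_ge0 iu' hull_supp_le//; exact: hull_mem.
have iv : supp (hull a B) v = dot v (a i).
  apply: supp_min; first exact: hull_mem.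
  move=> y; apply: hull_ge => j jB; rewrite -subr_ge0 -dotBr.
  have [jBu|jBu] := boolP (j \in argmin B u).
    by rewrite vE// mulr_ge0 ?u'0// ltW.
  by rewrite ltW// hd// inE jBu.
apply/setP => j; rewrite !inE iv.
have [jB|jB] := boolP (j \in B); rewrite /= ?andbF//.
have [jBu|jBu] := boolP (j \in argmin B u).
  have := jBu; rewrite inE jB/= => ->; rewrite /= -iu'.
  rewrite -[LHS]subr_eq0 -dotBr -[RHS]subr_eq0 -dotBr vE//.
  by rewrite mulf_eq0 (gt_eqF e0).
have := jBu; rewrite inE jB/= => /negbTE ->; rewrite /=; apply/esym/negbTE.
by rewrite -subr_eq0 -dotBr gt_eqF// hd// inE jBu.
Qed.

Lemma face_hull B v : B != finset.set0 -> face (hull a B) (hull a (argmin B v)).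
Proof.
move=> B0; rewrite -face_in_hull; split; last by exists v.
have [i iB] := set0Pn _ (argmin_neq0 v B0).
by rewrite face_in_hull; exists (a i); exact: hull_mem.
Qed.

Lemma hull_const B x : B != finset.set0 -> (forall i, i \in B -> a i = x) ->
  hull a B = [set x].
Proof.
move=> /set0Pn[i iB] h; apply/seteqP; split=> [y [l [l0 lB l1] ->]|_ ->] /=.
  rewrite -[RHS]scale1r -l1 scaler_suml; apply: eq_bigr => j _.
  by have [/h->//|/lB->] := boolP (j \in B); rewrite !scale0r.
by rewrite -(h i iB); exact: hull_mem.
Qed.

(** A hull of a finite family is the hull of its vertices: take a subfamily with
    the same hull and as few members as possible; each of its members is then
    separated from the other ones. *)
Lemma hull_vertices B : exists B' : {set I},
  [/\ hull a B' = hull a B, {in B' &, injective a}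
    & forall i, i \in B' -> vertex (hull a B) (a i)].
Proof.
case: (@arg_minnP _ B (fun C => `[< hull a C = hull a B >]) (fun C => #|C|)).
  by apply/asboolP.
move=> C /asboolP CB Cmin; exists C.
have sep i : i \in C -> exists u, forall j, j \in C -> j != i ->
    dot u (a i) < dot u (a j).
  move=> iC; have /hull_sep[u hu] : ~ hull a (C :\ i) (a i).
    move=> hi; have /asboolP/Cmin : hull a (C :\ i) = hull a B; last first.
      by rewrite [leqLHS](cardsD1 i) iC add1n ltnn.
    rewrite -CB; apply/seteqP; split=> x; first last.
      move=> hx; apply: contrapT => /hull_sep[u hu].
      have [j jC hj] := hull_argmin u (hull_nonempty hx).
      have := hj _ hx; rewrite leNgt; case: (eqVneq j i) jC => [->|ji] jC.
        have [k kC hk] := hull_argmin u (hull_nonempty hi).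
        by rewrite (lt_le_trans (hu _ kC) (hk _ hi)).
      by rewrite hu// !inE ji.
    move=> [l [l0 lC l1] ->]; exists l => //; split=> // j jC.
    by apply: lC; rewrite !inE negb_and jC orbT.
  by exists u => j jC ji; apply: hu; rewrite !inE ji.
split=> // [i j iC jC aij|i iC].
  apply/eqP; apply: contraT => ij; have [u hu] := sep i iC.
  by have := hu j jC; rewrite eq_sym ij aij ltxx => /(_ isT).
have [u hu] := sep i iC; rewrite -CB.
suff E : hull a (argmin C u) = [set a i].
  by rewrite /vertex -E; apply: face_hull; apply/set0Pn; exists i.
have ui : supp (hull a C) u = dot u (a i).
  apply: supp_min; first exact: hull_mem.
  move=> y; apply: hull_ge => j jC; have [->//|/hu ji] := eqVneq j i.
  exact/ltW/ji.
apply: hull_const => [|j]; first by apply: argmin_neq0; apply/set0Pn; exists i.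
rewrite inE ui => /andP[jC /eqP uj]; have [->//|/(hu _ jC)] := eqVneq j i.
by rewrite uj ltxx.
Qed.

Lemma vertex_hull B x : vertex (hull a B) x -> exists2 i, i \in B & x = a i.
Proof.
move=> [_ [u e]]; have hx : hull a B x.
  by have : [set x] x by []; rewrite e => -[].
have := argmin_neq0 u (hull_nonempty hx) => /set0Pn[i ih].
exists i; first by move: ih; rewrite inE => /andP[].
by have := hull_mem a ih; rewrite -face_in_hull -e => ->.
Qed.

(** A set that contains the hull of a finite family, and on which every functional
    attains its minimum at a member of this family, is the hull. *)
Lemma eq_hull P B : hull a B `<=` P ->
  (forall u, exists2 i, i \in B & forall x, P x -> dot u (a i) <= dot u x) ->
  P = hull a B.
Proof.
move=> BP h; apply/seteqP; split=> // x Px; apply: contrapT => /hull_sep[u hu].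
have [i iB hi] := h u; have := hi _ Px; by rewrite leNgt hu.
Qed.

End Family.
End Faces.

(** * Neighbors of faces and intersections with half-spaces *)

Section Neighbors.
Context {R : realType} {n : nat}.
Local Notation V := 'rV[R]_n.
Implicit Types (u x y : V).
Variables (I : finType) (a : I -> V).
Implicit Types B : {set I}.

Lemma eq_dot x y : (forall u, dot u x = dot u y) -> x = y.
Proof.
move=> h; apply/eqP; rewrite -subr_eq0; apply: contraT => /dot_gt0.
by rewrite dotBr !h subrr ltxx.
Qed.

Lemma argmin_full B : argmin a B 0 = B.
Proof.
apply/setP => i; rewrite inE; have [iB|//] := boolP (i \in B).
rewrite (@supp_min _ _ _ _ (a i)) ?eqxx//; first exact: hull_mem.
by move=> y _; rewrite !dot0l.
Qed.

(** Some edge leaves every proper face. Among the faces that meet the face [F]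
    of minimizers of [u] without lying in it, one with the fewest generators
    has all of them on a ray: otherwise some functional of the form [w - r *: u]
    would cut out a smaller one. *)
Lemma neighbor_exists B u y0 : hull a B y0 -> dot u y0 != supp (hull a B) u ->
  exists y, neighbor (hull a B) (face_in (hull a B) u) y.
Proof.
move=> hy0 uy0; have B0 := hull_nonempty hy0.
pose c := supp (hull a B) u; pose F := argmin a B u.
have cle i : i \in B -> c <= dot u (a i).
  by move=> iB; apply: hull_supp_le; exact: hull_mem.
have FE i : i \in B -> (i \in F) = (dot u (a i) == c) by rewrite inE => ->.
pose Q (C : {set I}) := `[< exists g, C = argmin a B g >] &&
  ((C :&: F != finset.set0) && (C :\: F != finset.set0)).
have QB : Q B.
  apply/and3P; split; first by apply/asboolP; exists 0; rewrite argmin_full.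
    have [i iF] := set0Pn _ (argmin_neq0 a u B0); apply/set0Pn; exists i.
    by rewrite inE iF andbT; move: iF; rewrite inE => /andP[].
  apply: contraNneq uy0 => /eqP; rewrite finset.setD_eq0 => /fintype.subsetP BF.
  suff : face_in (hull a B) u y0 by case=> _ ->.
  rewrite face_in_hull; have [l [l0 lB l1] ->] := hy0.
  by exists l => //; split=> // i iF; apply: lB; apply: contra iF => /BF.
case: (arg_minnP (fun C : {set I} => #|C|) QB) => C /and3P[/asboolP[g0 CE]].
move=> /set0Pn[i0]; rewrite inE => /andP[i0C i0F].
move=> /set0Pn[j0]; rewrite inE => /andP[j0F j0C] Cmin.
have CB i : i \in C -> i \in B by rewrite CE inE => /andP[].
have C0 : C != finset.set0 by apply/set0Pn; exists i0.
have uF i : i \in C -> i \in F -> dot u (a i) = c.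
  by move=> iC; rewrite FE ?CB// => /eqP.
have uNF i : i \in C -> i \notin F -> 0 < dot u (a i) - c.
  by move=> iC; rewrite FE ?CB// => h; rewrite subr_gt0 lt_neqAle eq_sym h cle// CB.
(* by minimality of [C], every functional is an affine function of [u] on [C] *)
have key w : exists m r, forall i, i \in C -> dot w (a i) = m + r * (dot u (a i) - c).
  have [i1 /andP[i1C i1F] i1min] : exists2 i, (i \in C) && (i \in F) &
      forall j, (j \in C) && (j \in F) -> dot w (a i) <= dot w (a j).
    have h : (i0 \in C) && (i0 \in F) by rewrite i0C.
    by case: (@arg_minP _ _ _ _ (fun i => (i \in C) && (i \in F))
      (fun i => dot w (a i)) h) => i ? ?; exists i.
  pose m := dot w (a i1).
  pose s j := (dot w (a j) - m) / (dot u (a j) - c).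
  have [j1 /andP[j1C j1F] j1min] : exists2 j, (j \in C) && (j \notin F) &
      forall k, (k \in C) && (k \notin F) -> s j <= s k.
    have h : (j0 \in C) && (j0 \notin F) by rewrite j0C.
    by case: (@arg_minP _ _ _ _ (fun i => (i \in C) && (i \notin F)) s h) => i ? ?; exists i.
  pose r := s j1; pose g := w - r *: u.
  have gE k : dot g (a k) = dot w (a k) - r * dot u (a k) by rewrite dotBl dotZl.
  have gi1 : dot g (a i1) = m - r * c by rewrite gE uF.
  have gge k : k \in C -> m - r * c <= dot g (a k).
    move=> kC; rewrite gE; have [kF|kF] := boolP (k \in F).
      by rewrite uF// lerD2r i1min// kC.
    have := j1min k; rewrite kC kF => /(_ isT).
    rewrite -/r ler_pdivlMr ?uNF//; lra.
  have gs : supp (hull a C) g = m - r * c.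
    rewrite -gi1; apply: supp_min; first exact: hull_mem.
    by move=> y; apply: hull_ge => k kC; rewrite gi1 gge.
  have gj1 : dot g (a j1) = m - r * c.
    rewrite gE; have : r * (dot u (a j1) - c) = dot w (a j1) - m.
      by rewrite /r /s divfK// gt_eqF// uNF.
    lra.
  have /Cmin h : Q (argmin a C g).
    apply/and3P; split.
    - by apply/asboolP; rewrite CE; apply: argmin_trans.
    - by apply/set0Pn; exists i1; rewrite finset.in_setI i1F andbT inE i1C gs gi1 eqxx.
    - by apply/set0Pn; exists j1; rewrite finset.in_setD j1F inE j1C gs gj1 eqxx.
  have /setP CC : argmin a C g = C.
    by apply/eqP; rewrite eqEcard h andbT; apply/fintype.subsetP => k; rewrite inE => /andP[].
  exists m, r => k kC; have := CC k; rewrite inE kC gs/= => /eqP.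
  rewrite gE; lra.
have Fx i : i \in C -> i \in F -> a i = a i0.
  move=> iC iF; apply: eq_dot => w; have [m [r h]] := key w.
  by rewrite !h// !uF.
pose d := (dot u (a j0) - c)^-1 *: (a j0 - a i0).
have line i : i \in C -> a i = a i0 + (dot u (a i) - c) *: d.
  move=> iC; apply: eq_dot => w; have [m [r h]] := key w.
  rewrite dotDr !dotZr dotBr !h// (uF i0)// subrr mulr0 addr0.
  by field; rewrite gt_eqF ?uNF.
have [j jC jmax] : exists2 j, j \in C & forall k, k \in C -> dot u (a k) <= dot u (a j).
  by case: (arg_maxP (fun i => dot u (a i)) j0C) => j ? ?; exists j.
(* the neighbor is the generator farthest from [F] on the ray *)
have ujc : c < dot u (a j) by rewrite -subr_gt0 (lt_le_trans (uNF _ j0C j0F))// lerD2r jmax.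
have Vx v : v \in C -> (exists g, forall k, k \in argmin a C g -> a k = a v) ->
    vertex (hull a B) (a v).
  move=> vC [g hg]; have [g' gg'] := @argmin_trans _ _ _ a B g0 g B0.
  have e : hull a (argmin a C g) = [set a v].
    by apply: hull_const => //; exact: argmin_neq0.
  by rewrite /vertex -e CE gg'; exact: face_hull.
exists (a j); split.
- apply: Vx => //; exists (- u) => k; rewrite inE => /andP[kC /eqP].
  rewrite (@supp_min _ _ _ _ (a j)); first last.
  + move=> y; apply: hull_ge => k' k'C; rewrite !dotNl lerN2; exact: jmax.
  + exact: hull_mem.
  by rewrite !dotNl => /eqP; rewrite eqr_opp => /eqP e; rewrite line// e -line.
- by case=> _ /eqP; rewrite gt_eqF.
exists (a i0), (hull a C); split; try exact: hull_mem.
- apply: Vx => //; exists u => k; rewrite inE => /andP[kC /eqP].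
  rewrite (@supp_min _ _ _ _ (a i0)); first last.
  + by move=> y; apply: hull_ge => k' k'C; rewrite uF// cle ?CB.
  + exact: hull_mem.
  by rewrite [RHS]uF// => e; apply: Fx; rewrite ?FE ?CB// e.
- rewrite face_in_hull; exact: hull_mem.
split; first by rewrite CE; exact: face_hull.
apply: (@affdim_line _ _ _ (a i0) (a j) d); try exact: hull_mem.
  by apply: contraTneq ujc => <-; rewrite uF// ltxx.
move=> _ [l [l0 lC l1] ->]; exists (\sum_i l i * (dot u (a i) - c)).
rewrite scaler_suml -[X in X + _]scale1r -l1 scaler_suml -big_split/=.
apply: eq_bigr => i _; have [iC|/lC->] := boolP (i \in C).
  by rewrite [in LHS]line// scalerDr scalerA.
by rewrite mul0r !scale0r addr0.
Qed.

(** The depth is the minimum of finitely many positive numbers. *)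
Lemma depth_gt0 B u y0 : hull a B y0 -> dot u y0 != supp (hull a B) u ->
  0 < depth (hull a B) (face_in (hull a B) u) u.
Proof.
move=> hy0 uy0; have [y1 ny1] := neighbor_exists hy0 uy0.
pose c := supp (hull a B) u.
have pos y : neighbor (hull a B) (face_in (hull a B) u) y ->
    exists2 i, i \in B :\: argmin a B u & y = a i.
  move=> [vy yF _]; have [i iB yE] := vertex_hull vy; exists i => //.
  rewrite inE iB andbT; apply/negP => iu; apply: yF.
  by rewrite face_in_hull yE; exact: hull_mem.
have [i1 i1B y1E] := pos _ ny1.
have [i0 i0B i0min] : exists2 i, i \in B :\: argmin a B u & forall j,
    j \in B :\: argmin a B u -> dot u (a i) <= dot u (a j).
  by case: (arg_minP (fun i => dot u (a i)) i1B) => i ? ?; exists i.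
have : 0 < dot u (a i0) - c.
  move: i0B; rewrite !inE negb_and => /andP[/orP[/negbTE->//|h] iB].
  rewrite subr_gt0 lt_neqAle eq_sym h/=; apply: hull_supp_le; exact: hull_mem.
move/lt_le_trans; apply; apply: lb_le_inf; first by exists (dot u y1 - c), y1.
by move=> _ [y /pos[i iB ->] <-]; rewrite lerD2r i0min.
Qed.

(** Intersecting with a half-space: the new generators are the old ones in the
    half-space, and the points where segments between old generators cross its
    boundary. Suppose that some [w] separates a point [x] of the intersection, with
    weights [l], from them. Weighting the value of [w] at every crossing point yields
    numbers [T i j >= 0] whose sum is not positive; so all of them vanish, and the
    weights are concentrated on one side of the boundary, which is impossible. *)
Lemma hull_halfspace B u c : exists (J : finType) (b : J -> V) (C : {set J}),
  [set x | hull a B x /\ c <= dot u x] = hull b C.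
Proof.
pose b (k : I + I * I) : V := match k with inl i => a i | inr (i, j) =>
  ((c - dot u (a j)) + (dot u (a i) - c))^-1 *:
  ((c - dot u (a j)) *: a i + (dot u (a i) - c) *: a j) end.
pose C : {set I + I * I} := finset (fun k : I + I * I => match k with
  | inl i => (i \in B) && (c <= dot u (a i))
  | inr (i, j) => [&& i \in B, j \in B, c <= dot u (a i) & dot u (a j) < c] end).
exists (I + I * I)%type, b, C; apply/seteqP; split=> x.
  move=> [[l [l0 lB l1] xE] cx]; apply: contrapT => /hull_sep[w hw].
  pose al i := dot u (a i) - c; pose W i := dot w (a i) - dot w x.
  pose P i := c <= dot u (a i).
  have slW : \sum_i l i * W i = 0.
    under eq_bigr do rewrite mulrBr; rewrite sumrB -mulr_suml l1 mul1r xE.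
    by rewrite dot_sumr; under [X in _ - X]eq_bigr do rewrite dotZr; rewrite subrr.
  have slal : 0 <= \sum_i l i * al i.
    under eq_bigr do rewrite mulrBr; rewrite sumrB -mulr_suml l1 mul1r subr_ge0.
    by move: cx; rewrite xE dot_sumr; under eq_bigr do rewrite dotZr.
  have W1 i : i \in B -> P i -> 0 < W i.
    by move=> iB Pi; rewrite subr_gt0; apply: (hw (inl i)); rewrite inE iB.
  have W2 i j : i \in B -> j \in B -> P i -> ~~ P j -> 0 < - al j * W i + al i * W j.
    move=> iB jB Pi; rewrite /P -ltNge => Pj.
    have ai : 0 <= al i by rewrite subr_ge0.
    have aj : 0 < - al j by rewrite oppr_gt0 subr_lt0.
    have : dot w x < dot w (b (inr (i, j))).
      by apply: hw; rewrite inE iB jB Pj andbT.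
    rewrite /b -/(al i) -[c - _]opprB -/(al j) dotZr dotDr !dotZr /W.
    rewrite mulrC ltr_pdivlMr; last by rewrite ltr_pwDl.
    lra.
  pose T i j := l i * l j * (- al j * W i + al i * W j).
  have T0 i j : P i -> ~~ P j -> 0 <= T i j.
    move=> Pi Pj; rewrite /T; have [iB|/lB->] := boolP (i \in B); last by rewrite !mul0r.
    have [jB|/lB->] := boolP (j \in B); last by rewrite mulr0 mul0r.
    by rewrite mulr_ge0 ?mulr_ge0// ltW// W2.
  pose S1 := \sum_(i | P i) l i * al i; pose S2 := \sum_(i | ~~ P i) l i * al i.
  pose Q1 := \sum_(i | P i) l i * W i; pose Q2 := \sum_(i | ~~ P i) l i * W i.
  have S12 : 0 <= S1 + S2 by move: slal; rewrite (bigID P).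
  have Q12 : Q1 + Q2 = 0 by move: slW; rewrite (bigID P).
  have Q1p : forall i, P i -> 0 <= l i * W i.
    move=> i Pi; have [iB|/lB->] := boolP (i \in B); last by rewrite mul0r.
    by rewrite mulr_ge0// ltW// W1.
  have Q10 : 0 <= Q1 by apply: sumr_ge0.
  have sT : \sum_(i | P i) \sum_(j | ~~ P j) T i j = - S2 * Q1 + S1 * Q2.
    rewrite mulNr (mulrC S2) /S1 /S2 /Q1 /Q2 !big_distrlr/= -sumrN -big_split/=.
    apply: eq_bigr => i _; rewrite -sumrN -big_split/=.
    by apply: eq_bigr => j _; rewrite /T; ring.
  have sT0 : \sum_(i | P i) \sum_(j | ~~ P j) T i j = 0.
    apply/eqP; rewrite eq_le; apply/andP; split.
      by rewrite sT; nra.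
    by apply: sumr_ge0 => i Pi; apply: sumr_ge0 => j; exact: T0.
  have TE i j : P i -> ~~ P j -> l i = 0 \/ l j = 0.
    move=> Pi Pj; have /eqP := sT0; rewrite psumr_eq0 => [/allP/(_ i)|k Pk]; last first.
      by apply: sumr_ge0 => k'; exact: T0.
    rewrite mem_index_enum => /(_ isT)/implyP/(_ Pi).
    rewrite psumr_eq0 => [/allP/(_ j)|k Pk]; last exact: T0.
    rewrite mem_index_enum => /(_ isT)/implyP/(_ Pj).
    have [iB|/lB->] := boolP (i \in B); last by left.
    have [jB|/lB->] := boolP (j \in B); last by right.
    rewrite /T mulf_eq0 (gt_eqF (W2 _ _ iB jB Pi Pj)) orbF mulf_eq0.
    by case/orP => /eqP; [left|right].
  have [/existsP[j0 /andP[Pj0 lj0]]|] := boolP [exists j, ~~ P j && (l j != 0)].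
    have S10 : S1 = 0.
      rewrite /S1 big1// => i Pi; have [->|/eqP] := TE _ _ Pi Pj0; first by rewrite mul0r.
      by rewrite (negbTE lj0).
    move: S12; rewrite S10 add0r leNgt => /negP; apply.
    rewrite /S2 (bigD1 j0)//=; set r := \sum_(_ | _) _.
    have r0 : r <= 0.
      apply: sumr_le0 => j /andP[]; rewrite /P -ltNge => jc _.
      by rewrite mulr_ge0_le0// subr_le0 ltW.
    have : l j0 * al j0 < 0; last by lra.
    move: Pj0; rewrite /P -ltNge => jc.
    by rewrite pmulr_rlt0 ?subr_lt0// lt_neqAle eq_sym lj0 l0.
  rewrite negb_exists => /forallP h.
  have l0' j : ~~ P j -> l j = 0.
    by move=> Pj; move: (h j); rewrite Pj/= negbK => /eqP.
  have Q20 : Q2 = 0 by rewrite /Q2 big1// => j /l0' ->; rewrite mul0r.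
  move: Q12; rewrite Q20 addr0 => /eqP; rewrite psumr_eq0// => /allP hl.
  have : \sum_i l i = 0.
    rewrite big1// => i _; have [Pi|/l0'//] := boolP (P i).
    have := hl i; rewrite mem_index_enum => /(_ isT)/implyP/(_ Pi).
    have [iB|/lB->//] := boolP (i \in B).
    by rewrite mulf_eq0 (gt_eqF (W1 _ iB Pi)) orbF => /eqP.
  by move/eqP; rewrite l1 oner_eq0.
move=> hx; split.
  apply: contrapT => /hull_sep[w hw].
  have [k kC hk] := hull_argmin b w (hull_nonempty hx).
  have := hk _ hx; rewrite leNgt => /negP; apply; move: kC; rewrite inE.
  case: k {hk} => [i|[i j]] /=; first by move=> /andP[/hw].
  move=> /and4P[/hw iB /hw jB ci cj].
  have ai : 0 <= dot u (a i) - c by rewrite subr_ge0.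
  have aj : 0 < c - dot u (a j) by rewrite subr_gt0.
  rewrite dotZr dotDr !dotZr mulrC ltr_pdivlMr; last by rewrite ltr_pwDl.
  nra.
apply: hull_ge hx => -[i|[i j]]; rewrite inE; first by case/andP.
move=> /and4P[_ _ ci cj]; rewrite /b dotZr dotDr !dotZr.
rewrite mulrC ler_pdivlMr; first by lra.
by rewrite ltr_pwDl ?subr_gt0// subr_ge0.
Qed.

End Neighbors.

(** * Facets of a full-dimensional polytope *)

Section Facets.
Context {R : realType} {n : nat}.
Local Notation V := 'rV[R]_n.
Implicit Types (S G : set V) (u v x y : V).

(** A finite set is enumerated by a family, and its convex hull is the hull of it. *)
Lemma finite_hull (A : set V) : finite_set A ->
  exists k (a : 'I_k -> V), A = range a /\ Defs.conv A = hull a finset.setT.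
Proof.
move=> /finite_seqP[s ->]; exists (size s), (tnth (in_tuple s)).
have e : [set` s] = range (tnth (in_tuple s)).
  apply/seteqP; split=> x /=; first by move=> /(seq_tnthP)[i ->]; exists i.
  by move=> [i _ <-]; exact: mem_tnth.
split=> //; rewrite e -conv_hull; congr (Defs.conv _).
by apply/seteqP; split=> _ [i _ <-]; exists i => //=; rewrite inE.
Qed.

Lemma interior0_scale S v : interior S 0 -> exists2 t : R, 0 < t & S (t *: v).
Proof.
move=> /nbhs_ballP[e e0 he].
have /small_pick[d d0 hd] : exists2 d : R, 0 < d & forall t, 0 < t < d ->
    forall j, t * `|v 0 j| < e.
  by apply: fin_small => j; exact: lin_small.
exists d => //; apply: he; split=> // i j; rewrite ord1 !mxE -ball_normE/= sub0r normrN normrM.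
by rewrite gtr0_norm// hd.
Qed.

Lemma interior0_lt S v : interior S 0 -> v != 0 -> exists2 y, S y & dot v y < 0.
Proof.
move=> S0 v0; have [t t0 St] := interior0_scale (- v) S0.
exists (t *: - v) => //; rewrite dotZr dotNr mulrN oppr_lt0.
by rewrite mulr_gt0// dot_gt0.
Qed.

Lemma mem0_interior S : interior S 0 -> S 0.
Proof. exact: nbhs_singleton. Qed.

Lemma proper_subspace k (M : 'M[R]_(k, n)) : (k < n)%N ->
  exists2 d : V, d != 0 & forall i, dot d (row i M) = 0.
Proof.
move=> kn; have : kermx M^T != 0.
  rewrite -mxrank_eq0 mxrank_ker mxrank_tr -lt0n subn_gt0.
  exact: leq_ltn_trans (rank_leq_row M) kn.
move=> /rowV0Pn[d /sub_kermxP dM d0]; exists d => // i.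
by rewrite dotE tr_row colE mulmxA dM mul0mx mxE.
Qed.

Lemma affdim_span S y (M : 'M[R]_(affdim S, n)) z :
  S y -> (forall i, S (y + row i M)) -> row_free M -> S z -> (z - y <= M)%MS.
Proof.
move=> Sy SM fM Sz; apply: contraT => zM.
suff : (affdim S + 1 <= affdim S)%N by rewrite addn1 ltnn.
apply: (@affdim_ge _ _ S y _ (col_mx M (z - y))) => //.
  move=> i; case: (split_ordP i) => j ->; first by rewrite rowKu.
  by rewrite rowKd row_id addrC subrK.
have z0 : z - y != 0 by apply: contraNneq zM => ->; exact: sub0mx.
rewrite /row_free -addsmxE mxrank_disjoint_sum.
  by rewrite rank_rV z0 (eqP fM).
apply/eqP; rewrite -submx0; apply/rV_subP => w.
rewrite sub_capmx => /andP[wM /sub_rVP[c wc]]; move: wM; rewrite wc.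
have [->|c0] := eqVneq c 0; first by rewrite scale0r !sub0mx.
move=> h; case/negP: zM; rewrite -[z - y](scalerK c0); exact: scalemx_sub.
Qed.

Lemma affdim_face S u x y : S x -> face_in S u x -> S y -> dot u y != supp S u ->
  (affdim (face_in S u) < affdim S)%N.
Proof.
move=> Sx Sux Sy; apply: (@affdim_lt _ _ _ _ _ _ x) => //.
  by move=> z [].
by move=> z [].
Qed.

(** A point outside [S] violates a facet inequality. Among the functionals that
    separate [x] from [S], normalised by their minimum [-1], take one with the
    largest number of minimizers; if they did not span, it could be tilted until
    another generator is hit. *)
Lemma facet_separation (I : finType) (a : I -> V) (S := hull a finset.setT) x :
  full_dimensional S -> interior S 0 -> ~ S x -> exists v,
  [/\ facet S (face_in S v), dot v x < -1, supp S v = -1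
    & forall d, (forall y, face_in S v y -> dot d y = 0) -> d = 0].
Proof.
move=> fullS S0 Sx; have [v0 hv0] := hull_sep Sx.
have SS0 := mem0_interior S0.
pose Q (C : {set I}) := `[< exists v, [/\ forall i, -1 <= dot v (a i),
  dot v x < -1 & C = finset (fun i => dot v (a i) == -1)] >].
have [C0 QC0] : exists C, Q C.
  have [i _ hi] := hull_argmin a v0 (hull_nonempty SS0).
  have vn0 : v0 != 0.
    by apply/eqP => v00; have := hv0 i; rewrite inE v00 !dot0l ltxx => /(_ isT).
  have [y Sy y0] := interior0_lt S0 vn0.
  have ci : dot v0 (a i) < 0 by rewrite (le_lt_trans (hi _ Sy)).
  pose c := - dot v0 (a i); have c0 : 0 < c by rewrite oppr_gt0.
  exists (finset (fun j => dot (c^-1 *: v0) (a j) == -1)).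
  apply/asboolP; exists (c^-1 *: v0); split=> // [j|].
    rewrite dotZl -[-1](mulKf (lt0r_neq0 c0)) ler_pM2l ?invr_gt0// mulrN1 opprK.
    apply: hi; exact: hull_mem.
  by rewrite dotZl mulrC ltr_pdivrMr// mulN1r opprK hv0.
case: (arg_maxnP (fun C : {set I} => #|C|) QC0) => C /asboolP[v [v1 vx CE]] Cmax.
(* the minimizers span: otherwise move [v] in a direction [e] that vanishes on them
   and does not increase at [x], until a new generator becomes a minimizer *)
have nodir d : (forall i, i \in C -> dot d (a i) = 0) -> d = 0.
  suff h e : (forall i, i \in C -> dot e (a i) = 0) -> dot e x <= 0 -> e = 0.
    move=> dC; have [dx|dx] := leP (dot d x) 0; first exact: h.
    apply/eqP; rewrite -oppr_eq0; apply/eqP/h => [i iC|].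
      by rewrite dotNl dC// oppr0.
    by rewrite dotNl oppr_le0 ltW.
  move=> eC ex; apply/eqP; apply: contraT => e0.
  have [y Sy y0] := interior0_lt S0 e0.
  have [j0 _ hj0] := hull_argmin a e (hull_nonempty SS0).
  have ej0 : dot e (a j0) < 0 by rewrite (le_lt_trans (hj0 _ Sy)).
  pose r j := (dot v (a j) + 1) / - dot e (a j).
  have [j ej jmin] : exists2 j, dot e (a j) < 0 & forall k, dot e (a k) < 0 -> r j <= r k.
    by case: (@arg_minP _ _ _ _ (fun i => dot e (a i) < 0) r ej0) => j ? ?; exists j.
  have r0 : 0 <= r j.
    by rewrite divr_ge0 ?oppr_ge0 ?(ltW ej)// -lerBlDr sub0r v1.
  pose v' := v + r j *: e.
  have v'E k : dot v' (a k) = dot v (a k) + r j * dot e (a k).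
    by rewrite dotDl dotZl.
  have v'j : dot v' (a j) = -1.
    by rewrite v'E /r; field; rewrite lt_eqF.
  pose C' := finset (fun i => dot v' (a i) == -1).
  have /Cmax : Q C'.
    apply/asboolP; exists v'; split=> // [k|].
      rewrite v'E; have [ek|ek] := leP 0 (dot e (a k)).
        by have := v1 k; have := mulr_ge0 r0 ek; lra.
      have := jmin k ek; rewrite ler_pdivlMr ?oppr_gt0//; lra.
    by rewrite dotDl dotZl; have := mulr_ge0_le0 r0 ex; lra.
  move=> /= CC'; suff : (#|C| < #|C'|)%N by rewrite ltnNge CC'.
  apply: proper_card; apply/properP; split.
    apply/fintype.subsetP => i iC; rewrite inE v'E eC// mulr0 addr0.
    by move: iC; rewrite CE inE.
  exists j; first by rewrite inE v'j.
  by apply: contraTN ej => /eC ->; rewrite ltxx.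
have Cn0 : C != finset.set0.
  apply/eqP => C0'; have v00 : v = 0 by apply: nodir => i; rewrite C0' inE.
  by move: vx; rewrite v00 dot0l ltrNr oppr0 ltNge ler01.
have [i0 i0C] := set0Pn _ Cn0.
have i01 : dot v (a i0) = -1 by move: i0C; rewrite CE inE => /eqP.
have sv : supp S v = -1.
  rewrite -i01; apply: supp_min; first by apply: hull_mem; rewrite inE.
  by move=> y; apply: hull_ge => i _; rewrite i01.
have faceC i : i \in C -> face_in S v (a i).
  rewrite CE inE => /eqP iv; split; last by rewrite iv sv.
  by apply: hull_mem; rewrite inE.
have nodir' d : (forall y, face_in S v y -> dot d y = 0) -> d = 0.
  by move=> h; apply: nodir => i /faceC; exact: h.
exists v; split=> //; split.
  by split; [exists (a i0); exact: faceC|exists v].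
have Gx := faceC _ i0C; apply/eqP; rewrite eqn_leq; apply/andP; split.
  apply: (affdim_face Gx.1 Gx SS0).
  by rewrite dot0r sv eq_sym oppr_eq0 oner_eq0.
rewrite fullS leqNgt; apply/negP => kn.
have [y [M [Gy GM fM]]] := affdim_wit Gx.
have [|d d0 dM] := @proper_subspace _ (col_mx M y); first by rewrite addn1.
case/eqP: d0; apply: nodir' => z Gz.
have dy : dot d y = 0 by have := dM (rshift _ 0); rewrite rowKd row_id.
have /submxP[w zw] := affdim_span Gy GM fM Gz.
rewrite -[z](subrK y) dotDr dy addr0 zw mulmx_sum_row dot_sumr big1// => i _.
by rewrite dotZr; have := dM (lshift _ i); rewrite rowKu => ->; rewrite mulr0.
Qed.

End Facets.

Section Lattice.
Context {n : nat}.

(** Every nonzero lattice vector is a multiple of a primitive one. *)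
Lemma primitive_multiple (w : 'rV[int]_n) : w != 0 ->
  exists (z : 'rV[int]_n) (k : nat), [/\ (0 < k)%N, w = z *+ k & primitive z].
Proof.
pose m (w : 'rV[int]_n) := (\sum_i `|w 0%R i|)%N.
have [k] := ubnP (m w); elim: k w => // k IH w; rewrite ltnS => wk w0.
have [pw|] := pselect (primitive w); first by exists w, 1%N.
move=> /existsNP[p /existsNP[z /not_implyP[wz p1]]].
have p0 : p != 0%N by apply: contra_neq w0 => p0; rewrite wz p0.
have z0 : z != 0 by apply: contra_neq w0 => z0; rewrite wz z0 mul0rn.
have mz : (m z < m w)%N.
  have -> : m w = (p * m z)%N.
    rewrite /m big_distrr/=; apply: eq_bigr => i _; rewrite wz mulmxnE.
    by rewrite -mulr_natr abszM natz mulnC.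
  rewrite ltn_Pmull//; first by case: p p0 p1 {wz} => [|[]].
  rewrite lt0n; apply: contra_neq z0 => /eqP; rewrite sum_nat_eq0 => /forallP h.
  by apply/rowP => i; rewrite mxE; apply/eqP; rewrite -absz_eq0; exact: h.
have [z' [q [q0 zE pz']]] := IH z (leq_trans mz wk) z0.
exists z', (q * p)%N; split=> //; first by rewrite muln_gt0 q0 lt0n.
by rewrite wz zE mulrnA.
Qed.

Lemma of_latticeMn {R : realType} (w : 'rV[int]_n) k :
  of_lattice (w *+ k) = k%:R *: of_lattice w :> 'rV[R]_n.
Proof.
by apply/rowP => i; rewrite !mxE mulmxnE raddfMn/= mulr_natl.
Qed.

End Lattice.

(** * Simple polytopes by facets and vertices *)

Section Presentation.
Context {R : realType} {n : nat}.
Local Notation V := 'rV[R]_n.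
Implicit Types (S G : set V) (u v x y : V).

(** [n] vectors that separate the points of an [n]-dimensional space are a basis,
    and have a dual basis. *)
Lemma dual_basis (I : finType) (T : {set I}) (u : I -> V) : #|T| = n ->
  (forall d, (forall i, i \in T -> dot (u i) d = 0) -> d = 0) ->
  exists w : I -> V,
    (forall i j, i \in T -> j \in T -> dot (u j) (w i) = (j == i)%:R) /\
    (forall v, v = \sum_(i in T) dot v (w i) *: u i).
Proof.
move=> Tn Td; pose U := \matrix_(r < #|T|) u (enum_val r).
have UE r j : U r j = u (enum_val r) 0 j by rewrite mxE.
have rUT : row_free U^T.
  apply: inj_row_free => v vU; apply: Td => i iT.
  have /matrixP/(_ 0 (enum_rank_in iT i)) := vU.
  rewrite [LHS]mxE [RHS]mxE /dot => e; rewrite -[RHS]e; apply: eq_bigr => j _.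
  by rewrite [in RHS]mxE UE enum_rankK_in// mulrC.
have rU : \rank U = n by rewrite -mxrank_tr; apply/eqP.
have /row_freeP[W UW] : row_free U by rewrite /row_free rU Tn.
have /row_fullP[W' WU'] : row_full U by rewrite /row_full rU.
have WU : W *m U = 1%:M by rewrite -[W]mul1mx -WU' -(mulmxA W') UW mulmx1.
pose w i : V := \sum_(r | enum_val r == i) (col r W)^T.
have wE r : w (enum_val r) = (col r W)^T.
  by rewrite /w (big_pred1 r)// => s; rewrite /= (inj_eq enum_val_inj).
have dw v r : dot v (w (enum_val r)) = (v *m W) 0 r.
  by rewrite wE dotE trmxK colE mulmxA -colE mxE.
exists w; split=> [i j iT jT|v].
  rewrite -(enum_rankK_in iT iT) -(enum_rankK_in iT jT) dw (inj_eq enum_val_inj).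
  have := congr1 (fun M => fun_of_matrix M (enum_rank_in iT j) (enum_rank_in iT i)) UW.
  rewrite [RHS]mxE => <-; rewrite !mxE; apply: eq_bigr => l _.
  by rewrite UE.
rewrite (big_enum_val (fun i => dot v (w i) *: u i)).
rewrite -{1}[v]mulmx1 -WU mulmxA mulmx_sum_row; apply: eq_bigr => r _.
by rewrite dw; congr (_ *: _); apply/rowP => j; rewrite mxE UE.
Qed.

Lemma hull_supp_scale (I : finType) (a : I -> V) B u (c : R) : B != finset.set0 ->
  0 < c -> supp (hull a B) (c *: u) = c * supp (hull a B) u.
Proof.
move=> B0 c0; have [i iB hi] := hull_argmin a u B0.
rewrite (supp_min (hull_mem a iB) hi) -dotZl; apply: supp_min; first exact: hull_mem.
by move=> y hy; rewrite !dotZl ler_pM2l// hi.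
Qed.

Lemma face_in_scale (I : finType) (a : I -> V) B u (c : R) : B != finset.set0 ->
  0 < c -> face_in (hull a B) (c *: u) = face_in (hull a B) u.
Proof.
move=> B0 c0; apply/seteqP; split=> x [hx].
  rewrite hull_supp_scale// dotZl => h.
  by split=> //; apply: (mulfI (lt0r_neq0 c0)).
by move=> h; split=> //; rewrite dotZl h hull_supp_scale.
Qed.

Lemma face_in0 S : S !=set0 -> face_in S 0 = S.
Proof.
move=> [x Sx]; apply/seteqP; split=> [y []//|y Sy]; split=> //.
by rewrite dot0l (@supp_min _ _ _ _ x)// => [|z _]; rewrite !dot0l.
Qed.

Lemma facet_normal0 S v : S !=set0 -> facet S (face_in S v) -> v != 0.
Proof.
move=> Sn [_]; apply: contra_eqN => /eqP ->; rewrite face_in0//.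
by rewrite -addn1 -[X in _ == X]addn0 eqn_add2l.
Qed.

Lemma facet_normalP S G : polytope S -> facet S G ->
  primitive (facet_normal S G) /\ G = face_in S (of_lattice (facet_normal S G)).
Proof.
move=> [Sn [A [fA SA]] hG] fG; have [w Gw] := hG _ fG.
have [m [a [_ SE]]] := finite_hull fA; rewrite -SA in SE.
have B0 : [set: 'I_m]%SET != finset.set0.
  by have [x Sx] := Sn; apply: (@hull_nonempty _ _ _ a _ x); rewrite -SE.
have w0 : w != 0.
  apply/eqP => w0; move: fG; rewrite Gw w0 => /facet_normal0-/(_ Sn).
  by rewrite /of_lattice map_mx0 eqxx.
have [z [k [k0 wz pz]]] := primitive_multiple w0.
apply: (@xgetPex _ 0 [set w | primitive w /\ G = face_in S (of_lattice w)]).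
exists z; split=> //; rewrite Gw wz of_latticeMn SE face_in_scale//.
by rewrite ltr0n.
Qed.

Lemma finite_facets S : polytope S -> finite_set (facet S).
Proof.
move=> [_ [A [fA SA]] _]; have [m [a [_ SE]]] := finite_hull fA; rewrite -SA in SE.
apply: (@sub_finite_set _ _ (range (fun B : {set 'I_m} => hull a B))).
  move=> G [[_ [u ->]] _]; rewrite SE face_in_hull.
  by exists (argmin a finset.setT u).
by apply: finite_image; exact: finite_finset.
Qed.

(** The inequality description of a full-dimensional polytope. *)
Lemma facet_inequality S x : polytope S -> full_dimensional S -> interior S 0 ->
  ~ S x -> exists2 G, facet S G &
    dot (of_lattice (facet_normal S G)) x < supp S (of_lattice (facet_normal S G)).
Proof.
move=> polyS fullS S0 Sx; have [Sn [A [fA SA]] hG] := polyS.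
have [m [a [_ SE]]] := finite_hull fA; rewrite -SA in SE.
have fullS' := fullS; have S0' := S0; have Sx' := Sx.
rewrite SE in fullS' S0' Sx'.
have [v [fG vx sv dir]] := facet_separation fullS' S0' Sx'.
rewrite -SE in fG sv dir; exists (face_in S v) => //.
have [_ GE] := facet_normalP polyS fG; move: GE; set w := of_lattice _ => GE.
have w0 : w != 0 by apply: (facet_normal0 Sn); rewrite -GE.
have sw0 : supp S w < 0.
  have [y Sy wy] := interior0_lt S0 w0; apply: le_lt_trans wy.
  by move: Sy; rewrite {1 2}SE; exact: hull_supp_le.
have wE : w = (- supp S w) *: v.
  apply/eqP; rewrite -subr_eq0 -scaleNr opprK; apply/eqP/dir => y Gy.
  have vy : dot v y = -1 by rewrite -sv; case: Gy.
  by move: Gy; rewrite GE dotDl dotZl vy => -[_ ->]; rewrite mulrN1 subrr.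
rewrite [X in dot X x]wE dotZl; nra.
Qed.

(** The data describing a simple polytope: the facets are indexed by ['I_fN] and
    have the inner lattice normals [lat i], the vertices are [vtx k], and
    [dual k i] is the direction of the edge at [vtx k] that leaves facet [i]; the
    latter is irrelevant if [vtx k] does not lie in facet [i]. *)
Record simple_data := Data {
  fN : nat; vN : nat;
  lat : 'I_fN -> 'rV[int]_n;
  vtx : 'I_vN -> V;
  dual : 'I_vN -> 'I_fN -> V }.

(** The normal of a facet, and the value of the support function there. *)
Definition nrm D (i : 'I_(fN D)) : V := of_lattice (lat i).

Definition off S D (i : 'I_(fN D)) : R := supp S (nrm i).

(** The facets containing a vertex. *)
Definition tight S D (k : 'I_(vN D)) : {set 'I_(fN D)} :=
  finset (fun i => dot (nrm i) (vtx k) == off S i).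

(** [D] describes [S]: its facet inequalities, its vertices, and at every vertex a
    pair of dual bases formed by the facet normals and the edge directions. *)
Record presents S (D : simple_data) : Prop := Presents {
  pres_ineq : S = [set x | forall i : 'I_(fN D), off S i <= dot (nrm i) x];
  pres_hull : S = hull (@vtx D) finset.setT;
  pres_vertex : forall k, vertex S (@vtx D k);
  pres_dual : forall (k : 'I_(vN D)) i j, i \in tight S k -> j \in tight S k ->
    dot (nrm j) (dual k i) = (j == i)%:R;
  pres_expand : forall (k : 'I_(vN D)) v,
    v = \sum_(i in tight S k) dot v (dual k i) *: nrm i;
  pres_off : forall i : 'I_(fN D), off S i < 0;
  pres_facet : forall i : 'I_(fN D), facet S (face_in S (nrm i));
  pres_facet_inj : injective (fun i : 'I_(fN D) => face_in S (nrm i));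
  pres_all_facets : forall G, facet S G -> exists i : 'I_(fN D), G = face_in S (nrm i);
  pres_normal : forall i : 'I_(fN D), facet_normal S (face_in S (nrm i)) = lat i;
  pres_primitive : forall i : 'I_(fN D), primitive (lat i) }.

Lemma presentation_exists S : polytope S -> full_dimensional S -> simple S ->
  interior S 0 -> exists D, presents S D.
Proof.
move=> polyS fullS simpleS S0; have [Sn [A [fA SA]] hG] := polyS.
have [m0 [a0 [_ SE0]]] := finite_hull fA; rewrite -SA in SE0.
have [B [BE _ Bv]] := hull_vertices a0 finset.setT.
pose a (k : 'I_#|B|) := a0 (enum_val k).
have SE : S = hull a finset.setT.
  rewrite SE0 -BE -!conv_hull; congr (Defs.conv _); apply/seteqP; split=> x.
    move=> [i iB <-]; exists (enum_rank_in iB i); first by rewrite /= inE.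
    by rewrite /a enum_rankK_in.
  by move=> [k _ <-]; exists (enum_val k) => //; exact: enum_valP.
have vS k : vertex S (a k) by rewrite SE0; apply/Bv/enum_valP.
have /finite_seqP[Gs0 GsE0] := finite_facets polyS.
pose Gs := undup Gs0.
have GsE G : G \in Gs <-> facet S G by rewrite mem_undup GsE0.
pose g i := tnth (in_tuple Gs) i.
have gf i : facet S (g i) by apply/GsE/mem_tnth.
have ginj : injective g by apply/tuple_uniqP/undup_uniq.
have gall G : facet S G -> exists i, G = g i.
  by move=> /GsE /(seq_tnthP)[i ->]; exists i.
pose l i := facet_normal S (g i); pose u i : V := of_lattice (l i).
have gE i : g i = face_in S (u i) by have [] := facet_normalP polyS (gf i).
pose b i := supp S (u i).
have supple v x : S x -> supp S v <= dot v x.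
  by rewrite {1 2}SE; exact: hull_supp_le.
have Sa k : S (a k).
  by have [_ [w vw]] := vS k; have : [set a k] (a k) by []; rewrite vw => -[].
have SH : S = [set x | forall i, b i <= dot (u i) x].
  apply/seteqP; split=> [x Sx i|x hx]; first exact: supple.
  apply: contrapT => /(facet_inequality polyS fullS S0)[G /gall[i ->]].
  by rewrite ltNge => /negP; apply; exact: hx.
have b0 i : b i < 0.
  have [|y Sy] := @interior0_lt _ _ S (u i) S0; last exact/le_lt_trans/supple.
  by apply: (facet_normal0 Sn); rewrite -gE; exact: gf.
pose T k := finset (fun i => dot (u i) (a k) == b i).
have TE k i : i \in T k <-> g i (a k).
  rewrite inE gE; split=> [/eqP h|[_ h]]; last exact/eqP.
  by split.
have Tn k : #|T k| = n.
  have := simpleS _ (vS k); rewrite fullS => /card_fset_set sz; apply: (etrans _ sz).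
  have fin : finite_set [set G | facet S G /\ G (a k)].
    by apply: sub_finite_set (finite_facets polyS) => G [].
  rewrite cardE -(size_map g); apply/perm_size/uniq_perm.
  - by rewrite map_inj_uniq ?enum_uniq.
  - exact: finmap.fset_uniq.
  move=> G; rewrite in_fset_set//; apply/mapP/idP.
    move=> [i]; rewrite mem_enum => /TE gi ->.
    by apply/mem_set; split=> //; exact: gf.
  rewrite inE => -[/gall[i ->] gi].
  by exists i => //; rewrite mem_enum; apply/TE.
(* a vector orthogonal to all normals at a vertex would allow to move the vertex
   both ways inside [S] *)
have Td k d : (forall i, i \in T k -> dot (u i) d = 0) -> d = 0.
  move=> hd; have /small_pick[e e0 ht] : exists2 t : R, 0 < t & forall e, 0 < e < t ->
      forall i, i \notin T k -> e * `|dot (u i) d| < dot (u i) (a k) - b i.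
    apply: fin_small => i; have [|iT] := boolP (i \in T k); first by exists 1.
    have [|t t0 ht] := @lin_small _ (dot (u i) (a k) - b i) `|dot (u i) d|.
      rewrite subr_gt0 lt_neqAle supple// andbT eq_sym.
      by move: iT; rewrite inE.
    by exists t => // e /ht.
  have Sad s : `|s| = e -> S (a k + s *: d).
    move=> se; rewrite SH => i; rewrite dotDr dotZr.
    have [iT|iT] := boolP (i \in T k).
      by rewrite hd// mulr0 addr0; move: iT; rewrite inE => /eqP ->.
    have := ht i iT; have := ler_norm (- (s * dot (u i) d)).
    by rewrite normrN normrM se; lra.
  have [_ [w vw]] := vS k.
  have [_ ws] : face_in S w (a k) by rewrite -vw.
  have h1 := supple w _ (Sad e (gtr0_norm e0)).
  have h2 : supp S w <= dot w (a k + (- e) *: d).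
    by apply/supple/Sad; rewrite normrN gtr0_norm.
  have : face_in S w (a k + e *: d).
    split; first exact/Sad/gtr0_norm.
    move: h1 h2; rewrite !dotDr !dotZr -ws mulNr; lra.
  rewrite -vw /= => /eqP; rewrite -subr_eq0 addrAC subrr add0r scaler_eq0.
  by rewrite (gt_eqF e0) => /eqP.
have [dl hdl] := choice (fun k => @dual_basis _ (T k) u (Tn k) (Td k)).
exists (@Data _ _ l a dl); split=> //=.
- by move=> k i j iT jT; exact: (hdl k).1.
- by move=> k v; exact: (hdl k).2.
- by move=> i; rewrite -gE; exact: gf.
- by move=> i j /=; rewrite -!gE; exact: ginj.
- by move=> G /gall[i ->]; exists i; rewrite gE.
- by move=> i; rewrite -gE.
- by move=> i; have [] := facet_normalP polyS (gf i).
Qed.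

End Presentation.

(** * Chains of finite sets *)

Section Chains.
Variable T : finType.
Implicit Types (c : {set {set T}}) (J K : {set T}).

(** Families of sets that are totally ordered by inclusion. *)
Definition chain c := {in c &, forall J K, (J \subset K) || (K \subset J)}.

Lemma chainS c c' : c' \subset c -> chain c -> chain c'.
Proof. by move=> /fintype.subsetP cc ch J K /cc Jc /cc Kc; exact: ch. Qed.

Lemma chain_setU1 c J : chain c -> {in c, forall K, (J \subset K) || (K \subset J)} ->
  chain (J |: c).
Proof.
move=> ch hJ K L; rewrite !finset.in_setU1 => /orP[/eqP->|Kc] /orP[/eqP->|Lc].
- by rewrite subxx.
- exact: hJ.
- by rewrite orbC hJ.
- exact: ch.
Qed.

Lemma chain_top c : chain c -> c != finset.set0 ->
  exists2 K, K \in c & {in c, forall J, J \subset K}.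
Proof.
move=> ch /set0Pn[K0 K0c]; case: (arg_maxnP (fun K : {set T} => #|K|) K0c) => K Kc Kmax.
exists K => // J Jc; have /orP[//|KJ] := ch J K Jc Kc.
have /eqP -> // : K == J by rewrite eqEcard KJ; exact: Kmax.
Qed.

(** Some element of [J] separates the members of a chain that contain [J] from
    those that do not. *)
Lemma chain_pick c J : chain c -> J != finset.set0 ->
  exists2 i, i \in J & {in c, forall K, (i \in K) = (J \subset K)}.
Proof.
move=> ch J0; pose c' := finset (fun K => (K \in c) && ~~ (J \subset K)).
have c'c : c' \subset c by apply/fintype.subsetP => K; rewrite inE => /andP[].
have in1 i K : i \in J -> J \subset K -> i \in K by move=> iJ /fintype.subsetP; exact.
have [c'0|c'0] := eqVneq c' finset.set0.
  have [i iJ] := set0Pn _ J0; exists i => // K Kc.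
  have JK : J \subset K.
    by have /setP/(_ K) := c'0; rewrite !inE Kc/= => /negbFE.
  by rewrite JK (in1 i).
have [L] := chain_top (chainS c'c ch) c'0; rewrite inE => /andP[Lc /subsetPn[i iJ iL]] h.
exists i => // K Kc; have [JK|JK] := boolP (J \subset K); first exact: in1 JK.
apply: contraNF iL => iK; have /fintype.subsetP : K \subset L by apply: h; rewrite inE Kc.
exact.
Qed.

Context {R : realType}.

(** The layer cake decomposition of a nonnegative function. *)
Lemma layer_cake (a : T -> R) : (forall i, 0 <= a i) ->
  exists c (l : {set T} -> R), [/\ chain c,
    {in c, forall J, J != finset.set0 /\ forall i, i \in J -> a i != 0},
    {in c, forall J, 0 < l J} & forall i, a i = \sum_(J in c) l J * (i \in J)%:R].
Proof.
pose su (a : T -> R) := finset (fun i => a i != 0).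
have [k] := ubnP #|su a|; elim: k a => // k IH a; rewrite ltnS => ak a0.
have [s0|s0] := eqVneq (su a) finset.set0.
  exists finset.set0, (fun=> 1); split=> [J K|J|J|i]; rewrite ?inE//.
  rewrite big1 => [|J]; last by rewrite inE.
  by apply/eqP; have /setP/(_ i) := s0; rewrite !inE => /negbFE.
have [i0 i0s] := set0Pn _ s0.
have [i1 i1s i1min] : exists2 i, i \in su a & forall j, j \in su a -> a i <= a j.
  by case: (arg_minP a i0s) => i ? ?; exists i.
have m0 : 0 < a i1 by move: i1s; rewrite inE lt_neqAle eq_sym => ->; exact: a0.
pose a' i := a i - a i1 * (i \in su a)%:R.
have a'0 i : 0 <= a' i.
  rewrite /a'; have [/i1min h|_] := boolP (i \in su a).
    by rewrite mulr1 subr_ge0.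
  by rewrite mulr0 subr0.
have sub : su a' \proper su a.
  apply/properP; split.
    apply/fintype.subsetP => i; rewrite !inE; apply: contra => /eqP ai.
    by rewrite /a' inE ai eqxx mulr0 subr0.
  by exists i1 => //; rewrite inE /a' i1s mulr1 subrr eqxx.
have [c [l [ch hc lc ac]]] := IH a' (leq_trans (proper_card sub) ak) a'0.
have cs J : J \in c -> J \subset su a'.
  by move=> /hc[_ h]; apply/fintype.subsetP => i /h; rewrite inE.
have sc : su a \notin c.
  by apply/negP => /cs; apply/negP; move: sub; rewrite properE => /andP[].
exists (su a |: c), (fun J => if J == su a then a i1 else l J); split.
- apply: chain_setU1 => // J /cs Js; apply/orP; right.
  exact: fintype.subset_trans Js (proper_sub sub).
- move=> J; rewrite finset.in_setU1 => /orP[/eqP->|Jc].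
    by split=> // i; rewrite inE.
  split; first by case: (hc J Jc).
  move=> i iJ; have : i \in su a.
    have /fintype.subsetP := proper_sub sub; apply; move/fintype.subsetP: (cs _ Jc); exact.
  by rewrite inE.
- move=> J; rewrite finset.in_setU1; case: eqP => //= _; exact: lc.
move=> i; rewrite big_setU1//= eqxx.
have -> : a i = a i1 * (i \in su a)%:R + a' i by rewrite /a'; ring.
congr (_ + _); rewrite ac; apply: eq_bigr => J Jc.
by rewrite (_ : (J == su a) = false)//; apply: contraNF sc => /eqP <-.
Qed.

End Chains.

Lemma fsbig_set (T : finType) (W : nmodType) (J : {set T}) (f : T -> W) :
  \sum_(i \in [set` J]) f i = \sum_(i in J) f i.
Proof.
rewrite (@fsbig_fwiden _ _ _ _ (enum J)) ?big_enum ?enum_uniq//.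
  by move=> i /=; rewrite mem_enum.
by move=> i [/=]; rewrite mem_enum.
Qed.

(** * Faces of simple polytopes *)

Section SimpleFaces.
Context {R : realType} {n : nat}.
Local Notation V := 'rV[R]_n.
Variables (S : set V) (D : @simple_data R n).
Local Notation N := 'I_(fN D).
Implicit Types (J K : {set N}) (x y v : V) (k : 'I_(vN D)).

(** Faces are encoded by the sets [J] of the facets that contain them, so that
    inclusion is reversed. The vector [nrm_sum J] is the normal of the face. *)
Definition nrm_sum J : V := \sum_(i in J) nrm i.

(** The value at [nrm_sum J] of the support function of [S]. *)
Definition off_sum J : R := \sum_(i in J) off S i.

(** The intersection of the facets in [J]; this is [S] if [J] is empty. *)
Definition face_of J : set V :=
  [set x | S x /\ forall i, i \in J -> dot (nrm i) x = off S i].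

(** The sets [J] that encode nonempty proper faces: nonempty sets of facets with
    a common vertex. *)
Definition Delta J := (J != finset.set0) && [exists k : 'I_(vN D), J \subset tight S k].

Hypothesis p : presents S D.

Lemma hull_neq0 x : S x -> [set: 'I_(vN D)]%SET != finset.set0.
Proof. by rewrite (pres_hull p); exact: hull_nonempty. Qed.

Lemma S_off x (i : N) : S x -> off S i <= dot (nrm i) x.
Proof. by rewrite {1}(pres_ineq p); exact. Qed.

Lemma supp_le v x : S x -> supp S v <= dot v x.
Proof. by rewrite {1 2}(pres_hull p); exact: hull_supp_le. Qed.

Lemma S_vtx k : S (@vtx _ _ D k).
Proof. by rewrite (pres_hull p); apply: hull_mem; rewrite inE. Qed.

Lemma S_argmin v x : S x ->
  exists k : 'I_(vN D), forall y, S y -> dot v (vtx k) <= dot v y.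
Proof.
move=> /hull_neq0 h; have [k _ hk] := hull_argmin (@vtx _ _ D) v h.
by exists k => y Sy; apply: hk; rewrite -(pres_hull p).
Qed.

Lemma tightP k i : reflect (dot (nrm i) (vtx k) = off S i) (i \in tight S k).
Proof. by rewrite inE; exact: eqP. Qed.

Lemma nrm_sum_ge J x : S x -> off_sum J <= dot (nrm_sum J) x.
Proof. by move=> Sx; rewrite dot_suml; apply: ler_sum => i _; exact: S_off. Qed.

Lemma nrm_sum_eq J x : S x -> (dot (nrm_sum J) x = off_sum J) <->
  (forall i, i \in J -> dot (nrm i) x = off S i).
Proof.
move=> Sx; split=> [h i iJ|h]; last by rewrite dot_suml; exact: eq_bigr.
have : \sum_(j in J) (dot (nrm j) x - off S j) = 0.
  by rewrite sumrB -dot_suml; apply/eqP; rewrite subr_eq0; apply/eqP.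
move/eqP; rewrite psumr_eq0 => [/allP/(_ i)|j _]; last by rewrite subr_ge0 S_off.
by rewrite mem_index_enum => /(_ isT)/implyP/(_ iJ); rewrite subr_eq0 => /eqP.
Qed.

Lemma nrm_sum_vtx J k : J \subset tight S k -> dot (nrm_sum J) (vtx k) = off_sum J.
Proof.
move=> /fintype.subsetP Jk; apply/nrm_sum_eq; first exact: S_vtx.
by move=> i /Jk/tightP.
Qed.

Lemma nrm_sum_vtx_gt J k : ~~ (J \subset tight S k) -> off_sum J < dot (nrm_sum J) (vtx k).
Proof.
move=> /subsetPn[i iJ ik]; rewrite lt_neqAle nrm_sum_ge ?andbT; last exact: S_vtx.
apply: contra ik => /eqP h; apply/tightP; move: i iJ; apply/nrm_sum_eq; first exact: S_vtx.
by rewrite h.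
Qed.

Lemma nrm_sum_dual J k i : i \in tight S k -> J \subset tight S k ->
  dot (nrm_sum J) (dual k i) = (i \in J)%:R.
Proof.
move=> ik /fintype.subsetP Jk; rewrite dot_suml.
under eq_bigr => j jJ do rewrite (pres_dual p ik (Jk _ jJ)).
have [iJ|iJ] := boolP (i \in J).
  rewrite (bigD1 i)//= eqxx big1 ?addr0// => j /andP[_ /negbTE ->//].
by rewrite big1// => j jJ; case: eqP jJ iJ => // -> ->.
Qed.

(** The point at heights [t i] above the facets [i] that contain a vertex. *)
Definition shift k (t : N -> R) : V := vtx k + \sum_(i in tight S k) t i *: dual k i.

Lemma nrm_sum_shift J k t : J \subset tight S k ->
  dot (nrm_sum J) (shift k t) = off_sum J + \sum_(i in J) t i.
Proof.
move=> Jk; rewrite dotDr nrm_sum_vtx// dot_sumr; congr (_ + _).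
rewrite [LHS]big_mkcond [RHS]big_mkcond; apply: eq_bigr => i _.
have [ik|ik] := boolP (i \in tight S k).
  by rewrite dotZr nrm_sum_dual//; case: ifP; rewrite ?mulr1 ?mulr0.
by case: ifP => // iJ; move/fintype.subsetP: Jk ik => /(_ _ iJ) ->.
Qed.

Lemma shift_delta k i (e : R) : i \in tight S k ->
  shift k (fun j => e * (j == i)%:R) = vtx k + e *: dual k i.
Proof.
move=> ik; congr (_ + _); rewrite (bigD1 i)//= eqxx mulr1 big1 ?addr0// => j.
by move=> /andP[_ /negbTE ->]; rewrite mulr0 scale0r.
Qed.

(** Points close to a vertex stay above the truncating hyperplanes of the faces
    that do not contain it. *)
Lemma small_shift : exists2 d : R, 0 < d & forall e, 0 < e < d -> forall k J,
  ~~ (J \subset tight S k) -> forall t, (forall i, 0 <= t i <= e) ->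
  off_sum J + e < dot (nrm_sum J) (shift k t).
Proof.
suff [d d0 hd] : exists2 d : R, 0 < d & forall e, 0 < e < d ->
    forall kJ : 'I_(vN D) * {set N}, ~~ (kJ.2 \subset tight S kJ.1) ->
    forall t, (forall i, 0 <= t i <= e) ->
    off_sum kJ.2 + e < dot (nrm_sum kJ.2) (shift kJ.1 t).
  by exists d => // e /hd h k J; exact: (h (k, J)).
apply: fin_small => -[k J] /=; have [Jk|Jk] := boolP (J \subset tight S k).
  by exists 1.
pose C := \sum_(i in tight S k) `|dot (nrm_sum J) (dual k i)|.
have gap : 0 < dot (nrm_sum J) (vtx k) - off_sum J by rewrite subr_gt0 nrm_sum_vtx_gt.
have [d d0 hd] := lin_small (1 + C) gap; exists d => // e ed _ t t0e.
have [e0 _] := andP ed; have {hd} := hd _ ed.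
have : `|dot (nrm_sum J) (\sum_(i in tight S k) t i *: dual k i)| <= e * C.
  rewrite dot_sumr (le_trans (ler_norm_sum _ _ _))// mulr_sumr.
  apply: ler_sum => i _; have /andP[ti0 tie] := t0e i.
  by rewrite dotZr normrM ger0_norm// ler_wpM2r.
rewrite /shift dotDr ler_norml => /andP[+ _]; lra.
Qed.

Lemma shift_mem (e : R) : 0 < e -> (forall k J, ~~ (J \subset tight S k) ->
    forall t, (forall i, 0 <= t i <= e) -> off_sum J + e < dot (nrm_sum J) (shift k t)) ->
  forall k t, (forall i, 0 <= t i <= e) -> S (shift k t).
Proof.
move=> e0 he k t te; rewrite (pres_ineq p) => i.
have s1 : nrm_sum [set i]%SET = nrm i by rewrite /nrm_sum big_set1.
have o1 : off_sum [set i]%SET = off S i by rewrite /off_sum big_set1.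
have [ik|ik] := boolP (i \in tight S k).
  have := @nrm_sum_shift [set i]%SET k t; rewrite finset.sub1set ik s1 o1 big_set1 => -> //.
  by rewrite lerDl; case/andP: (te i).
have := he k [set i]%SET; rewrite finset.sub1set ik s1 o1 => /(_ isT t te) /ltW.
by apply: le_trans; rewrite lerDl ltW.
Qed.

(** The truncation parameters for which the truncation of a face keeps the vertices
    outside the face, and for which all edges reach at least to height [e]. *)
Definition good (e : R) := [/\ 0 < e,
  forall k J, ~~ (J \subset tight S k) -> off_sum J + e <= dot (nrm_sum J) (vtx k)
  & forall k i, i \in tight S k -> S (vtx k + e *: dual k i)].

Lemma small_good : exists2 d : R, 0 < d & forall e, 0 < e < d -> good e /\
  forall k J, ~~ (J \subset tight S k) -> off_sum J + e < dot (nrm_sum J) (vtx k).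
Proof.
have [d d0 hd] := small_shift; exists d => // e ed; have /andP[e0 _] := ed.
have h k J : ~~ (J \subset tight S k) -> off_sum J + e < dot (nrm_sum J) (vtx k).
  move=> /(hd e ed k J)/(_ (fun=> 0)); rewrite lexx (ltW e0) => /(_ (fun=> isT)).
  by rewrite /shift big1 ?addr0// => i _; rewrite scale0r.
split=> //; split=> // [k J /h/ltW//|k i ik].
rewrite -shift_delta//; apply: (shift_mem e0 (hd e ed)) => j.
by case: eqP => _; rewrite ?mulr1 ?mulr0 lexx ltW.
Qed.

Lemma good_edge e k i : good e -> i \in tight S k ->
  forall J, J \subset tight S k -> dot (nrm_sum J) (vtx k + e *: dual k i) =
    off_sum J + e * (i \in J)%:R.
Proof. by move=> _ ik J Jk; rewrite dotDr dotZr nrm_sum_vtx// nrm_sum_dual. Qed.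

(** If [face_of K] is nonempty and does not lie in [face_of J], then one of its
    vertices does not lie there either. *)
Lemma vertex_pick K J k0 : K \subset tight S k0 -> ~~ (J \subset K) ->
  exists2 k, K \subset tight S k & ~~ (J \subset tight S k).
Proof.
move=> Kk0 /subsetPn[j jJ jK].
have [jk0|jk0] := boolP (j \in tight S k0); last first.
  by exists k0 => //; apply/subsetPn; exists j.
have [e e0 [ge _]] := small_pick small_good.
pose y := vtx k0 + e *: dual k0 j; have Sy : S y by case: ge => _ _; exact.
have Ky : dot (nrm_sum K) y = off_sum K.
  by rewrite (good_edge ge jk0)// (negbTE jK) mulr0 addr0.
have : face_in S (nrm_sum K) y.
  split=> //; rewrite Ky; apply/esym; rewrite -(nrm_sum_vtx Kk0).
  apply: supp_min; first exact: S_vtx.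
  by move=> z Sz; rewrite nrm_sum_vtx// nrm_sum_ge.
have sK : supp S (nrm_sum K) = off_sum K.
  rewrite -(nrm_sum_vtx Kk0); apply: supp_min; first exact: S_vtx.
  by move=> z Sz; rewrite nrm_sum_vtx// nrm_sum_ge.
rewrite {1}(pres_hull p) face_in_hull => hy.
have [k kh kmin] := hull_argmin (@vtx _ _ D) (- nrm j) (hull_nonempty hy).
exists k.
  apply/fintype.subsetP => i iK; apply/tightP; move: i iK; apply/nrm_sum_eq.
    exact: S_vtx.
  by move: kh; rewrite inE -(pres_hull p) sK => /andP[_ /eqP].
apply/subsetPn; exists j => //; apply/tightP => jk.
have := kmin _ hy; rewrite !dotNl lerN2 jk.
have -> : dot (nrm j) y = off S j + e.
  have s1 : nrm_sum [set j]%SET = nrm j by rewrite /nrm_sum big_set1.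
  have o1 : off_sum [set j]%SET = off S j by rewrite /off_sum big_set1.
  by rewrite -s1 (good_edge ge jk0) ?finset.sub1set// o1 finset.in_set1 eqxx mulr1.
by rewrite leNgt ltrDl e0.
Qed.

Lemma supp_nrm_sum J : Delta J -> supp S (nrm_sum J) = off_sum J.
Proof.
move=> /andP[_ /existsP[k Jk]]; rewrite -(nrm_sum_vtx Jk).
apply: supp_min; first exact: S_vtx.
by move=> z Sz; rewrite nrm_sum_vtx// nrm_sum_ge.
Qed.

Lemma face_of_face_in J : Delta J -> face_of J = face_in S (nrm_sum J).
Proof.
move=> DJ; apply/seteqP; split=> x [Sx h]; split=> //.
  by rewrite supp_nrm_sum//; apply/nrm_sum_eq.
by move: h; rewrite supp_nrm_sum// => /nrm_sum_eq; exact.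
Qed.

Lemma face_of_vtx J k : face_of J (vtx k) <-> J \subset tight S k.
Proof.
split=> [[_ h]|/fintype.subsetP h]; first by apply/fintype.subsetP => i /h/tightP.
by split=> [|i /h/tightP//]; exact: S_vtx.
Qed.

Lemma face_of_subset J K : Delta J -> face_of J `<=` face_of K <-> K \subset J.
Proof.
move=> /andP[_ /existsP[k0 Jk0]]; split=> [h|/fintype.subsetP KJ x [Sx h]].
  apply: contraT => /(vertex_pick Jk0)[k Jk /negP].
  by case; apply/face_of_vtx/h/face_of_vtx.
by split=> // i /KJ/h.
Qed.

Lemma face_of_inj J K : Delta J -> Delta K -> face_of J = face_of K -> J = K.
Proof.
move=> DJ DK e; apply/eqP; rewrite finset.eqEsubset; apply/andP; split.
  by apply/(face_of_subset _ DK); rewrite e.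
by apply/(face_of_subset _ DJ); rewrite e.
Qed.

Lemma face_of_proper J : S 0 -> Delta J -> proper_face S (face_of J).
Proof.
move=> S0 DJ; have /andP[J0 /existsP[k Jk]] := DJ; split.
  split; first by exists (vtx k); apply/face_of_vtx.
  by exists (nrm_sum J); exact: face_of_face_in.
move=> e; have [i iJ] := set0Pn _ J0.
have : face_of J 0 by rewrite e.
by move=> [_ /(_ i iJ)]/eqP; rewrite dot0r gt_eqF// (pres_off p).
Qed.

(** A functional that is minimal at a vertex is a nonnegative combination of the
    normals there; the facets with a positive coefficient cut out its face. *)
Lemma proper_face_of F : proper_face S F -> exists2 J, Delta J & F = face_of J.
Proof.
move=> [[[x Fx] [v FE]] FS].
have Sx : S x by move: Fx; rewrite FE => -[].
have [k hk] := S_argmin v Sx; have [e e0 [[_ _ ge] _]] := small_pick small_good.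
have sv : supp S v = dot v (vtx k) by apply: supp_min => //; exact: S_vtx.
have a0 i : i \in tight S k -> 0 <= dot v (dual k i).
  by move=> /ge /hk; rewrite dotDr dotZr lerDl pmulr_rge0.
pose J := finset (fun i => (i \in tight S k) && (dot v (dual k i) != 0)).
have Jk : J \subset tight S k by apply/fintype.subsetP => i; rewrite inE => /andP[].
have vE y : dot v y - dot v (vtx k) =
    \sum_(i in tight S k) dot v (dual k i) * (dot (nrm i) y - off S i).
  rewrite {1 2}(pres_expand p k v) !dot_suml -sumrB; apply: eq_bigr => i /tightP ik.
  by rewrite !dotZl ik mulrBr.
have FJ : F = face_of J.
  rewrite FE; apply/seteqP; split=> y [Sy h]; split=> //.
    move=> i; rewrite inE => /andP[ik vi].
    have /eqP := vE y; rewrite h sv subrr eq_sym psumr_eq0 => [/allP/(_ i)|j jk].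
      rewrite mem_index_enum => /(_ isT)/implyP/(_ ik).
      by rewrite mulf_eq0 (negbTE vi) subr_eq0 => /eqP.
    by rewrite mulr_ge0 ?a0// subr_ge0 S_off.
  apply/eqP; rewrite sv -subr_eq0 vE big1// => i ik.
  have [->|vi] := eqVneq (dot v (dual k i)) 0; first by rewrite mul0r.
  by rewrite h ?subrr ?mulr0// inE ik.
exists J => //; rewrite /Delta; apply/andP; split; last by apply/existsP; exists k.
apply/eqP => J0; apply: FS; rewrite FJ; apply/seteqP; split=> [y []//|y Sy].
by split=> // i; rewrite J0 inE.
Qed.

Lemma face_of_facet J i : Delta J -> face_of J `<=` face_in S (nrm i) <-> i \in J.
Proof.
move=> DJ; suff -> : face_in S (nrm i) = face_of [set i]%SET.
  by rewrite face_of_subset// finset.sub1set.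
apply/seteqP; split=> x [Sx h]; split=> //; first by move=> j /set1P ->.
by apply: h; rewrite finset.in_set1.
Qed.

Lemma face_normal_face_of J : Delta J -> face_normal S (face_of J) = nrm_sum J.
Proof.
move=> DJ; rewrite /face_normal /nrm_sum.
have -> : [set G | facet S G /\ face_of J `<=` G] =
    (fun i : N => face_in S (nrm i)) @` [set` J].
  apply/seteqP; split=> G.
    by move=> [/(pres_all_facets p)[i ->]] /(face_of_facet _ DJ); exists i.
  by move=> [i iJ <-]; split; [exact: pres_facet p i|apply/face_of_facet].
rewrite (fsbig_image _ (fun i : N => face_in S (nrm i))); last first.
  by move=> i j _ _; exact: (pres_facet_inj p).
rewrite fsbig_set (big_morph (@of_lattice R n) (id1 := 0) (op1 := +%R)).
- by apply: eq_bigr => i _; rewrite (pres_normal p).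
- by move=> u v; rewrite /of_lattice raddfD.
- by rewrite /of_lattice raddf0.
Qed.

End SimpleFaces.

(** * The barycentric fan and the polytopes compatible with it *)

Section Fan.
Context {R : realType} {n : nat}.
Local Notation V := 'rV[R]_n.
Variables (S : set V) (D : @simple_data R n).
Local Notation N := 'I_(fN D).
Hypotheses (p : presents S D) (S0 : S 0).
Implicit Types (J K : {set N}) (x y v : V) (k : 'I_(vN D)) (c : {set {set N}}).

(** Chains of nonempty proper faces. *)
Definition face_chain c := chain c /\ {in c, forall J, Delta S J}.

(** The cone spanned by the normals of the members of a chain. *)
Definition face_cone c : set V := [set v | exists2 l : {set N} -> R,
  forall J, J \in c -> 0 <= l J & v = \sum_(J in c) l J *: nrm_sum J].

(** The barycentric fan is complete: write [v] in terms of the facet normals at a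
    vertex where it is minimal, and take the layer cake of the coefficients. *)
Lemma Bar_complete v : exists c (l : {set N} -> R),
  [/\ face_chain c, {in c, forall J, 0 < l J} & v = \sum_(J in c) l J *: nrm_sum J].
Proof.
have [k hk] := S_argmin p v S0; have [e e0 [[_ _ ge] _]] := small_pick (small_good p).
pose a i := if i \in tight S k then dot v (dual k i) else 0.
have a0 i : 0 <= a i.
  rewrite /a; case: ifP => // /ge /hk.
  by rewrite dotDr dotZr lerDl pmulr_rge0.
have [c [l [ch hc lc ac]]] := layer_cake a0; exists c, l; split=> //.
  split=> // J /hc[J0 Ja]; apply/andP; split=> //; apply/existsP; exists k.
  by apply/fintype.subsetP => i /Ja; rewrite /a; case: ifP => //; rewrite eqxx.
rewrite [LHS](pres_expand p k) big_mkcond.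
transitivity (\sum_i a i *: nrm i).
  by apply: eq_bigr => i _; rewrite /a; case: ifP => //; rewrite scale0r.
under eq_bigr => i _ do rewrite ac scaler_suml.
rewrite exchange_big/=; apply: eq_bigr => J _; rewrite scaler_sumr [RHS]big_mkcond.
apply: eq_bigr => i _; case: (i \in J); first by rewrite mulr1.
by rewrite mulr0 scale0r.
Qed.

Lemma cone_nrm_sum c : cone [set nrm_sum J | J in [set` c]] = face_cone c.
Proof.
apply/seteqP; split=> [v [k [q [a [hq a0 ->]]]]|v [l l0 ->]].
  have [g hg] := choice2 hq.
  exists (fun J => \sum_(j | g j == J) a j); first by move=> J _; exact: sumr_ge0.
  rewrite (partition_big g (mem c))/= => [|i _]; last by case: (hg i).
  apply: eq_bigr => J _; rewrite scaler_suml; apply: eq_bigr => j /eqP <-.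
  by case: (hg j) => _ ->.
exists #|c|, (fun i => nrm_sum (enum_val i)), (l \o enum_val); split=> /=.
- by move=> i; exists (enum_val i) => //; exact: enum_valP.
- by move=> i; apply/l0/enum_valP.
- by rewrite (big_enum_val (fun J => l J *: nrm_sum J)).
Qed.

Lemma Bar_face_cone : Bar S = [set face_cone c | c in face_chain].
Proof.
apply/seteqP; split=> C.
  move=> [c0 [c0f c0c] <-].
  pose c := finset (fun J => Delta S J && `[< c0 (face_of S J) >]).
  have cP J : J \in c <-> Delta S J /\ c0 (face_of S J).
    by rewrite inE; split=> [/andP[? /asboolP]|[? ?]] //; apply/andP; split=> //; apply/asboolP.
  exists c.
    split=> [J K /cP[DJ hJ] /cP[DK hK]|J /cP[]//].
    have [/(face_of_subset p _ DJ) ->|/(face_of_subset p _ DK) ->//] := c0c _ _ hJ hK.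
    by rewrite orbT.
  rewrite -cone_nrm_sum; congr cone; apply/seteqP; split=> u.
    by move=> [J /cP[DJ hJ] <-]; exists (face_of S J) => //; exact: face_normal_face_of.
  move=> [F hF <-]; have [J DJ FJ] := proper_face_of p (c0f _ hF); exists J.
    by apply/cP; split=> //; rewrite -FJ.
  by rewrite FJ (face_normal_face_of p).
move=> [c [ch cD] <-]; exists ((fun J => face_of S J) @` [set` c]).
  split=> [_ [J /cD DJ <-]|_ _ [J Jc <-] [K Kc <-]].
    exact: face_of_proper.
  have /orP[h|h] := ch _ _ Jc Kc; [right|left].
    exact/(face_of_subset p _ (cD _ Kc)).
  exact/(face_of_subset p _ (cD _ Jc)).
rewrite -cone_nrm_sum; congr cone; apply/seteqP; split=> u.
  by move=> [_ [J Jc <-] <-]; exists J => //; rewrite (face_normal_face_of p)//; exact: cD.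
move=> [J Jc <-]; exists (face_of S J); first by exists J.
by rewrite (face_normal_face_of p)//; exact: cD.
Qed.

Section Compatible.
Variables (P : set V) (b : {set N} -> R).

(** [P] lies above the values [b], and it attains them simultaneously along
    every chain; thus its support function is linear on the barycentric cones. *)
Definition compatible := (forall J, Delta S J -> forall x, P x -> b J <= dot (nrm_sum J) x) /\
  (forall c, face_chain c -> exists2 x, P x & forall J, J \in c -> dot (nrm_sum J) x = b J).

Hypothesis Pb : compatible.
Implicit Types l : {set N} -> R.

Lemma comb_dot c l x : (forall J, J \in c -> dot (nrm_sum J) x = b J) ->
  dot (\sum_(J in c) l J *: nrm_sum J) x = \sum_(J in c) l J * b J.
Proof. by move=> h; rewrite dot_suml; apply: eq_bigr => J /h; rewrite dotZl => ->. Qed.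

Lemma comb_le c l x : face_chain c -> (forall J, J \in c -> 0 <= l J) -> P x ->
  \sum_(J in c) l J * b J <= dot (\sum_(J in c) l J *: nrm_sum J) x.
Proof.
move=> cc l0 Px; rewrite dot_suml; apply: ler_sum => J Jc.
by rewrite dotZl ler_wpM2l// ?l0//; apply: Pb.1 => //; exact: cc.2.
Qed.

Lemma comb_supp c l : face_chain c -> (forall J, J \in c -> 0 <= l J) ->
  supp P (\sum_(J in c) l J *: nrm_sum J) = \sum_(J in c) l J * b J.
Proof.
move=> cc l0; have [x Px hx] := Pb.2 _ cc; rewrite -(comb_dot _ hx).
by apply: supp_min => // y Py; rewrite (comb_dot _ hx) comb_le.
Qed.

Lemma comb_eq c l x : face_chain c -> (forall J, J \in c -> 0 < l J) -> P x ->
  dot (\sum_(J in c) l J *: nrm_sum J) x = supp P (\sum_(J in c) l J *: nrm_sum J) <->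
  (forall J, J \in c -> dot (nrm_sum J) x = b J).
Proof.
move=> cc l0 Px; rewrite comb_supp// => [|J /l0/ltW//].
split=> [/eqP|]; last exact: comb_dot.
rewrite dot_suml -subr_eq0 -sumrB psumr_eq0 => [/allP h J Jc|J Jc]; last first.
  rewrite dotZl -mulrBr mulr_ge0 ?(ltW (l0 _ Jc))// subr_ge0.
  by apply: Pb.1 => //; exact: cc.2.
have /implyP := h J (mem_index_enum _) => /(_ Jc).
by rewrite dotZl -mulrBr mulf_eq0 (gt_eqF (l0 _ Jc)) subr_eq0 => /eqP.
Qed.

Lemma face_chain0 : face_chain finset.set0.
Proof. by split=> [J K|J]; rewrite inE. Qed.

Lemma face_chain1 J : Delta S J -> face_chain [set J]%SET.
Proof.
by move=> DJ; split=> [K L /set1P-> /set1P->|K /set1P->//]; rewrite subxx.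
Qed.

Lemma compatible_supp J : Delta S J -> supp P (nrm_sum J) = b J.
Proof.
move=> DJ; have := @comb_supp [set J]%SET (fun=> 1) (face_chain1 DJ) (fun _ _ => ler01).
by rewrite !big_set1 scale1r mul1r.
Qed.

Lemma compatible_nonempty : P !=set0.
Proof. by have [x Px _] := Pb.2 _ face_chain0; exists x. Qed.

Lemma compatible_PL : PL (Bar S) (supp P).
Proof.
move=> C; rewrite Bar_face_cone => -[c cc <-]; have [x Px hx] := Pb.2 _ cc.
by exists x => _ [l l0 ->]; rewrite comb_supp// dotC (comb_dot _ hx).
Qed.

Lemma compatible_coarsens : coarsens (normal_fan P) (Bar S).
Proof.
move=> _ [F [_ [v FE]] <-].
exists [set C | Bar S C /\ C `<=` normal_cone P F]; first by move=> C [].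
apply/seteqP; split=> [u uF|u [C [_ CF] Cu]]; last exact: CF.
have [c [l [cc l0 uE]]] := Bar_complete u.
exists (face_cone c); last by exists l => // J /l0/ltW.
split; first by rewrite Bar_face_cone; exists c.
move=> _ [l' l'0 ->] x Fx; rewrite comb_supp//; apply: comb_dot.
apply/(comb_eq cc l0); first by move: Fx; rewrite FE => -[].
by rewrite -uE; exact: uF.
Qed.

(** If moreover [P] separates every face from every chain not containing it,
    then the normal fan of [P] is the whole barycentric fan. *)
Lemma compatible_normal_fan :
  (forall c G, face_chain c -> Delta S G -> G \notin c -> exists x,
    [/\ P x, forall J, J \in c -> dot (nrm_sum J) x = b J & b G < dot (nrm_sum G) x]) ->
  normal_fan P = Bar S.
Proof.
move=> sep.
have nc c l : face_chain c -> (forall J, J \in c -> 0 < l J) ->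
    normal_cone P (face_in P (\sum_(J in c) l J *: nrm_sum J)) = face_cone c.
  move=> cc l0; apply/seteqP; split=> u; last first.
    move=> [l' l'0 ->] x [Px] /(comb_eq cc l0 Px) hx.
    by rewrite comb_supp//; exact: comb_dot.
  have [c' [l' [cc' l'0 ->]]] := Bar_complete u => hu.
  have c'c : c' \subset c.
    apply/fintype.subsetP => G Gc'; apply: contraT => Gc.
    have [x [Px hx]] := sep _ _ cc (cc'.2 _ Gc') Gc.
    have /(comb_eq cc' l'0 Px)/(_ _ Gc') -> := hu x (conj Px (proj2 (comb_eq cc l0 Px) hx)).
    by rewrite ltxx.
  exists (fun J => if J \in c' then l' J else 0).
    by move=> J _; case: ifP => // /l'0/ltW.
  rewrite [LHS]big_mkcond [RHS]big_mkcond; apply: eq_bigr => J _.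
  case: ifP => [/(fintype.subsetP c'c) -> //|_].
  by case: ifP; rewrite ?scale0r.
rewrite Bar_face_cone; apply/seteqP; split=> C.
  move=> [F [_ [v FE]] <-]; have [c [l [cc l0 vE]]] := Bar_complete v.
  by exists c => //; rewrite FE vE nc.
move=> [c cc <-]; exists (face_in P (\sum_(J in c) 1 *: nrm_sum J)).
  split; last by exists (\sum_(J in c) 1 *: nrm_sum J).
  have [x Px hx] := Pb.2 _ cc; exists x; split=> //.
  exact: (proj2 (@comb_eq c (fun=> 1) x cc (fun _ _ => ltr01) Px) hx).
by rewrite (nc c (fun=> 1)).
Qed.

Lemma nrm_sum_lattice J : nrm_sum J = of_lattice (\sum_(i in J) lat i).
Proof.
rewrite (big_morph (@of_lattice R n) (id1 := 0) (op1 := +%R))//.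
- by move=> u v; rewrite /of_lattice raddfD.
- by rewrite /of_lattice raddf0.
Qed.

(** A facet of a compatible set is cut out by a single face normal: the face that
    the latter cuts out contains the facet, and a strict inclusion would lower the
    affine dimension twice. *)
Lemma compatible_facet G : facet P G -> exists2 J : {set N}, Delta S J & G = face_in P (nrm_sum J).
Proof.
move=> [[[x Gx] [v GE]] dG]; have [c [l [cc l0 vE]]] := Bar_complete v.
have Px : P x by move: Gx; rewrite GE => -[].
have GP : G `<=` P by rewrite GE => z [].
have [y Py] : exists2 y, P y & ~ G y.
  apply: contrapT => h; move/eqP: dG; rewrite -[X in _ == X -> _]addn0 -addn1.
  suff -> : P = G by rewrite eqn_add2l.
  apply/seteqP; split=> // z Pz; apply: contrapT => Gz; apply: h; by exists z.
rewrite GE vE => Gy.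
have [J Jc yJ] : exists2 J, J \in c & dot (nrm_sum J) y != b J.
  apply: contrapT => h; apply: Gy; split=> //; apply/(comb_eq cc l0) => // J Jc.
  by apply: contrapT => /eqP yJ; apply: h; exists J.
have DJ := cc.2 _ Jc; exists J => //; rewrite -vE -GE.
have GJ : G `<=` face_in P (nrm_sum J).
  move=> z; rewrite GE vE => -[Pz] /(comb_eq cc l0 Pz)/(_ _ Jc) h.
  by split=> //; rewrite compatible_supp.
have lt1 : (affdim (face_in P (nrm_sum J)) < affdim P)%N.
  apply: (affdim_face Px (GJ _ Gx) Py).
  by rewrite compatible_supp.
apply/seteqP; split=> // z Jz; apply: contrapT => Gz.
suff : (affdim G < affdim (face_in P (nrm_sum J)))%N.
  by move: lt1; rewrite -dG ltnS ltnNge => ->.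
apply: (@affdim_lt _ _ _ _ v (supp P v) x z) => //; first by move=> w; rewrite GE => -[].
by apply/eqP => vz; apply: Gz; rewrite GE; split=> //; case: Jz.
Qed.

(** A finite family attaining the minima along all chains spans [P]. *)
Lemma compatible_hull (I : finType) (a : I -> V) (B : {set I}) : hull a B `<=` P ->
  (forall c, face_chain c -> exists2 i, i \in B &
    forall J, J \in c -> dot (nrm_sum J) (a i) = b J) ->
  P = hull a B.
Proof.
move=> BP h; apply: eq_hull => // u; have [c [l [cc l0 ->]]] := Bar_complete u.
have [i iB hi] := h _ cc; exists i => // x Px.
by rewrite (comb_dot _ hi) comb_le// => J /l0/ltW.
Qed.

(** The facet normals of a compatible polytope are face normals, hence integral. *)
Lemma compatible_polytope (I : finType) (a : I -> V) (B : {set I}) :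
  P = hull a B -> polytope P.
Proof.
move=> PE; split; first exact: compatible_nonempty.
  exists [set a i | i in [set` B]]; split; last by rewrite conv_hull.
  by apply: finite_image; exact: finite_finpred.
move=> G /compatible_facet[J DJ ->]; exists (\sum_(i in J) lat i).
by rewrite nrm_sum_lattice.
Qed.

End Compatible.
End Fan.

(** * Truncations *)

Section Truncations.
Context {R : realType} {n : nat}.
Local Notation V := 'rV[R]_n.
Variables (S : set V) (D : @simple_data R n).
Local Notation N := 'I_(fN D).
Hypotheses (p : presents S D) (S0 : S 0).
Implicit Types (J K G : {set N}) (x y v : V) (k : 'I_(vN D)) (c : {set {set N}}).

Lemma Tr_face_of e J : Delta S J ->
  Tr e S (face_of S J) = [set x | S x /\ off_sum S J + e <= dot (nrm_sum J) x].
Proof. by move=> DJ; rewrite /Tr /truncate (face_normal_face_of p)// (supp_nrm_sum p). Qed.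

(** The value at [nrm_sum K] of the support function of the truncation of [face_of J]. *)
Definition trunc_val (e : R) J K : R := off_sum S K + e * (J \subset K)%:R.

(** The points of a truncation that attain its support function: the vertices of
    [S] outside the truncated face, and the points at height [e] on the edges that
    leave this face. *)
Definition trunc_pt (e : R) (q : 'I_(vN D) * option N) : V :=
  if q.2 is Some i then vtx q.1 + e *: dual q.1 i else vtx q.1.

Definition trunc_pts J : {set 'I_(vN D) * option N} := finset (fun q =>
  if q.2 is Some i then (J \subset tight S q.1) && (i \in J) else ~~ (J \subset tight S q.1)).

Lemma trunc_pts_mem e J q : good S D e -> Delta S J -> q \in trunc_pts J ->
  Tr e S (face_of S J) (trunc_pt e q).
Proof.
move=> ge DJ; rewrite inE Tr_face_of//; case: q => k [i|] /=; last first.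
  by move=> h; split; [exact: S_vtx|case: ge => _ + _; exact].
move=> /andP[Jk iJ]; have ik := fintype.subsetP Jk i iJ.
split; first by case: ge => _ _; exact.
by rewrite (good_edge p ge)// iJ mulr1.
Qed.

Lemma trunc_pts_hull e J : good S D e -> Delta S J ->
  hull (trunc_pt e) (trunc_pts J) `<=` Tr e S (face_of S J).
Proof.
move=> ge DJ x hx; rewrite Tr_face_of//; split.
  rewrite (pres_ineq p) => i; apply: hull_ge hx => q /(trunc_pts_mem ge DJ).
  by rewrite Tr_face_of// => -[Sq _]; exact: (S_off p).
by apply: hull_ge hx => q /(trunc_pts_mem ge DJ); rewrite Tr_face_of// => -[].
Qed.

Lemma trunc_pts_chain e J c : good S D e -> Delta S J -> face_chain S c ->
  exists2 q, q \in trunc_pts J & forall K, K \in c ->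
    dot (nrm_sum K) (trunc_pt e q) = trunc_val e J K.
Proof.
move=> ge DJ cc; have [J0 /existsP[kJ JkJ]] := andP DJ.
have [i iJ ic] := chain_pick cc.1 J0.
have [->|c0] := eqVneq c finset.set0.
  by exists (kJ, Some i) => [|K]; rewrite inE//= JkJ.
have [K1 K1c K1top] := chain_top cc.1 c0.
have /andP[_ /existsP[k0 K1k0]] := cc.2 _ K1c.
have [JK1|JK1] := boolP (J \subset K1).
  have Jk0 := fintype.subset_trans JK1 K1k0.
  exists (k0, Some i); first by rewrite inE /= Jk0.
  move=> K Kc; rewrite /trunc_pt/= /trunc_val (good_edge p ge) ?(ic _ Kc)//.
    exact: (fintype.subsetP Jk0).
  exact: fintype.subset_trans (K1top _ Kc) _.
have [k K1k Jk] := vertex_pick p K1k0 JK1.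
exists (k, None); first by rewrite inE.
move=> K Kc; rewrite /trunc_pt/= /trunc_val (nrm_sum_vtx p).
  rewrite (_ : (J \subset K) = false) ?mulr0 ?addr0//.
  by apply: contraNF JK1 => /fintype.subset_trans; apply; exact: K1top.
exact: fintype.subset_trans (K1top _ Kc) _.
Qed.

(** The support function of a truncation on the barycentric fan. *)
Lemma compatible_Tr e J : good S D e -> Delta S J ->
  compatible S (Tr e S (face_of S J)) (trunc_val e J).
Proof.
move=> ge DJ; split; last first.
  move=> c cc; have [q qB hq] := trunc_pts_chain ge DJ cc.
  by exists (trunc_pt e q) => //; exact: trunc_pts_mem.
move=> K DK x; rewrite Tr_face_of// => -[Sx hx]; rewrite /trunc_val.
have [JK|_] := boolP (J \subset K); last by rewrite mulr0 addr0 (nrm_sum_ge p).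
have sJ (W : nmodType) (F : N -> W) :
    \sum_(i in K) F i = \sum_(i in J) F i + \sum_(i in K :\: J) F i.
  rewrite (big_setID J)/=; congr (_ + _); apply: eq_bigl => i.
  by rewrite (finset.setIidPr JK).
have := @nrm_sum_ge _ _ _ _ p (K :\: J) x Sx.
rewrite /nrm_sum /off_sum !sJ dotDl mulr1 -/(nrm_sum J) -/(off_sum S J); lra.
Qed.

Lemma supp_Tr e J K : good S D e -> Delta S J -> Delta S K ->
  supp (Tr e S (face_of S J)) (nrm_sum K) = trunc_val e J K.
Proof. by move=> ge DJ DK; rewrite (compatible_supp (compatible_Tr ge DJ)). Qed.

Lemma truncations_set e :
  [set Tr e S F | F in proper_face S] =
  [set Tr e S (face_of S J) | J in [set J : {set N} | Delta S J]].
Proof.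
apply/seteqP; split=> Q.
  by move=> [F /(proper_face_of p)[J DJ ->] <-]; exists J.
by move=> [J DJ <-]; exists (face_of S J) => //; exact: face_of_proper.
Qed.

(** A face [G] outside a chain is separated from it by a truncation: by that of
    [G] itself at a vertex outside [G], or else by that of the largest face in
    the chain contained in [G]. *)
Lemma Tr_separates e c G : good S D e ->
  (forall k J, ~~ (J \subset tight S k) -> off_sum S J + e < dot (nrm_sum J) (vtx k)) ->
  face_chain S c -> Delta S G -> G \notin c -> exists2 J, Delta S J & exists x,
  [/\ Tr e S (face_of S J) x, forall K, K \in c -> dot (nrm_sum K) x = trunc_val e J K
    & trunc_val e J G < dot (nrm_sum G) x].
Proof.
move=> ge gap cc DG Gc; have [G0 /existsP[kG GkG]] := andP DG.
have [e0 _ _] := ge.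
have far K1 k1 : K1 \subset tight S k1 -> ~~ (G \subset K1) ->
    (forall K, K \in c -> K \subset K1) -> exists2 J, Delta S J & exists x,
  [/\ Tr e S (face_of S J) x, forall K, K \in c -> dot (nrm_sum K) x = trunc_val e J K
    & trunc_val e J G < dot (nrm_sum G) x].
  move=> K1k1 GK1 K1top; have [k K1k Gk] := vertex_pick p K1k1 GK1.
  exists G => //; exists (vtx k); split.
  - rewrite Tr_face_of//; split; first exact: S_vtx.
    exact/ltW/gap.
  - move=> K Kc; rewrite /trunc_val (nrm_sum_vtx p).
      rewrite (_ : (G \subset K) = false) ?mulr0 ?addr0//.
      by apply: contraNF GK1 => /fintype.subset_trans; apply; exact: K1top.
    exact: fintype.subset_trans (K1top _ Kc) _.
  - by rewrite /trunc_val subxx mulr1 gap.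
have [cE|c0] := eqVneq c finset.set0.
  apply: (far finset.set0 kG) => [||K]; rewrite ?finset.sub0set ?finset.subset0//.
  by rewrite cE inE.
have [K1 K1c K1top] := chain_top cc.1 c0.
have /andP[_ /existsP[k0 K1k0]] := cc.2 _ K1c.
have [GK1|GK1] := boolP (G \subset K1); last exact: far K1k0 GK1 K1top.
have [i iG ic] := chain_pick cc.1 G0.
have [J /andP[Jc GJ] Jmin] : exists2 J, (J \in c) && (G \subset J) &
    forall K, (K \in c) && (G \subset K) -> (#|J| <= #|K|)%N.
  have h : (K1 \in c) && (G \subset K1) by rewrite K1c.
  by case: (@arg_minnP _ _ (fun K => (K \in c) && (G \subset K))
    (fun K => #|K|) h) => J ? ?; exists J.
have DJ := cc.2 _ Jc.
have Jk0 : J \subset tight S k0 by exact: fintype.subset_trans (K1top _ Jc) _.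
have ik0 : i \in tight S k0 by apply: (fintype.subsetP Jk0); exact: (fintype.subsetP GJ).
exists J => //; exists (vtx k0 + e *: dual k0 i); split.
- rewrite Tr_face_of//; split; first by case: ge => _ _; exact.
  by rewrite (good_edge p ge)// (fintype.subsetP GJ)// mulr1.
- move=> K Kc; have Kk0 := fintype.subset_trans (K1top _ Kc) K1k0.
  rewrite (good_edge p ge)// /trunc_val ic//; congr (_ + _ * _%:R); congr nat_of_bool.
  apply/idP/idP => [GK|]; last exact: fintype.subset_trans.
  have /orP[//|KJ] := cc.1 _ _ Jc Kc.
  suff /eqP -> : K == J by [].
  by rewrite eqEcard KJ Jmin// Kc.
- have Gk0 := fintype.subset_trans GK1 K1k0.
  rewrite (good_edge p ge)// iG mulr1 /trunc_val (_ : (J \subset G) = false).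
    by rewrite mulr0 addr0 ltrDl.
  apply: contraNF Gc => JG; suff /eqP -> : G == J by [].
  by rewrite finset.eqEsubset GJ JG.
Qed.

End Truncations.

(** * Minkowski sums *)

Section Minkowski.
Context {R : realType} {n : nat}.
Local Notation V := 'rV[R]_n.
Variables (S : set V) (D : @simple_data R n).
Local Notation N := 'I_(fN D).
Variables (Qs : set (set V)) (b : set V -> {set N} -> R).
Hypothesis Qfin : finite_set Qs.
Hypothesis Qb : forall Q, Qs Q -> compatible S Q (b Q).

(* support functions add up *)
Let bM K : R := \sum_(Q \in Qs) b Q K.

Lemma dot_fsbig v (x : set V -> V) :
  dot v (\sum_(Q \in Qs) x Q) = \sum_(Q \in Qs) dot v (x Q).
Proof. by rewrite !fsbig_finite//= dot_sumr. Qed.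

Lemma compatible_minkowski : compatible S (minkowski_sum Qs) bM.
Proof.
split=> [J DJ _ [x xQ <-]|c cc].
  rewrite dot_fsbig /bM !fsbig_finite//= big_seq [leRHS]big_seq.
  apply: ler_sum => Q; rewrite in_fset_set// => /set_mem QQ.
  by apply: (Qb QQ).1 => //; exact: xQ.
have [x hx] : exists x : set V -> V, forall Q, Qs Q ->
    Q (x Q) /\ forall J, J \in c -> dot (nrm_sum J) (x Q) = b Q J.
  have h Q : exists y, Qs Q -> Q y /\ forall J, J \in c -> dot (nrm_sum J) y = b Q J.
    have [QQ|QQ] := pselect (Qs Q); last by exists 0.
    by have [y Qy hy] := (Qb QQ).2 c cc; exists y.
  by have [x hx] := choice h; exists x.
exists (\sum_(Q \in Qs) x Q); first by exists x => // Q /hx[].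
move=> J Jc; rewrite dot_fsbig /bM !fsbig_finite//= !big_seq.
by apply: eq_bigr => Q; rewrite in_fset_set// => /set_mem /hx[_]; exact.
Qed.

Lemma minkowski_separates c G Q y : face_chain S c -> Delta S G -> Qs Q -> Q y ->
  (forall J, J \in c -> dot (nrm_sum J) y = b Q J) -> b Q G < dot (nrm_sum G) y ->
  exists x, [/\ minkowski_sum Qs x, forall J, J \in c -> dot (nrm_sum J) x = bM J
    & bM G < dot (nrm_sum G) x].
Proof.
move=> cc DG QQ Qy yc yG.
have [x hx] : exists x : set V -> V, forall Q', Qs Q' ->
    [/\ Q' (x Q'), forall J, J \in c -> dot (nrm_sum J) (x Q') = b Q' J
      & (Q' = Q -> x Q' = y)].
  have h Q' : exists z, Qs Q' -> [/\ Q' z, forall J, J \in c -> dot (nrm_sum J) z = b Q' J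
      & (Q' = Q -> z = y)].
    have [->|Q'Q] := pselect (Q' = Q); first by exists y.
    have [QQ'|QQ'] := pselect (Qs Q'); last by exists 0.
    by have [z Qz hz] := (Qb QQ').2 c cc; exists z.
  by have [x hx] := choice h; exists x.
exists (\sum_(Q \in Qs) x Q); split.
- by exists x => // Q' /hx[].
- move=> J Jc; rewrite dot_fsbig /bM !fsbig_finite//= !big_seq.
  by apply: eq_bigr => Q'; rewrite in_fset_set// => /set_mem /hx[_ + _]; exact.
have Qin : Q \in finmap.enum_fset (fset_set Qs) by rewrite in_fset_set//; exact: mem_set.
rewrite dot_fsbig /bM !fsbig_finite//= (big_rem Q)//= [ltRHS](big_rem Q)//=.
have [_ _ /(_ erefl) ->] := hx _ QQ.
rewrite ltr_leD// big_seq [leRHS]big_seq; apply: ler_sum => Q' /mem_rem.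
rewrite in_fset_set// => /set_mem QQ'; apply: (Qb QQ').1 => //.
by have [] := hx _ QQ'.
Qed.

End Minkowski.

(** * The truncations form a basis *)

Section Basis.
Context {R : realType} {n : nat}.
Local Notation V := 'rV[R]_n.
Variables (S : set V) (D : @simple_data R n).
Local Notation N := 'I_(fN D).
Hypotheses (p : presents S D) (S0 : S 0).
Variable e : R.
Hypotheses (ge : good S D e) (esum : e + \sum_(i : N) off S i != 0).
Implicit Types (J K G : {set N}) (x y v : V) (k : 'I_(vN D)) (c : {set {set N}}).

(** Every facet contains a vertex. *)
Lemma Delta1 (i : N) : Delta S [set i]%SET.
Proof.
have [k hk] := S_argmin p (nrm i) S0.
apply/andP; split; first by rewrite -card_gt0 cards1.
apply/existsP; exists k; rewrite finset.sub1set; apply/tightP.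
by apply/esym/supp_min => //; exact: S_vtx.
Qed.

(** The matrix of the values [trunc_val e J K] is [e] times the zeta matrix of the
    face poset plus a matrix whose rows are all equal to [off_sum S]. Adding to
    the coefficients of a linear relation, with sum [s], the multiple [s / e] of the
    function that is [off S i] at facet [i] and zero at the other faces yields a
    relation for the zeta matrix, which is unitriangular. *)
Lemma trunc_val_free (d : {set N} -> R) :
  (forall K, Delta S K -> \sum_(J | Delta S J) d J * trunc_val S e J K = 0) ->
  forall J, Delta S J -> d J = 0.
Proof.
move=> hd; have e0 : 0 < e by case: ge.
pose s := \sum_(J | Delta S J) d J.
(* the function [i |-> off S i] on facets, extended by zero to all faces *)
pose f J : R := \sum_(i : N) off S i * (J == [set i]%SET)%:R.
pose d' J := d J + s / e * f J.
have sumf (P : pred {set N}) : (forall i : N, P [set i]%SET -> Delta S [set i]%SET) ->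
    \sum_(J | Delta S J && P J) f J = \sum_(i | P [set i]%SET) off S i.
  move=> hP; rewrite exchange_big/= [RHS]big_mkcond; apply: eq_bigr => i _.
  rewrite -mulr_sumr; have [Pi|Pi] := boolP (P _).
    rewrite (bigD1 [set i]%SET) ?Delta1//= eqxx big1 ?addr0 ?mulr1// => J.
    by move=> /andP[_ /negbTE ->].
  rewrite big1 ?mulr0// => J /andP[_ PJ]; case: eqP PJ => // ->.
  by rewrite (negbTE Pi).
have d'0 K : Delta S K -> \sum_(J | Delta S J && (J \subset K)) d' J = 0.
  move=> DK; rewrite big_split/= -mulr_sumr sumf => [|i _]; last exact: Delta1.
  under [X in _ + _ * X]eq_bigl => i do rewrite finset.sub1set.
  rewrite -/(off_sum S K).
  have : \sum_(J | Delta S J) (d J * off_sum S K + e * (d J * (J \subset K)%:R)) = 0.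
    by rewrite -[RHS](hd K DK); apply: eq_bigr => J _; rewrite /trunc_val; ring.
  rewrite big_split/= -mulr_suml -/s -mulr_sumr.
  have -> : \sum_(J | Delta S J) d J * (J \subset K)%:R =
      \sum_(J | Delta S J && (J \subset K)) d J.
    by rewrite [RHS]big_mkcondr; apply: eq_bigr => J _; case: ifP; rewrite ?mulr1 ?mulr0.
  set z := \sum_(_ | _) _ => h; apply: (mulfI (lt0r_neq0 e0)).
  by rewrite mulr0 -h; field; rewrite gt_eqF.
have {}d'0 J : Delta S J -> d' J = 0.
  have [m] := ubnP #|J|; elim: m J => // m IH J; rewrite ltnS => Jm DJ.
  have := d'0 J DJ; rewrite (bigD1 J)/= ?DJ ?subxx// big1 ?addr0//.
  move=> K /andP[/andP[DK KJ] KJn]; apply: IH => //; apply: leq_trans Jm.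
  by apply: proper_card; rewrite finset.properEneq KJn.
have dE J : Delta S J -> d J = - (s / e) * f J.
  by move=> /d'0; rewrite /d'; lra.
have : s = - (s / e) * \sum_(i : N) off S i.
  have := @sumf xpredT (fun i _ => Delta1 i); under eq_bigl do rewrite andbT.
  by move=> <-; rewrite mulr_sumr /s; apply: eq_bigr.
move=> sE; have s0 : s = 0.
  have : s * (e + \sum_(i : N) off S i) = 0.
    apply: (mulIf (lt0r_neq0 (_ : 0 < e^-1))); first by rewrite invr_gt0.
    rewrite mul0r -[RHS](subrr s) [X in _ = _ - X]sE; field; rewrite gt_eqF//.
  by move/eqP; rewrite mulf_eq0 (negbTE esum) orbF => /eqP.
by move=> J /dE ->; rewrite s0 mul0r oppr0 mul0r.
Qed.

Local Notation trunc J := (Tr e S (face_of S J)).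

Lemma trunc_inj J K : Delta S J -> Delta S K ->
  supp (trunc J) = supp (trunc K) -> J = K.
Proof.
move=> DJ DK h; have e0 : 0 < e by case: ge.
have E G : Delta S G -> (J \subset G) = (K \subset G).
  move=> DG; have := congr1 (fun g => g (nrm_sum G)) h.
  rewrite !(supp_Tr p ge)// /trunc_val => /addrI/(mulfI (lt0r_neq0 e0))/eqP.
  by rewrite eqr_nat; do 2 case: (_ \subset _).
by apply/eqP; rewrite finset.eqEsubset (E K DK) -(E J DJ) !subxx.
Qed.

(** A piecewise linear function on the barycentric fan is determined by its values
    at the face normals, of which there are as many as truncations. *)
Lemma trunc_basis : is_basis
  [set supp Q | Q in [set Tr e S F | F in proper_face S]] (PL (Bar S)).
Proof.
pose f J : V -> R^o := supp (trunc J).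
have BE : [set supp Q | Q in [set Tr e S F | F in proper_face S]] =
    f @` [set J : {set N} | Delta S J].
  rewrite (truncations_set p S0); apply/seteqP; split=> g.
    by move=> [_ [J DJ <-] <-]; exists J.
  by move=> [J DJ <-]; exists (trunc J) => //; exists J.
rewrite BE; split.
- move=> _ [J DJ <-]; exact: (compatible_PL p S0 (compatible_Tr p ge DJ)).
- move=> s c us sB; have sE : perm_eq s
      [seq f J | J <- enum (finset (fun J => Delta S J && (f J \in s)))].
    apply: uniq_perm => //.
      rewrite map_inj_in_uniq ?enum_uniq// => J K.
      by rewrite !mem_enum !inE => /andP[DJ _] /andP[DK _]; exact: trunc_inj.
    move=> g; apply/idP/mapP => [gs|[J]].
      have [J DJ fJ] := sB g gs; exists J => //.
      by rewrite mem_enum inE fJ gs andbT.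
    by rewrite mem_enum inE => /andP[_ h] ->.
  move=> s0; pose d J := if f J \in s then c (f J) else 0.
  have d0 := @trunc_val_free d _.
  move=> g gs; have [J DJ fJ] := sB g gs.
  have -> : c g = d J by rewrite /d fJ gs.
  apply: d0 => // K DK; have := congr1 (fun g => g (nrm_sum K)) s0.
  rewrite fct_sumE /= => h; rewrite -[RHS]h (perm_big _ sE)/= big_map big_enum/=.
  rewrite [LHS]big_mkcond [RHS]big_mkcond/=; apply: eq_bigr => L _; rewrite inE /d.
  case: ifP => //= DL; case: ifP => _; last by rewrite mul0r.
  by rewrite /f !fctE (supp_Tr p ge).
- move=> w wPL; pose DS : {set {set N}} := finset (Delta S (D := D)).
  pose M : 'M[R]_#|DS| := \matrix_(j, k) trunc_val S e (enum_val j) (enum_val k).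
  have ME j i : M j i = trunc_val S e (enum_val j) (enum_val i) by rewrite mxE.
  have evD (j : 'I_#|DS|) : Delta S (enum_val j).
    by have := enum_valP j; rewrite inE.
  have fM : row_free M.
    apply: inj_row_free => v vM.
    pose d J := \sum_(j | enum_val j == J) v 0 j.
    have dv j : d (enum_val j) = v 0 j.
      by rewrite /d (big_pred1 j)// => i; rewrite /= (inj_eq enum_val_inj).
    suff d0 J : Delta S J -> d J = 0.
      by apply/rowP => j; rewrite [RHS]mxE -dv d0.
    apply: trunc_val_free J => K DK; have KDS : K \in DS by rewrite inE.
    have := congr1 (fun u => fun_of_matrix u 0 (enum_rank_in KDS K)) vM.
    rewrite [X in _ = X -> _]mxE => h; rewrite -[RHS]h mxE.
    rewrite (eq_bigl (mem DS)) => [|J]; last by rewrite -[RHS]/(J \in DS) inE.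
    rewrite (big_enum_val (fun J => d J * trunc_val S e J K)); apply: eq_bigr => j _.
    by rewrite dv ME enum_rankK_in.
  pose y : 'rV[R]_#|DS| := \row_k w (nrm_sum (enum_val k)).
  pose z := y *m invmx M.
  have zM : z *m M = y by rewrite /z mulmxKV// -row_free_unit.
  pose cf (g : V -> R^o) := \sum_(j | f (enum_val j) == g) z 0 j.
  have cfE j : cf (f (enum_val j)) = z 0 j.
    rewrite /cf (big_pred1 j)// => i /=; apply/eqP/eqP => [h|->//].
    by apply: enum_val_inj; apply: trunc_inj h; exact: evD.
  exists [seq f J | J <- enum DS], cf; split.
    move=> g /= /mapP[J]; rewrite mem_enum inE => DJ ->; by exists J.
  apply/funext => v; rewrite fct_sumE big_map big_enum/=.
  rewrite (big_enum_val (fun J => (cf (f J) *: f J) v))/=.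
  have [c [l [cc l0 vE]]] := Bar_complete p S0 v.
  have Bc : Bar S (face_cone c) by rewrite (Bar_face_cone p S0); exists c.
  have [x hx] := wPL _ Bc.
  have wK K : K \in c -> w (nrm_sum K) = dot x (nrm_sum K).
    move=> Kc; apply: hx; exists (fun J => (J == K)%:R) => //.
    rewrite (bigD1 K)//= eqxx scale1r big1 ?addr0// => J /andP[_ /negbTE ->].
    by rewrite scale0r.
  have -> : w v = \sum_(K in c) l K * w (nrm_sum K).
    rewrite hx; last by exists l => // J /l0/ltW.
    rewrite vE dot_sumr; apply: eq_bigr => K Kc; by rewrite dotZr wK.
  have wz K : Delta S K -> w (nrm_sum K) = \sum_j z 0 j * trunc_val S e (enum_val j) K.
    move=> DK; have KDS : K \in DS by rewrite inE.
    have := congr1 (fun u => fun_of_matrix u 0 (enum_rank_in KDS K)) zM.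
    rewrite [RHS]mxE enum_rankK_in// => <-; rewrite mxE.
    by apply: eq_bigr => j _; rewrite ME enum_rankK_in.
  under [LHS]eq_bigr => K Kc do rewrite (wz _ (cc.2 _ Kc)) mulr_sumr.
  rewrite exchange_big/=; apply: eq_bigr => j _.
  rewrite fctE cfE /f vE (comb_supp (compatible_Tr p ge (evD j)) cc); last first.
    by move=> J /l0/ltW.
  rewrite -[RHS]/(z 0 j * _) mulr_sumr; apply: eq_bigr => K _; by rewrite mulrCA.
Qed.

Lemma trunc_polytopal_basis :
  polytopal_basis (Bar S) [set Tr e S F | F in proper_face S].
Proof.
split; last exact: trunc_basis.
rewrite (truncations_set p S0) => _ [J DJ <-].
have cJ := compatible_Tr p ge DJ; split; last exact: (compatible_coarsens p S0 cJ).
apply: (compatible_polytope p S0 cJ (compatible_hull p S0 cJ (trunc_pts_hull p ge DJ) _)).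
by move=> c cc; exact: (trunc_pts_chain p ge DJ cc).
Qed.

End Basis.

(** * Omnitruncations *)

Section Spread.
Context {R : realType}.
Variable T : finType.
Implicit Types (c : {set {set T}}) (J K I : {set T}).

(** How quickly the function in [chain_spread] must grow. *)
Definition rate : R := (2 * #|T|.+1)%:R.

(** If [b] grows quickly along inclusions, then a mass distribution on [I] can have
    mass [b K] on every member [K] of a chain and mass more than [b J] on all other
    subsets: spread the increments of [b] along the chain evenly. *)
Lemma chain_spread (b : {set T} -> R) c I : chain c -> I \in c -> finset.set0 \in c ->
  {in c, forall K, K \subset I} -> b finset.set0 = 0 ->
  (forall J K, J \proper K -> K \subset I -> rate * b J < b K) ->
  exists t : T -> R, [/\ forall i, 0 <= t i <= b I,
    {in c, forall K, \sum_(i in K) t i = b K}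
    & forall J, J \subset I -> J != finset.set0 -> J \notin c -> b J < \sum_(i in J) t i].
Proof.
have rate1 : 1 <= rate by rewrite ler1n muln_gt0.
move=> + + + + b0.
have [m] := ubnP #|c|; elim: m c I => // m IH c I; rewrite ltnS => cm ch Ic c0 cI dec.
have bge0 J : J \subset I -> 0 <= b J.
  have [->|J0 JI] := eqVneq J finset.set0; first by rewrite b0.
  by apply: ltW; rewrite -[X in X < _](mulr0 rate) -b0 dec// finset.proper0.
have [I0|I0] := eqVneq I finset.set0.
  exists (fun=> 0); split=> [i|K|J]; first by rewrite lexx I0 b0 lexx.
    move=> /cI; rewrite I0 finset.subset0 => /eqP ->; by rewrite big_set0.
  by rewrite I0 finset.subset0 => /eqP -> /eqP.
have c'c : c :\ I \subset c by exact: subD1set.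
have c'0 : finset.set0 \in c :\ I by rewrite !inE eq_sym I0.
have [K2 K2c K2top] : exists2 K, K \in c :\ I & {in c :\ I, forall J, J \subset K}.
  by apply: chain_top (chainS c'c ch) _; apply/set0Pn; exists finset.set0.
have [K2I K2c'] : K2 != I /\ K2 \in c by move: K2c; rewrite in_setD1 => /andP[].
have K2p : K2 \proper I by rewrite finset.properEneq K2I cI.
have K2s := proper_sub K2p.
have [||t' [t'0 t'c t'J]] := IH (c :\ I) K2 _ (chainS c'c ch) K2c c'0 K2top.
- by apply: leq_trans cm; rewrite [ltnRHS](cardsD1 I) Ic.
- by move=> J K JK KK2; apply: dec => //; exact: fintype.subset_trans K2s.
have [bI bK2] := (bge0 _ (fintype.subxx I), bge0 _ K2s).
have bK2I := dec _ _ K2p (fintype.subxx I).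
have bK2I' : b K2 < b I by apply: le_lt_trans bK2I; rewrite ler_peMl.
pose k := #|I :\: K2|.
have k0 : (0 < k)%N.
  by rewrite card_gt0 finset.setD_eq0; move: K2p; rewrite properE => /andP[].
have kT : (k <= #|T|)%N by exact: max_card.
have k0R : 0 < k%:R :> R by rewrite ltr0n.
pose t i := if i \in K2 then t' i else if i \in I then (b I - b K2) / k%:R else 0.
have q0 : 0 <= (b I - b K2) / k%:R by rewrite divr_ge0 ?ler0n// subr_ge0 ltW.
have tK2 K : K \subset K2 -> \sum_(i in K) t i = \sum_(i in K) t' i.
  by move=> /fintype.subsetP KK2; apply: eq_bigr => i /KK2; rewrite /t => ->.
have t0 i : 0 <= t i.
  by rewrite /t; case: ifP => _; [case/andP: (t'0 i)|case: ifP].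
exists t; split=> [i|K Kc|J JI J0 Jc].
- rewrite t0 /t; case: ifP => _.
    by case/andP: (t'0 i) => _ /le_trans; apply; exact: ltW.
  case: ifP => // _; rewrite ler_pdivrMr//.
  have k1 : 1 <= k%:R :> R by rewrite ler1n.
  nra.
- have [->|KI] := eqVneq K I; last first.
    have Kc' : K \in c :\ I by rewrite in_setD1 KI.
    by rewrite tK2 ?t'c//; exact: K2top.
  rewrite (big_setID K2)/= (finset.setIidPr K2s) tK2// t'c//.
  rewrite (eq_bigr (fun=> (b I - b K2) / k%:R)); last first.
    by move=> i; rewrite finset.in_setD /t => /andP[/negbTE -> ->].
  by rewrite sumr_const -/k -[_ *+ k]mulr_natr divfK ?gt_eqF//; ring.
- have [JK2|/subsetPn[i iJ iK2]] := boolP (J \subset K2).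
    rewrite tK2//; apply: t'J => //; apply: contra Jc; exact: (fintype.subsetP c'c).
  have iI := fintype.subsetP JI i iJ.
  have JpI : J \proper I.
    by rewrite finset.properEneq JI andbT; apply: contraNneq Jc => ->.
  have := dec _ _ JpI (fintype.subxx I); have := bge0 _ JI => bJ bJI.
  rewrite (bigD1 i)//= ltr_wpDr//; first by apply: sumr_ge0 => j _; exact: t0.
  rewrite /t (negbTE iK2) iI ltr_pdivlMr//.
  have kr : 2 * k%:R + 2 <= rate.
    by rewrite /rate -[2 * _]natrM -natrD ler_nat -mulnSr leq_mul2l.
  have : (2 * k%:R + 2) * b J <= rate * b J by rewrite ler_wpM2r.
  have : 2 * b K2 <= rate * b K2.
    rewrite ler_wpM2r//; apply: le_trans kr; lra.
  nra.
Qed.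

End Spread.

(** Dependent choice, with conditions on all the preceding terms. *)
Lemma seq_choice (T : Type) (Q : seq T -> T -> Prop) : (forall s, exists x, Q s x) ->
  exists f : nat -> T, forall i, Q (mkseq f i) (f i).
Proof.
move=> /choice[g hg].
pose hs i : seq T := iteri i (fun=> fun s => rcons s (g s)) [::].
exists (fun i => g (hs i)) => i; suff -> : mkseq (fun i => g (hs i)) i = hs i by exact: hg.
by elim: i => // i IH; rewrite mkseqS IH.
Qed.

Section Omnitruncation.
Context {R : realType} {n : nat}.
Local Notation V := 'rV[R]_n.
Variables (S : set V) (D : @simple_data R n).
Local Notation N := 'I_(fN D).
Hypotheses (p : presents S D) (S0 : S 0).
Implicit Types (J K G : {set N}) (x y v : V) (k : 'I_(vN D)) (c : {set {set N}}).

(** The faces, smaller ones first. *)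
Lemma face_order : exists Js : seq {set N}, [/\ uniq Js,
  forall J, (J \in Js) = Delta S J &
  forall J K, J \in Js -> K \in Js -> J \proper K -> (index K Js < index J Js)%N].
Proof.
pose r J K := (#|K| <= #|J|)%N.
have rt : transitive r by move=> K J L h1 h2; exact: leq_trans h2 h1.
have rtot : total r by move=> J K; exact: leq_total.
exists (sort r (enum (finset (Delta S (D := D))))); split.
- by rewrite sort_uniq enum_uniq.
- by move=> J; rewrite mem_sort mem_enum inE.
move=> J K Js Ks JK; rewrite ltnNge leq_eqVlt; apply/norP; split.
  apply/eqP => e; move: JK; rewrite -(nth_index finset.set0 Js) e nth_index//.
  by rewrite fintype.properxx.
apply/negP => /(sorted_ltn_index rt (sort_sorted rtot _) J K Js Ks).
by rewrite /r leqNgt proper_card.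
Qed.

Variables (Js : seq {set N}) (eta : R).
Hypotheses (uJs : uniq Js) (JsE : forall J, (J \in Js) = Delta S J).
Hypothesis Jsi : forall J K, J \in Js -> K \in Js -> J \proper K ->
  (index K Js < index J Js)%N.
Hypotheses (eta0 : 0 < eta) (etaP : forall k J,
  ~~ (J \subset tight S k) -> forall t, (forall i, 0 <= t i <= eta) ->
  off_sum S J + eta < dot (nrm_sum J) (shift S k t)).

Local Notation Jn i := (nth finset.set0 Js i).

(** The polytope obtained after the truncations by the depths in [s]. *)
Definition stage (s : seq R) : set V := [set x | S x /\ forall j, (j < size s)%N ->
  off_sum S (Jn j) + nth 0 s j <= dot (nrm_sum (Jn j)) x].

Lemma stage_rcons s e : stage (rcons s e) =
  [set x | stage s x /\ off_sum S (Jn (size s)) + e <= dot (nrm_sum (Jn (size s))) x].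
Proof.
apply/seteqP; split=> x.
  move=> [Sx h]; split; last by have := h (size s); rewrite size_rcons nth_rcons ltnn eqxx; exact.
  split=> // j js; have := h j; rewrite size_rcons nth_rcons js; apply.
  exact: ltnW.
move=> [[Sx h] h']; split=> // j; rewrite size_rcons ltnS nth_rcons leq_eqVlt.
by move=> /orP[/eqP->|js]; [rewrite ltnn eqxx|rewrite js; exact: h].
Qed.

Lemma stage_hull s : exists (I : finType) (a : I -> V) (B : {set I}), stage s = hull a B.
Proof.
elim/last_ind: s => [|s e [I [a [B IH]]]].
  exists 'I_(vN D), (@vtx _ _ D), finset.setT; rewrite -(pres_hull p).
  by apply/seteqP; split=> x; [case|move=> Sx; split].
rewrite stage_rcons IH; have [I' [a' [B' E]]] := hull_halfspace a B (nrm_sum (Jn (size s)))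
  (off_sum S (Jn (size s)) + e).
by exists I', a', B'; rewrite -E.
Qed.

(** A point in the relative interior of a face, or of [S] if [J] is empty. *)
Lemma inner_point J k : J \subset tight S k -> exists2 x, S x &
  dot (nrm_sum J) x = off_sum S J /\
  forall K, Delta S K -> ~~ (K \subset J) -> off_sum S K + eta <= dot (nrm_sum K) x.
Proof.
move=> Jk; pose t (i : N) := eta * (i \notin J)%:R.
have t0 i : 0 <= t i <= eta.
  by rewrite /t; case: (i \in J); rewrite /= ?mulr0 ?mulr1 lexx ltW.
exists (shift S k t); first exact: (shift_mem p eta0 etaP).
split.
  rewrite (nrm_sum_shift p)// big1 ?addr0// => i iJ.
  by rewrite /t iJ mulr0.
move=> K DK /subsetPn[i iK iJ]; have [Kk|/etaP/(_ t t0)/ltW//] := boolP (K \subset tight S k).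
rewrite (nrm_sum_shift p)// lerD2l (bigD1 i)//= {1}/t iJ mulr1 lerDl.
by apply: sumr_ge0 => j _; case/andP: (t0 j).
Qed.

(** Depths below the bound [eta], up to which the truncations at different vertices
    do not interact. *)
Definition small s := all (fun e => 0 < e < eta) s.

Lemma stage_point s J k : J \subset tight S k -> small s -> (size s <= size Js)%N ->
  (forall j, (j < size s)%N -> ~~ (Jn j \subset J)) ->
  exists2 x, stage s x & dot (nrm_sum J) x = off_sum S J /\
  forall K, Delta S K -> ~~ (K \subset J) -> off_sum S K + eta <= dot (nrm_sum K) x.
Proof.
move=> Jk ss sJ h; have [x Sx [xJ xK]] := inner_point Jk; exists x => //.
split=> // j js; have js' := leq_trans js sJ.
apply: (le_trans _ (xK _ _ (h j js))); last by rewrite -JsE mem_nth.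
by rewrite lerD2l ltW//; have /allP/(_ _ (mem_nth 0 js))/andP[] := ss.
Qed.

(** When the turn of a face comes, no face containing it has been truncated; thus the
    preceding truncations have kept a part of the face, and truncating it further
    by a small amount is shallow. *)
Lemma stage_next s : small s -> (size s < size Js)%N ->
  let J := Jn (size s) in
  [/\ supp (stage s) (nrm_sum J) = off_sum S J,
    face_of S J `&` stage s = face_in (stage s) (nrm_sum J)
  & 0 < depth (stage s) (face_of S J `&` stage s) (nrm_sum J)].
Proof.
move=> ss sJ /=; set J := Jn (size s).
have JJs : J \in Js by exact: mem_nth.
have DJ : Delta S J by rewrite -JsE.
have [J0 /existsP[k Jk]] := andP DJ.
have before j : (j < size s)%N -> ~~ (Jn j \subset J).
  move=> js; have js' := ltn_trans js sJ; apply/negP => jJ.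
  have [e|ne] := eqVneq (Jn j) J.
    have /eqP := e; rewrite nth_uniq// => /eqP jE; by rewrite jE ltnn in js.
  have := Jsi (mem_nth _ js') JJs (_ : Jn j \proper J).
  rewrite finset.properEneq ne jJ => /(_ isT); rewrite !index_uniq// ltnNge.
  by rewrite ltnW.
have [x Px [xJ _]] := stage_point Jk ss (ltnW sJ) before.
have sP : supp (stage s) (nrm_sum J) = off_sum S J.
  by rewrite -xJ; apply: supp_min => // y [Sy _]; rewrite xJ; exact: (nrm_sum_ge p).
have FE : face_of S J `&` stage s = face_in (stage s) (nrm_sum J).
  apply/seteqP; split=> y; first by move=> [[Sy /(nrm_sum_eq p _ Sy) h] Py]; split=> //; rewrite sP.
  by move=> [Py]; rewrite sP; have [Sy _] := Py => /(nrm_sum_eq p _ Sy) h; split.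
split=> //; rewrite FE; have [I [a [B PE]]] := stage_hull s; rewrite PE.
have none j : (j < size s)%N -> ~~ (Jn j \subset finset.set0).
  move=> js; rewrite finset.subset0.
  have : Delta S (Jn j) by rewrite -JsE mem_nth// (ltn_trans js).
  by case/andP.
have [y Py [_ yK]] := stage_point (finset.sub0set (tight S k)) ss (ltnW sJ) none.
have /yK := DJ; rewrite finset.subset0 J0 => /(_ isT) yJ.
apply: (@depth_gt0 _ _ _ _ _ _ y); first by rewrite -PE.
by rewrite -PE sP gt_eqF// (lt_le_trans _ yJ)// ltrDl.
Qed.

(** The depths are chosen one after the other; each of them is shallow and much
    smaller than the preceding ones. *)
Lemma depths_exist : exists f : nat -> R, forall i, (i < size Js)%N ->
  [/\ 0 < f i < eta, small (mkseq f i),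
    f i < depth (stage (mkseq f i)) (face_of S (Jn i) `&` stage (mkseq f i)) (nrm_sum (Jn i))
  & forall j, (j < i)%N -> rate N * f i < f j].
Proof.
pose Q (s : seq R) (x : R) := small s -> (size s < size Js)%N -> [/\ 0 < x < eta,
  x < depth (stage s) (face_of S (Jn (size s)) `&` stage s) (nrm_sum (Jn (size s)))
  & forall j, (j < size s)%N -> rate N * x < nth 0 s j].
have [s|f hf] := @seq_choice R Q.
  have [[ss sJ]|h] := pselect (small s /\ (size s < size Js)%N); last first.
    by exists 0 => ss sJ; case: h.
  have [_ _ dep] := stage_next ss sJ.
  have [d d0 hd] : exists2 d : R, 0 < d & forall x : R, 0 < x < d ->
      forall j : 'I_(size s), rate N * x < nth 0 s j.
    apply: fin_small => j.
    have [|d d0 hd] := @lin_small _ (nth 0 s j) (rate N).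
      by have /allP/(_ _ (mem_nth 0 (ltn_ord j)))/andP[] := ss.
    by exists d => // x /hd; rewrite mulrC.
  have [|x x0] := @small_pick _ (fun x : R => x < Num.min d (Num.min eta
      (depth (stage s) (face_of S (Jn (size s)) `&` stage s) (nrm_sum (Jn (size s)))))).
    exists (Num.min d (Num.min eta
      (depth (stage s) (face_of S (Jn (size s)) `&` stage s) (nrm_sum (Jn (size s)))))).
      by rewrite !lt_min d0 eta0.
    by move=> x /andP[].
  rewrite !lt_min => /and3P[xd xe xp]; exists x => _ _; split=> //.
    by rewrite x0.
  by move=> j js; apply: (hd x _ (Ordinal js)); rewrite x0.
have sm i : (i <= size Js)%N -> small (mkseq f i).
  elim: i => // i IH iJ; rewrite mkseqS /small all_rcons -/(small _) IH ?(ltnW iJ)// andbT.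
  by have [] := hf i (IH (ltnW iJ)); rewrite size_mkseq.
exists f => i iJ; have [] := hf i (sm i (ltnW iJ)); rewrite size_mkseq// => fi fd fr.
split=> //; first exact/sm/ltnW.
by move=> j ji; have := fr j ji; rewrite nth_mkseq.
Qed.

Section Depths.
Variable f : nat -> R.
Hypothesis fP : forall i, (i < size Js)%N ->
  [/\ 0 < f i < eta, small (mkseq f i),
    f i < depth (stage (mkseq f i)) (face_of S (Jn i) `&` stage (mkseq f i)) (nrm_sum (Jn i))
  & forall j, (j < i)%N -> rate N * f i < f j].

Let Fs := [seq face_of S J | J <- Js].
Let T := stage (mkseq f (size Js)).

Lemma truncations_stage i : (i <= size Js)%N ->
  truncations S (fun F => f (index F Fs)) (take i Fs) = stage (mkseq f i).
Proof.
have uFs : uniq Fs.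
  rewrite map_inj_in_uniq// => J K; rewrite !JsE => DJ DK; exact: (face_of_inj p).
elim: i => [_|i IH iJ].
  by rewrite take0 /=; apply/seteqP; split=> x; [move=> Sx; split|case].
have iF : (i < size Fs)%N by rewrite size_map.
rewrite (@take_nth _ (face_of S (finset.set0 : {set N})) i Fs iF) -cats1 /truncations foldl_cat.
rewrite -/(truncations S _ (take i Fs)) (IH (ltnW iJ)) mkseqS stage_rcons size_mkseq /=.
have [fi sm _ _] := fP iJ.
have [] := stage_next sm; rewrite size_mkseq// => sP _ _.
rewrite index_uniq// (nth_map finset.set0)// (face_normal_face_of p); last first.
  by rewrite -JsE mem_nth.
by rewrite /truncate sP.
Qed.

Lemma omnitruncation_stage : omnitruncation S T.
Proof.
have uFs : uniq Fs.
  rewrite map_inj_in_uniq// => J K; rewrite !JsE => DJ DK; exact: (face_of_inj p).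
have iFs J : J \in Js -> index (face_of S J) Fs = index J Js.
  move=> JJ; rewrite -{1}(nth_index finset.set0 JJ) -(nth_map _ (face_of S J)) ?index_mem//.
  by rewrite index_uniq// size_map index_mem.
exists Fs, (fun F => f (index F Fs)); split.
- split=> //; apply/seteqP; split=> F /=.
    by move=> /mapP[J]; rewrite JsE => DJ ->; exact: face_of_proper.
  by move=> /(proper_face_of p)[J DJ ->]; apply: map_f; rewrite JsE.
- move=> _ _ /mapP[J JJ ->] /mapP[K KK ->] [JK KJ]; rewrite !iFs//; apply: Jsi => //.
  move: (JJ) (KK); rewrite !JsE => DJ DK.
  rewrite properE; apply/andP; split; first exact/(face_of_subset p _ DJ).
  by apply/negP => h; apply: KJ; apply/(face_of_subset p _ DK).
- move=> _ /mapP[J JJ ->] /=; rewrite iFs//.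
  have iJ : (index J Js < size Js)%N by rewrite index_mem.
  rewrite (truncations_stage (ltnW iJ)); have [/andP[f0 _] _ + _] := fP iJ.
  by rewrite nth_index// f0 (face_normal_face_of p) -?JsE.
- by rewrite /T -(truncations_stage (leqnn _)) take_oversize// size_map.
Qed.

(** The values of the support function of the omnitruncation. *)
Definition omni_val K : R := off_sum S K + f (index K Js).

Lemma omnitruncation_mem x : T x <-> S x /\
  forall K, Delta S K -> omni_val K <= dot (nrm_sum K) x.
Proof.
split=> -[Sx h]; split=> //.
  move=> K; rewrite -JsE => KJ; have iJ : (index K Js < size Js)%N by rewrite index_mem.
  by have := h (index K Js); rewrite size_mkseq nth_mkseq// nth_index//; exact.
move=> j; rewrite size_mkseq => jJ; rewrite nth_mkseq//.
by have := h (Jn j); rewrite -JsE mem_nth// /omni_val index_uniq//; exact.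
Qed.

(** The points of the omnitruncation attached to the chains at a vertex. *)
Lemma omnitruncation_point c k : face_chain S c -> (forall K, K \in c -> K \subset tight S k) ->
  exists x, [/\ T x, forall K, K \in c -> dot (nrm_sum K) x = omni_val K
    & forall G, Delta S G -> G \notin c -> G != tight S k -> omni_val G < dot (nrm_sum G) x].
Proof.
move=> [ch cD] ck; pose b J := if J == finset.set0 then 0 else f (index J Js).
have DJ J : J \subset tight S k -> J != finset.set0 -> J \in Js.
  by move=> Jk J0; rewrite JsE; apply/andP; split=> //; apply/existsP; exists k.
have b0 J : J \subset tight S k -> 0 <= b J <= eta.
  move=> Jk; rewrite /b; case: eqVneq => [_|J0]; first by rewrite lexx ltW.
  have iJ : (index J Js < size Js)%N by rewrite index_mem DJ.
  by have [/andP[f0 fe] _ _ _] := fP iJ; rewrite !ltW.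
pose c' := finset.set0 |: (tight S k |: c).
have inc' K : (K \in c') = [|| K == finset.set0, K == tight S k | K \in c].
  by rewrite !finset.in_setU1.
have [||||||t [t0 tc tJ]] := @chain_spread R _ b c' (tight S k).
- apply: chain_setU1 => [|K _]; last by rewrite finset.sub0set.
  by apply: chain_setU1 => // K /ck ->; rewrite orbT.
- by rewrite inc' eqxx orbT.
- by rewrite inc' eqxx.
- move=> K; rewrite inc' => /or3P[/eqP->|/eqP->|/ck//]; first exact: finset.sub0set.
  exact: fintype.subxx.
- by rewrite /b eqxx.
- move=> J K JK Kk; have K0 : K != finset.set0.
    by apply: contraTneq JK => ->; rewrite properE finset.sub0set andbF.
  have KJ := DJ _ Kk K0; have iK : (index K Js < size Js)%N by rewrite index_mem.
  rewrite /b (negbTE K0); case: eqVneq => [_|J0].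
    by rewrite mulr0; have [/andP[]] := fP iK.
  have JJ := DJ _ (fintype.subset_trans (proper_sub JK) Kk) J0.
  have iJ : (index J Js < size Js)%N by rewrite index_mem.
  by have [_ _ _ h] := fP iJ; apply: h; exact: Jsi.
have bE K : Delta S K -> b K = f (index K Js).
  by case/andP => /negbTE K0 _; rewrite /b K0.
have te i : 0 <= t i <= eta.
  have /andP[-> /le_trans ti] := t0 i; apply: ti.
  by have /andP[] := b0 _ (fintype.subxx (tight S k)).
have eqc K : K \in c' -> Delta S K -> dot (nrm_sum K) (shift S k t) = omni_val K.
  move=> Kc DK; rewrite (nrm_sum_shift p) ?tc ?bE//.
  move: Kc; rewrite inc' => /or3P[/eqP->|/eqP->|/ck//]; first exact: finset.sub0set.
  exact: fintype.subxx.
have gtc K : K \notin c' -> Delta S K -> omni_val K < dot (nrm_sum K) (shift S k t).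
  move=> Kc DK; have [Kk|Kk] := boolP (K \subset tight S k).
    rewrite (nrm_sum_shift p)// ltrD2l -bE// tJ//.
    by case/andP: DK.
  apply: lt_trans (etaP Kk te); rewrite ltrD2l.
  have iK : (index K Js < size Js)%N by rewrite index_mem JsE.
  by have [/andP[]] := fP iK.
exists (shift S k t); split.
- apply/omnitruncation_mem; split; first exact: (shift_mem p eta0 etaP).
  move=> K DK; have [Kc|Kc] := boolP (K \in c'); first by rewrite eqc.
  exact/ltW/gtc.
- by move=> K Kc; apply: eqc; [rewrite inc' Kc !orbT|exact: cD].
- move=> G DG Gc Gk; apply: gtc => //; rewrite inc' (negbTE Gc) (negbTE Gk) !orbF.
  by case/andP: DG.
Qed.

Lemma omnitruncation_normal_fan : normal_fan T = Bar S.
Proof.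
have pick c : face_chain S c -> exists k, forall K, K \in c -> K \subset tight S k.
  move=> [ch cD]; have [->|c0] := eqVneq c finset.set0.
    by have [k _] := S_argmin p 0 S0; exists k => K; rewrite inE.
  have [K1 K1c K1top] := chain_top ch c0.
  have /andP[_ /existsP[k K1k]] := cD _ K1c.
  by exists k => K /K1top/fintype.subset_trans; exact.
apply: (@compatible_normal_fan _ _ _ _ p S0 T omni_val).
  split=> [J DJ x /omnitruncation_mem[_]|c cc]; first exact.
  have [k ck] := pick c cc; have [x [Tx hx _]] := omnitruncation_point cc ck.
  by exists x.
move=> c G cc DG Gc; suff [k ck Gk] : exists2 k,
    forall K, K \in c -> K \subset tight S k & G != tight S k.
  by have [x [Tx hx h]] := omnitruncation_point cc ck; exists x; split=> //; exact: h.
have [G0 /existsP[kG GkG]] := andP DG.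
have [->|c0] := eqVneq c finset.set0.
  have [||k _ Gk] := @vertex_pick _ _ _ _ p finset.set0 G kG.
  - exact: finset.sub0set.
  - by rewrite finset.subset0.
  by exists k => [K|]; [rewrite inE|apply: contraNneq Gk => ->; exact: fintype.subxx].
have [K1 K1c K1top] := chain_top cc.1 c0.
have /andP[_ /existsP[k0 K1k0]] := cc.2 _ K1c.
have [GK1|GK1] := boolP (G \subset K1).
  exists k0 => [K /K1top/fintype.subset_trans|]; first exact.
  apply: contraNneq Gc => GE; suff -> : G = K1 by [].
  by apply/eqP; rewrite finset.eqEsubset GK1 GE.
have [k K1k Gk] := vertex_pick p K1k0 GK1.
exists k => [K /K1top/fintype.subset_trans|]; first exact.
by apply: contraNneq Gk => ->; exact: fintype.subxx.
Qed.

End Depths.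
End Omnitruncation.

Lemma omnitruncation_exists (R : realType) (n : nat) (S : set 'rV[R]_n) (D : @simple_data R n) :
  presents S D -> S 0 -> exists2 T, omnitruncation S T & normal_fan T = Bar S.
Proof.
move=> p S0; have [Js [uJs JsE Jsi]] := @face_order _ _ S D.
have [eta eta0 etaP] := small_pick (small_shift p).
have [f fP] := depths_exist p uJs JsE Jsi eta0 etaP.
exists (stage S Js (mkseq f (size Js))).
  exact: (omnitruncation_stage p S0 uJs JsE Jsi eta0 etaP fP).
exact: (omnitruncation_normal_fan p S0 uJs JsE Jsi eta0 etaP fP).
Qed.

(** * Smooth polytopes with primitive edges *)

Section IntegerVectors.
Context {n : nat}.
Implicit Types w x y z : 'rV[int]_n.

(** The integral scalar product. *)
Definition idot x y : int := \sum_i x 0 i * y 0 i.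

Lemma dot_lattice (R : realType) x y :
  dot (of_lattice x) (of_lattice y) = (idot x y)%:~R :> R.
Proof.
rewrite /dot /idot (big_morph (intr : int -> R) (id1 := 0) (op1 := +%R))//.
- by apply: eq_bigr => i _; rewrite !mxE intrM.
- by move=> a b; rewrite intrD.
Qed.

Lemma idot_comb x (s : seq 'rV[int]_n) (c : 'rV[int]_n -> int) :
  idot x (\sum_(y <- s) c y *: y) = \sum_(y <- s) c y * idot x y.
Proof.
rewrite /idot; under eq_bigr do rewrite summxE mulr_sumr.
rewrite exchange_big/=; apply: eq_bigr => y _; rewrite mulr_sumr.
by apply: eq_bigr => i _; rewrite mxE; ring.
Qed.

Lemma idot_delta x (i : 'I_n) : idot x (delta_mx 0 i) = x 0 i.
Proof.
rewrite /idot (bigD1 i)//= mxE !eqxx mulr1 big1 ?addr0// => j ji.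
by rewrite mxE eqxx (negbTE ji) mulr0.
Qed.

Lemma of_lattice_inj (R : realType) : injective (@of_lattice R n).
Proof.
move=> x y /rowP h; apply/rowP => i; have := h i; rewrite !mxE.
by move=> /eqP; rewrite eqr_int => /eqP.
Qed.

Lemma of_latticeB (R : realType) x y :
  of_lattice (x - y) = of_lattice x - of_lattice y :> 'rV[R]_n.
Proof. by rewrite /of_lattice raddfB. Qed.

Lemma primitive_neq0 w : primitive w -> w != 0.
Proof. by move=> /(_ 0%N 0) h; apply/eqP => w0; have := h w0. Qed.

(** A lattice vector on the ray of a primitive vector is a multiple of it. *)
Lemma primitive_ray (R : realType) w y (l : R) : primitive w -> 0 < l ->
  of_lattice y = l *: of_lattice w -> exists2 q : nat, (0 < q)%N & y = w *+ q.
Proof.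
move=> pw l0 yl; have yE i : (y 0 i)%:~R = l * (w 0 i)%:~R :> R.
  by have /rowP/(_ i) := yl; rewrite !mxE.
have [j wj] : exists j, w 0 j != 0.
  apply/existsP; apply: contraNT (primitive_neq0 pw); rewrite negb_exists => /forallP h.
  by apply/eqP/rowP => i; rewrite mxE; apply/eqP; move: (h i); rewrite negbK.
pose a := `|w 0%R j|%N; pose b := `|y 0%R j|%N.
have a0 : (0 < a)%N by rewrite absz_gt0.
have ab i : a%:Z * y 0 i = b%:Z * w 0 i.
  apply: (@intr_inj R); rewrite !intrM /a /b !abszE !intr_norm !yE.
  by rewrite normrM (gtr0_norm l0); ring.
have b0 : (0 < b)%N.
  rewrite absz_gt0 -(intr_eq0 R) yE; apply: mulf_neq0; last by rewrite intr_eq0.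
  by rewrite gt_eqF.
pose g := gcdn a b; have g0 : (0 < g)%N by rewrite gcdn_gt0 a0.
have aE : a = (a %/ g * g)%N by rewrite divnK// dvdn_gcdl.
have bE : b = (b %/ g * g)%N by rewrite divnK// dvdn_gcdr.
pose a' := (a %/ g)%N; pose b' := (b %/ g)%N.
have co : coprime a' b'.
  have : (gcdn a' b' * g == 1 * g)%N by rewrite muln_gcdl -aE -bE mul1n.
  by rewrite eqn_pmul2r.
have ab' i : a'%:Z * y 0 i = b'%:Z * w 0 i.
  apply: (@mulfI _ g%:Z); first by rewrite eqz_nat -lt0n.
  have := ab i; rewrite aE bE !PoszM -/a' -/b' => h.
  by rewrite !mulrA !(mulrC g%:Z).
have [z wz] : exists z, w = z *+ a'.
  have dv i : (a'%:Z %| w 0%R i)%Z.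
    by rewrite -(@Gauss_dvdzr _ b'%:Z) ?coprimezE// -ab' dvdz_mulr.
  exists (\row_i (w 0%R i %/ a'%:Z)%Z); apply/rowP => i; rewrite mulmxnE mxE.
  by rewrite -mulr_natr natz divzK.
have a'1 := pw _ _ wz; exists b'; first by rewrite divn_gt0// dvdn_leq// dvdn_gcdr.
apply/rowP => i; rewrite mulmxnE -mulr_natl natz -ab' a'1; by rewrite mul1r.
Qed.

End IntegerVectors.

Section Smooth.
Context {R : realType} {n : nat}.
Local Notation V := 'rV[R]_n.
Variables (S : set V) (D : @simple_data R n).
Local Notation N := 'I_(fN D).
Hypotheses (p : presents S D) (S0 : S 0).
Hypotheses (smoothS : smooth S) (primS : forall E, edge S E -> lattice_length_one E).
Implicit Types (J K G : {set N}) (x y v : V) (k : 'I_(vN D)) (c : {set {set N}}).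

Lemma vertexP y : vertex S y <-> exists k, y = vtx k.
Proof.
split=> [|[k ->]]; last exact: pres_vertex.
by rewrite {1}(pres_hull p) => /vertex_hull[k _ ->]; exists k.
Qed.

Lemma vtx_lattice k : exists z, of_lattice z = vtx k.
Proof. by have [_ h _] := smoothS; have [z _ zk] := h _ (pres_vertex p k); exists z. Qed.

Lemma tight_zero k v : (forall j, j \in tight S k -> dot (nrm j) v = 0) -> v = 0.
Proof.
move=> h; apply/eqP; apply: contraT => /dot_gt0; rewrite {1}(pres_expand p k v) dot_suml.
by rewrite big1 ?ltxx// => j /h; rewrite dotZl => ->; rewrite mulr0.
Qed.

(** The edge at a vertex that leaves one of its facets, and its other end. *)
Lemma edge_face k i : i \in tight S k -> exists k' (s : R),
  [/\ 0 < s, vtx k' = vtx k + s *: dual k i, edge S (face_of S (tight S k :\ i)),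
      face_of S (tight S k :\ i) (vtx k) & face_of S (tight S k :\ i) (vtx k')].
Proof.
move=> ik; set J := tight S k :\ i; have Jk : J \subset tight S k by exact: subD1set.
have iJ : i \notin J by rewrite !inE eqxx.
have FE : face_of S J = face_in S (nrm_sum J).
  have sJ : supp S (nrm_sum J) = off_sum S J.
    rewrite -(nrm_sum_vtx p Jk); apply: supp_min; first exact: S_vtx.
    by move=> z Sz; rewrite (nrm_sum_vtx p)// (nrm_sum_ge p).
  apply/seteqP; split=> x [Sx h]; split=> //; first by rewrite sJ; apply/(nrm_sum_eq p).
  by move: h; rewrite sJ => /(nrm_sum_eq p _ Sx).
have Jv : face_of S J (vtx k) by apply/(face_of_vtx p).
have ti j : j \in tight S k -> dot (nrm j) (vtx k) = off S j by move=> /tightP.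
have [e e0 [ge _]] := small_pick (small_good p).
pose y := vtx k + e *: dual k i.
have Sy : S y by case: ge => _ _; exact.
have yi : dot (nrm i) y = off S i + e.
  by rewrite dotDr dotZr (pres_dual p ik ik) eqxx mulr1 ti.
have Jy : face_of S J y.
  by split=> //; apply/(nrm_sum_eq p) => //; rewrite (good_edge p ge ik Jk) (negbTE iJ) mulr0 addr0.
have line z : face_of S J z -> z = vtx k + (dot (nrm i) z - off S i) *: dual k i.
  move=> [Sz hz]; apply/eqP; rewrite -subr_eq0; apply/eqP/(@tight_zero k) => j jk.
  rewrite dotBr dotDr dotZr (pres_dual p ik jk) ti//.
  have [->|ji] := eqVneq j i; first by rewrite mulr1; ring.
  by rewrite hz ?mulr0 ?addr0 ?subrr// in_setD1 ji.
have hy : hull (@vtx _ _ D) (argmin (@vtx _ _ D) finset.setT (nrm_sum J)) y.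
  by rewrite -face_in_hull -(pres_hull p) -FE.
have [k' k'h k'min] := hull_argmin (@vtx _ _ D) (- nrm i) (hull_nonempty hy).
have Jk' : face_of S J (vtx k').
  by rewrite FE {1}(pres_hull p) face_in_hull; exact: hull_mem.
have s0 : 0 < dot (nrm i) (vtx k') - off S i.
  have := k'min _ hy; rewrite !dotNl lerN2 yi; lra.
exists k', (dot (nrm i) (vtx k') - off S i); split=> //; first exact: line.
split; first by rewrite FE; split; [exists (vtx k); rewrite -FE|exists (nrm_sum J)].
apply: (@affdim_line _ _ _ (vtx k) (vtx k') (dual k i)) => //; last first.
  by move=> z /line zE; exists (dot (nrm i) z - off S i).
by apply: contraTneq s0 => <-; rewrite ti// subrr ltxx.
Qed.

(** The other end of an edge is at lattice distance one: if [m] is the distance of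
    its other end from the facet [i], then every edge vector at the vertex, and thus
    every lattice vector, has a pairing with the facet normal divisible by [m]; but
    this normal is primitive. *)
Lemma smooth_edge k i : i \in tight S k -> exists k', vtx k' = vtx k + dual k i.
Proof.
move=> ik; have [k' [s [s0 k'E edgeE Ek Ek']]] := edge_face ik.
set E := face_of S _ in edgeE Ek Ek'; exists k'.
have [z zk] := vtx_lattice k; have [z' zk'] := vtx_lattice k'.
pose L := z' - z; have LE : of_lattice L = s *: dual k i :> V.
  by rewrite of_latticeB zk zk' k'E addrAC subrr add0r.
have sE : s = (idot (lat i) L)%:~R.
  by rewrite -dot_lattice LE dotZr -/(nrm i) (pres_dual p ik ik) eqxx mulr1.
have dual0 : dual k i != 0.
  apply/eqP => d0; have := pres_dual p ik ik; rewrite d0 dot0r eqxx => /eqP.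
  by rewrite eq_sym oner_eq0.
have tS w (t : R) : 0 < t -> S (vtx k + t *: of_lattice w) -> forall j,
    j \in tight S k -> 0 <= dot (nrm j) (of_lattice w).
  move=> t0 Sw j /tightP jk; have := S_off p j Sw.
  by rewrite dotDr dotZr jk lerDl pmulr_rge0.
have Emid l : 0 <= l <= 1 -> E (vtx k + l *: of_lattice L).
  move=> /andP[l0 l1].
  have lc (v : V) : dot v (vtx k + l *: of_lattice L) =
      (1 - l) * dot v (vtx k) + l * dot v (vtx k').
    by rewrite LE k'E !dotDr !dotZr; ring.
  have l1' : 0 <= 1 - l by rewrite subr_ge0.
  split.
    rewrite (pres_ineq p) => j; rewrite lc.
    have := S_off p j (S_vtx p k); have := S_off p j (S_vtx p k').
    move=> /(ler_wpM2l l0) h1 /(ler_wpM2l l1') h2; lra.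
  by move=> j jJ; rewrite lc (Ek.2 _ jJ) (Ek'.2 _ jJ); ring.
(* an edge vector [w] that leaves facet [i] is parallel to [L], and [vtx k + w] is
   a lattice point of the edge different from [vtx k], hence the other end *)
have edgeL w : edge_vectors S (vtx k) w -> idot (lat i) w != 0 -> w = L.
  move=> [pw [F [t [[[_ [g FE]] dF] Fk t0 Ft]]]] iw.
  have Sk : S (vtx k) by exact: S_vtx.
  have St : S (vtx k + t *: of_lattice w) by move: Ft; rewrite FE => -[].
  have w0 := tS w t t0 St.
  have gw : dot g (of_lattice w) = 0.
    move: Fk Ft; rewrite FE => -[_ gk] [_]; rewrite dotDr gk dotZr => /eqP.
    by rewrite -subr_eq0 addrAC subrr add0r mulf_eq0 gt_eqF//= => /eqP.
  have [e e0 [[_ _ ge] _]] := small_pick (small_good p).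
  have g0 j : j \in tight S k -> 0 <= dot g (dual k j).
    move=> /ge /(supp_le p g); move: Fk; rewrite FE => -[_ <-].
    by rewrite dotDr dotZr lerDl pmulr_rge0.
  have iw0 : 0 < dot (nrm i) (of_lattice w).
    by rewrite lt_neqAle w0// andbT dot_lattice eq_sym intr_eq0.
  have gi : dot g (dual k i) = 0.
    have /eqP := gw; rewrite {1}(pres_expand p k g) dot_suml.
    under eq_bigr do rewrite dotZl.
    rewrite psumr_eq0 => [/allP/(_ i)|j jk]; last by rewrite mulr_ge0 ?g0 ?w0.
    rewrite mem_index_enum => /(_ isT)/implyP/(_ ik).
    by rewrite mulf_eq0 (gt_eqF iw0) orbF => /eqP.
  have Fe : F (vtx k + e *: dual k i).
    rewrite FE; split; first exact: ge.
    by rewrite dotDr dotZr gi mulr0 addr0; move: Fk; rewrite FE => -[].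
  have /sub_rVP[a aE] : (dual k i <= of_lattice w)%MS.
    apply: contraT => nd.
    have wn0 : t *: of_lattice w != 0 :> V.
      rewrite scaler_eq0 gt_eqF//=; apply: contraTneq iw0 => ->.
      by rewrite dot0r ltxx.
    suff : (1 + 1 <= affdim F)%N by rewrite dF.
    apply: (@affdim_ge _ _ F (vtx k) _ (col_mx (t *: of_lattice w) (e *: dual k i))) => //.
      move=> r; case: (split_ordP r) => j ->.
        by rewrite rowKu row_id.
      by rewrite rowKd row_id.
    rewrite /row_free -addsmxE mxrank_disjoint_sum.
      have en0 : e *: dual k i != 0 by rewrite scaler_eq0 (gt_eqF e0).
      by rewrite !rank_rV wn0 en0.
    apply/eqP; rewrite -submx0; apply/rV_subP => y; rewrite sub_capmx.
    move=> /andP[/sub_rVP[b ->] /sub_rVP[c bc]]; rewrite bc.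
    have [->|c0] := eqVneq c 0; first by rewrite scale0r sub0mx.
    case/negP: nd; have -> : dual k i = ((c * e)^-1 * (b * t)) *: of_lattice w.
      rewrite -!scalerA [b *: _]scalerA -scalerA bc !scalerA.
      by rewrite -mulrA mulVf ?scale1r// mulf_neq0// gt_eqF.
    exact: scalemx_sub.
  have a0 : 0 < a.
    have : 0 < a * dot (nrm i) (of_lattice w).
      by rewrite -dotZr -aE (pres_dual p ik ik) eqxx.
    by rewrite pmulr_lgt0.
  have LwE : of_lattice L = (s * a) *: of_lattice w :> V by rewrite LE aE scalerA.
  have [q q0 Lq] := primitive_ray pw (mulr_gt0 s0 a0) LwE.
  have q0R : 0 < q%:R :> R by rewrite ltr0n.
  have wq : of_lattice w = q%:R^-1 *: of_lattice L :> V.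
    by rewrite Lq of_latticeMn scalerA mulVf ?scale1r// gt_eqF.
  have Ew : E (vtx k + of_lattice w).
    rewrite wq; apply: Emid; rewrite invr_ge0 ltW//=.
    by rewrite invf_le1// ler1n.
  have vw : vertex E (vtx k + of_lattice w).
    have <- : E `&` range of_lattice = vertex E by exact: primS.
    by split=> //; exists (z + w) => //; rewrite /of_lattice raddfD -zk.
  have [_ [h hE]] := vw.
  have [I [a1 [B EE]]] : exists (I : finType) (a : I -> V) (B : {set I}), E = hull a B.
    have [[_ [g' ->]] _] := edgeE; rewrite (pres_hull p) face_in_hull.
    by exists 'I_(vN D), (@vtx _ _ D), (argmin (@vtx _ _ D) finset.setT g').
  have hx : dot h (vtx k + of_lattice w) = supp E h.
    by have : [set vtx k + of_lattice w] (vtx k + of_lattice w) by []; rewrite hE => -[].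
  have hk : supp E h <= dot h (vtx k) by move: Ek; rewrite EE; exact: hull_supp_le.
  have hk' : supp E h <= dot h (vtx k') by move: Ek'; rewrite EE; exact: hull_supp_le.
  have k'L : vtx k' = vtx k + of_lattice L by rewrite k'E LE.
  have h' : dot h (vtx k') = supp E h.
    move: hx hk'; rewrite k'L wq !dotDr dotZr => hx hk'.
    have /(_ (dot h (of_lattice L)))/eqP := mulKf (lt0r_neq0 q0R).
    have q1 : 1 <= q%:R :> R by rewrite ler1n.
    move: hx hk hk'; set X := dot h _; set Y := dot h (of_lattice L) => hx hk hk' _.
    have qY : q%:R^-1 * Y = supp E h - X by rewrite -hx; ring.
    have YE : Y = q%:R * (supp E h - X) by rewrite -qY mulrA mulfV ?mul1r// gt_eqF.
    nra.
  have : face_in E h (vtx k') by [].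
  rewrite -hE /= k'L => /addrI /of_lattice_inj; exact.
have [m mE] : exists m : nat, idot (lat i) L = m%:Z.
  have : 0 <= idot (lat i) L by rewrite -(ler0z R) -sE ltW.
  by case: (idot _ _) => // m _; exists m.
have dvd (x : 'rV[int]_n) : exists b : int, idot (lat i) x = b * m%:Z.
  have [_ _ basis] := smoothS; have [_ _ span] := basis _ (pres_vertex p k).
  have [l [c [le ->]]] := span x Logic.I.
  rewrite idot_comb big_seq; elim/big_ind: _ => [|_ _ [a ->] [b ->]|w wl].
  - by exists 0; rewrite mul0r.
  - by exists (a + b); rewrite mulrDl.
  have [->|/edgeL wL] := eqVneq (idot (lat i) w) 0; first by exists 0; rewrite mulr0 mul0r.
  by exists (c w); rewrite (wL (le _ wl)) mE.
have [f fE] := choice dvd.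
have /(pres_primitive p) m1 : lat i = (\row_j f (delta_mx 0 j)) *+ m.
  by apply/rowP => j; rewrite mulmxnE mxE -mulr_natr natz -fE idot_delta.
by rewrite k'E sE mE m1 scale1r.
Qed.

Lemma off_int (i : N) : exists z : int, off S i = z%:~R.
Proof.
have /andP[_ /existsP[k]] := Delta1 p S0 i; rewrite finset.sub1set => /tightP <-.
by have [z <-] := vtx_lattice k; exists (idot (lat i) z); rewrite dot_lattice.
Qed.

Lemma good1 : good S D 1.
Proof.
split=> // [k J /(nrm_sum_vtx_gt p)|k i ik]; last first.
  by rewrite scale1r; have [k' <-] := smooth_edge ik; exact: S_vtx.
have [a ->] : exists z : int, off_sum S J = z%:~R.
  rewrite /off_sum; elim/big_ind: _ => [|_ _ [a ->] [b ->]|i _]; last exact: off_int.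
    by exists 0.
  by exists (a + b); rewrite intrD.
have [z <-] := vtx_lattice k; rewrite nrm_sum_lattice dot_lattice.
by rewrite ltr_int -[1]/(1%:~R) -intrD ler_int lezD1.
Qed.

Lemma depth1 J : Delta S J -> depth S (face_of S J) (face_normal S (face_of S J)) = 1.
Proof.
move=> DJ; rewrite (face_normal_face_of p)// /depth (supp_nrm_sum p)//.
set A := [set _ | _ in _]; have A1 r : A r -> 1 <= r.
  move=> [y [/vertexP[k ->] yJ _] <-]; rewrite lerBrDl.
  have [_ h _] := good1; apply: h; apply/negP => /(face_of_vtx p); exact: yJ.
have [J0 /existsP[k Jk]] := andP DJ; have [i iJ] := set0Pn _ J0.
have ik := fintype.subsetP Jk i iJ; have [k' k'E] := smooth_edge ik.
have hk' : dot (nrm_sum J) (vtx k') = off_sum S J + 1.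
  by rewrite k'E dotDr (nrm_sum_vtx p)// (nrm_sum_dual p)// iJ.
have A1' : A 1.
  exists (vtx k'); last by rewrite hk' addrAC subrr add0r.
  split; first exact: pres_vertex.
    by move=> /(face_of_vtx p) /(nrm_sum_vtx p); rewrite hk'; lra.
  have [k2 [s [s0 k2E eE Ek Ek2]]] := edge_face ik.
  exists (vtx k), (face_of S (tight S k :\ i)).
  split=> //; [exact: pres_vertex|exact/(face_of_vtx p)|].
  split; first exact: S_vtx.
  move=> j; rewrite in_setD1 => /andP[ji jk]; rewrite k'E dotDr (pres_dual p ik jk).
  by rewrite (negbTE ji) addr0; apply/tightP.
apply/eqP; rewrite eq_le; apply/andP; split; first by apply: ge_inf => //; exists 1.
by apply: lb_le_inf => //; exists 1.
Qed.

(** The height of the origin above every facet is at least one, and if there is a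
    facet at all, then there are at least two. *)
Lemma esum1 : 1 + \sum_(i : N) off S i != 0.
Proof.
have off1 (i : N) : off S i <= -1.
  have := pres_off p i; have [z ->] := off_int i; rewrite ltrz0 => z0.
  have : (z + 1)%:~R <= 0 :> R by rewrite lerz0 lezD1.
  by rewrite intrD; lra.
apply/eqP => h; case: (pickP (@predT N)) => [i0 _|none]; last first.
  by move: h; rewrite big_pred0// addr0 => /eqP; rewrite oner_eq0.
have only (i : N) : i = i0.
  apply/eqP; apply: contraT => ii0; move: h.
  rewrite (bigD1 i0)//= (bigD1 i)//=; set r := \sum_(_ | _) _.
  have r0 : r <= 0 by apply: sumr_le0 => j _; exact: le_trans (off1 j) _.
  by have := off1 i; have := off1 i0; lra.
have [k hk] := S_argmin p (- nrm i0) S0.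
have [ik|ik] := boolP (i0 \in tight S k).
  have [_ _ /(_ k i0 ik)/hk] := good1.
  rewrite dotDr dotZr !dotNl (pres_dual p ik ik) eqxx mul1r lerDl oppr_ge0.
  by rewrite ler10.
have n0 : nrm i0 = 0.
  rewrite (pres_expand p k (nrm i0)) big1// => j; rewrite (only j) => h'.
  by rewrite h' in ik.
have /andP[_ /existsP[k1]] := Delta1 p S0 i0; rewrite finset.sub1set => /tightP.
by rewrite n0 dot0l => h'; have := pres_off p i0; rewrite -h' ltxx.
Qed.

Lemma DTr_face_of J : Delta S J -> DTr S (face_of S J) = Tr 1 S (face_of S J).
Proof. by move=> DJ; rewrite /DTr depth1. Qed.

(** In the deep truncation of a face, the points at height one on the edges that
    leave the face are vertices of [S]. *)
Lemma DTr_flat F : proper_face S F -> flat_DTr S F.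
Proof.
move=> /(proper_face_of p)[J DJ ->]; rewrite /flat_DTr DTr_face_of//.
pose B := finset (fun k => ~~ (J \subset tight S k)).
have -> : [set y | vertex S y /\ ~ face_of S J y] = [set vtx k | k in [set` B]].
  apply/seteqP; split=> y.
    move=> [/vertexP[k ->] yJ]; exists k => //=; rewrite inE.
    by apply/negP => /(face_of_vtx p).
  move=> [k]; rewrite /= inE => kJ <-; split; first exact: pres_vertex.
  by move=> /(face_of_vtx p); exact/negP.
rewrite conv_hull; apply: (compatible_hull p S0 (compatible_Tr p good1 DJ)).
  have [_ gap _] := good1; move=> x hx; rewrite (Tr_face_of p)//; split.
    by rewrite (pres_ineq p) => i; apply: hull_ge hx => k _; exact/(S_off p)/(S_vtx p).
  by apply: hull_ge hx => k; rewrite inE; exact: gap.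
move=> c cc; have [[k o] + hq] := trunc_pts_chain p good1 DJ cc; rewrite inE /=.
case: o hq => [i|] hq; last by exists k; rewrite ?inE.
move=> /andP[Jk iJ]; have ik := fintype.subsetP Jk i iJ.
have [k' k'E] := smooth_edge ik; exists k'; last first.
  by move=> K /hq; rewrite /trunc_pt /= scale1r k'E.
rewrite inE; apply/negP => /(nrm_sum_vtx p).
rewrite k'E dotDr (nrm_sum_vtx p)// (nrm_sum_dual p)// iJ => /eqP.
by rewrite -subr_eq0 addrAC subrr add0r oner_eq0.
Qed.

Lemma DTr_basis : polytopal_basis (Bar S) [set DTr S F | F in proper_face S].
Proof.
have -> : [set DTr S F | F in proper_face S] = [set Tr 1 S F | F in proper_face S].
  apply/seteqP; split=> Q [F properF <-]; exists F => //;
    by have [J DJ ->] := proper_face_of p properF; rewrite DTr_face_of.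
exact: (trunc_polytopal_basis p S0 good1 esum1).
Qed.

End Smooth.

(** * The Minkowski sum of the truncations *)

Lemma minkowski_normal_fan (R : realType) (n : nat) (S : set 'rV[R]_n)
    (D : @simple_data R n) (e : R) : presents S D -> S 0 -> good S D e ->
  (forall (k : 'I_(vN D)) (J : {set 'I_(fN D)}),
     ~~ (J \subset tight S k) -> off_sum S J + e < dot (nrm_sum J) (vtx k)) ->
  normal_fan (minkowski_sum [set Tr e S F | F in proper_face S]) = Bar S.
Proof.
move=> p S0 ge gap; rewrite (truncations_set p S0); set Qs := [set _ | _ in _].
have fQ : finite_set Qs by apply: finite_image; exact: finite_finset.
have cQ Q : Qs Q -> compatible S Q (fun K : {set 'I_(fN D)} => supp Q (nrm_sum K)).
  move=> [J DJ <-]; have [lo at_] := compatible_Tr p ge DJ; split=> [K DK x Tx|c cc].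
    by rewrite (supp_Tr p ge DJ DK); exact: lo.
  have [x Tx hx] := at_ c cc; exists x => // K Kc.
  by rewrite (supp_Tr p ge DJ (cc.2 _ Kc)) hx.
apply: (compatible_normal_fan p S0 (compatible_minkowski fQ cQ)) => c G cc DG Gc.
have [J DJ [x [Tx xc xG]]] := Tr_separates p ge gap cc DG Gc.
apply: (minkowski_separates fQ cQ cc DG (_ : Qs (Tr e S (face_of S J))) Tx).
- by exists J.
- by move=> K Kc; rewrite (supp_Tr p ge DJ (cc.2 _ Kc)) xc.
- by rewrite (supp_Tr p ge DJ DG).
Qed.

Theorem theorem1p1 (R : realType) (n : nat) (S : set 'rV[R]_n)
    (polyS : polytope S) (fullS : full_dimensional S) (simpleS : simple S)
    (S0 : interior S 0) :
  (exists2 e0 : R, 0 < e0 & forall e : R, 0 < e < e0 ->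
        polytopal_basis (Bar S) [set Tr e S F | F in proper_face S] /\
        (exists2 T : set 'rV[R]_n, omnitruncation S T &
           normally_equivalent
             (minkowski_sum [set Tr e S F | F in proper_face S]) T)) /\
  (smooth S -> (forall E, edge S E -> lattice_length_one E) ->
        (forall F, proper_face S F -> flat_DTr S F) /\
        polytopal_basis (Bar S) [set DTr S F | F in proper_face S]).
Proof.
have [D p] := presentation_exists polyS fullS simpleS S0.
have S00 := mem0_interior S0; split; last first.
  move=> smoothS primS; split; first exact: (DTr_flat p S00 smoothS primS).
  exact: (DTr_basis p S00 smoothS primS).
have [d d0 hd] := small_good p.
pose s := - \sum_(i < fN D) off S i.
(* the truncations form a basis for all small [e] different from [s] *)
have s0 : 0 <= s by rewrite oppr_ge0; apply: sumr_le0 => i _; exact/ltW/(pres_off p).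
exists (if s == 0 then d else Num.min d s).
  by case: eqVneq => // sn0; rewrite lt_min d0 lt_neqAle eq_sym sn0.
move=> e /andP[e0 he].
have [ed es] : e < d /\ e + \sum_(i < fN D) off S i != 0.
  rewrite -[X in e + X]opprK -/s; move: he; case: eqVneq => [-> ed|sn0].
    by split=> //; rewrite oppr0 addr0 gt_eqF.
  by rewrite lt_min => /andP[ed es]; split=> //; rewrite subr_eq0 lt_eqF.
have [|ge gap] := hd e; first by rewrite e0.
split; first exact: (trunc_polytopal_basis p S00 ge es).
have [T oT fT] := omnitruncation_exists p S00; exists T => //.
by rewrite /normally_equivalent fT (minkowski_normal_fan p).
Qed.
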